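(* Let $K$ be a compact Hausdorff abelian topological group and $H\leq K$ a subgroup. (a) If $H$ is closed, then it is $\mathfrak{l}$-closed in $K$. (b) $H$ is $\mathfrak{l}$-closed in $K$ if and only if $H$ is realcompact. (c) $H$ is $\mathfrak{l}$-dense in $K$ if and only if it is dense in $K$ and pseudocompact. (d) $K$ is metrizable if and only if every subgroup of $K$ is $\mathfrak{l}$-closed in $K$.
   Context: $\mathbb{T}=\mathbb{R}/\mathbb{Z}$; $\hat G$ is the Pontryagin dual of an abelian topological group $G$. For a topological group $G$, $\mathcal{C}(G)$ is the set of all filter-bases on $G$ that contain (as a member) a countable subset of $G$. For a filter-base $\mathcal{F}$ on $\hat G$, put $z_{\mathcal{F}}(G)=\{\chi\in G\mid \chi(\mathcal{F})\longrightarrow 0\text{ in }\mathbb{T}\}$, where $\chi\in G$ is regarded as the character $x\mapsto x(\chi)$ of $\hat G$ and $\chi(\mathcal{F})=\{\chi(F)\mid F\in\mathcal{F}\}$. For an abelian topological group $G$ and $H\leq G$, $$\mathfrak{l}_G(H)=\bigcap\{z_{\mathcal{F}}(G)\mid \mathcal{F}\in\mathcal{C}(\hat G),\ H\leq z_{\mathcal{F}}(G)\}.$$ $H$ is $\mathfrak{l}$-closed in $G$ if $\mathfrak{l}_G(H)=H$, and $\mathfrak{l}$-dense in $G$ if $\mathfrak{l}_G(H)=G$. Realcompactness and pseudocompactness of $H$ refer to its subspace topology. *)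

(* Defs.v *)
From HB Require Import structures.
From mathcomp Require Import all_boot all_order all_algebra archimedean.
From mathcomp Require Import all_classical all_reals all_analysis.

Set Implicit Arguments.
Unset Strict Implicit.
Unset Printing Implicit Defensive.

Import GRing.Theory Num.Theory.
Import numFieldNormedType.Exports.

Local Open Scope classical_set_scope.
Local Open Scope ring_scope.

Definition int_subgroup (R : realType) : zmodClosed R :=
  GRing.ZmodClosed.clone R (@Num.int_num_subdef R) _.

(* R/Z. The quotient topology is declared by hand because [quotient_topology]
   equips the carrier with an eqType not convertible to that of the quotient
   group. *)
Definition circle (R : realType) : Type := Quotient.quot (int_subgroup R).

HB.instance Definition _ (R : realType) :=
  GRing.Zmodule.copy (circle R) (Quotient.quot (int_subgroup R)).

Section circle_topology.
Variable R : realType.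

Definition circle_proj : R -> circle R :=
  \pi_(Quotient.quot (int_subgroup R))%qT.

Definition circle_open : set (set (circle R)) :=
  [set U | open (circle_proj @^-1` U)].

Let circle_openT : circle_open setT.
Proof. exact: openT. Qed.

Let circle_openI A B : circle_open A -> circle_open B -> circle_open (A `&` B).
Proof. exact: openI. Qed.

Let circle_open_bigU (I : Type) (f : I -> set (circle R)) :
  (forall i, circle_open (f i)) -> circle_open (\bigcup_i f i).
Proof. by move=> fo; apply: bigcup_open => i _; exact: fo. Qed.

HB.instance Definition _ := isOpenTopological.Build (circle R)
  circle_openT circle_openI circle_open_bigU.

End circle_topology.

Section dual_filters.
Context (R : realType) (G : topologicalZmodType).

(* Underlying set of the Pontryagin dual. The compact-open topology is omitted:
   neither [countable_filter_bases] nor [z_] depends on it. *)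
Definition dual : Type := {x : {additive G -> circle R} | continuous x}.

Definition filter_base (T : Type) (F : set (set T)) : Prop :=
  [/\ F !=set0, forall A, F A -> A !=set0 &
      forall A B, F A -> F B -> exists2 C, F C & C `<=` A `&` B].

(* [countable] includes the finite sets. *)
Definition countable_filter_bases (T : Type) : set (set (set T)) :=
  [set F | filter_base F /\ exists2 A, F A & countable A].

Definition eval_char (chi : G) (x : dual) : circle R := sval x chi.

(* The set of images of the members of [F] generates a filter; the filter base
   converges to 0 when that filter does. *)
Definition z_ (F : set (set dual)) : set G :=
  [set chi | filter_from [set eval_char chi @` A | A in F] id
               --> (0 : circle R)].

Definition l_closure (H : set G) : set G :=
  \bigcap_(F in [set F | countable_filter_bases F /\ H `<=` z_ F]) z_ F.

Definition l_closed (H : set G) : Prop := l_closure H = H.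

Definition l_dense (H : set G) : Prop := l_closure H = setT.

End dual_filters.

Arguments l_closure R {G} H.
Arguments l_closed R {G} H.
Arguments l_dense R {G} H.

Definition homeomorphic (X Y : topologicalType) : Prop :=
  exists f : X -> Y, exists g : Y -> X,
    [/\ cancel f g, cancel g f, continuous f & continuous g].

Definition metrizable (R : realType) (X : topologicalType) : Prop :=
  exists M : metricType R, homeomorphic X M.

Definition pseudocompact (R : realType) (X : topologicalType) : Prop :=
  forall f : X -> R, continuous f -> exists M : R, forall x, `|f x| <= M.

(* Homeomorphic to a closed subspace of a power of the real line. *)
Definition realcompact (R : realType) (X : topologicalType) : Prop :=
  exists (I : Type) (C : set {ptws I -> R}), closed C /\ homeomorphic X C.

(* Main.v *)
(* A point y lies in the l-closure of H if and only if every countable family of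
   continuous characters of K agrees at y with some element of H: otherwise the
   trigonometric neighbourhoods of 0 on H give a filter base on the integer
   combinations of the family which converges at the points of H but not at y.
   So the l-closure is the closure of H for the G_delta-topology.

   Characters of K separate points from closed subgroups; this gives (a), and is
   proved without Haar measure, with an invariant mean on the bounded functions
   and an idempotent of the convolution algebra.

   For (b) and (c), the subgroup H satisfies the countable chain condition, so a
   continuous real function on H depends on countably many characters and
   extends to the l-closure.  Conversely, for y outside the l-closure, the
   inverse of a distance to y built from countably many characters is continuous
   on H and blows up at y.

   For (d), if K is not metrizable its character group is uncountable, and so is
   a maximal independent set X of characters.  The points killed by all but
   countably many members of X form an l-dense proper subgroup. *)

(* An invariant mean is defined on all bounded functions, with the group taken as discrete. The same
   tool therefore serves for convolution on [K], for averaging over a subgroup, and on the integer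
   combinations of characters. The price is finite additivity: two means need not commute. For the
   continuous kernels used here, total boundedness of the translates restores the exchange, and with
   it associativity of convolution. Spectral theory stays real. The functions are even, so
   convolution by them is self-adjoint, and the top eigenvalue is reached by iteration. Only cosines
   of characters come out of this, so sines have to be recovered from odd parts of translates. The
   step from a bound near 0 on finitely many elements to a representing element is proved for an
   abstract biadditive pairing, because it is used twice with the sides exchanged: polynomials
   against points for the closure, points against polynomials for double annihilators, on which the
   prescription of values of independent characters in (d) rests. *)
Require Import Defs.
From HB Require Import structures.
From mathcomp Require Import all_boot all_order all_algebra.
From mathcomp Require Import finmap.
From mathcomp Require Import all_classical all_reals all_analysis.
From mathcomp Require Import ring lra zify.

Set Implicit Arguments.
Unset Strict Implicit.
Unset Printing Implicit Defensive.

Import Order.TTheory GRing.Theory Num.Theory.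
Import numFieldNormedType.Exports.

Local Open Scope classical_set_scope.
Local Open Scope ring_scope.

(** * Invariant means *)

Section subgroup.
Context (G : zmodType) (H : set G) (sH : zmod_closed (mem H)).

Lemma subgroup0 : H 0.
Proof. by have [h _] := sH; exact: set_mem. Qed.

Lemma subgroupB x y : H x -> H y -> H (x - y).
Proof. by have [_ h] := sH => Hx Hy; apply/set_mem/h; exact: mem_set. Qed.

Lemma subgroupN x : H x -> H (- x).
Proof. by move=> Hx; rewrite -sub0r; apply: subgroupB => //; exact: subgroup0. Qed.

Lemma subgroupD x y : H x -> H y -> H (x + y).
Proof. by move=> Hx Hy; rewrite -[y]opprK; apply/subgroupB/subgroupN. Qed.

Lemma subgroupMn x n : H x -> H (x *+ n).
Proof.
move=> Hx; elim: n => [|n IH]; first by rewrite mulr0n; exact: subgroup0.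
by rewrite mulrS; exact: subgroupD.
Qed.

End subgroup.

Section mean.
Context (R : realType).

Definition bdd (T : Type) (f : T -> R) : Prop :=
  exists C, forall x, `|f x| <= C.

Lemma bddP (T : Type) (f : T -> R) :
  bdd f -> exists2 C, 0 < C & forall x, `|f x| <= C.
Proof.
case=> C fC; exists (`|C| + 1); first by rewrite ltr_pwDr.
by move=> x; rewrite (le_trans (fC x))// (le_trans (ler_norm _))// lerDl.
Qed.

Lemma bdd_cst (T : Type) (c : R) : bdd (fun _ : T => c).
Proof. by exists `|c|. Qed.

Lemma bddD (T : Type) (f g : T -> R) :
  bdd f -> bdd g -> bdd (fun x => f x + g x).
Proof.
move=> [C fC] [D gD]; exists (C + D) => x.
by rewrite (le_trans (ler_normD _ _))// lerD.
Qed.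

Lemma bddM (T : Type) (f g : T -> R) :
  bdd f -> bdd g -> bdd (fun x => f x * g x).
Proof.
move=> /bddP[C C0 fC] [D gD]; exists (C * D) => x.
by rewrite normrM ler_pM.
Qed.

Lemma bdd_comp (T U : Type) (f : T -> R) (h : U -> T) :
  bdd f -> bdd (fun x => f (h x)).
Proof. by move=> [C fC]; exists C => x. Qed.

Lemma bddN (T : Type) (f : T -> R) : bdd f -> bdd (fun x => - f x).
Proof. by move=> [C fC]; exists C => x; rewrite normrN. Qed.

(** All bounded functions are allowed, so that indicators have a mean. Monotonicity asks for the
    inequality on [H] only, which makes the mean blind to values off [H]. Invariance under [- x] is
    what makes convolution commutative. *)
Record invariant_mean (G : zmodType) (H : set G) (M : (G -> R) -> R) : Prop := {
  meanD : forall f g, bdd f -> bdd g -> M (fun x => f x + g x) = M f + M g;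
  meanZ : forall c f, bdd f -> M (fun x => c * f x) = c * M f;
  mean_cst : forall c, M (fun=> c) = c;
  mean_le : forall f g, bdd f -> bdd g -> (forall x, H x -> f x <= g x) ->
    M f <= M g;
  mean_shift : forall a f, H a -> bdd f -> M (fun x => f (x + a)) = M f;
  mean_opp : forall f, bdd f -> M (fun x => f (- x)) = M f }.

Section box_average.
Context (G : zmodType).

Definition avg (n : nat) (a : G) (f : G -> R) : G -> R :=
  fun x => n.+1%:R^-1 * \sum_(k < n.+1) f (x + a *+ k).

(** For [i = (s, n)] this averages over the sums of multiples [a *+ k], with [k <= n], of the
    entries [a] of [s]: a Folner box, with multiplicities, of the group generated by [s]. *)
Definition box_avg (i : seq G * nat) (f : G -> R) : G -> R :=
  foldr (avg i.2) f i.1.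

Lemma avgD n a f g : avg n a (fun x => f x + g x) =
  fun x => avg n a f x + avg n a g x.
Proof. by apply/funext => x; rewrite /avg big_split mulrDr. Qed.

Lemma avgZ n a c f : avg n a (fun x => c * f x) = fun x => c * avg n a f x.
Proof. by apply/funext => x; rewrite /avg -mulr_sumr mulrCA. Qed.

Lemma avg_cst n a c : avg n a (fun=> c) = fun=> c.
Proof.
apply/funext => x; rewrite /avg sumr_const card_ord -[c *+ _]mulr_natr mulrC.
by rewrite mulfK// pnatr_eq0.
Qed.

Lemma avg_shift n a b f :
  avg n a (fun x => f (x + b)) = fun x => avg n a f (x + b).
Proof.
by apply/funext => x; congr (_ * _); apply: eq_bigr => k _; rewrite addrAC.
Qed.

Lemma avg_le (H : set G) n a f g : zmod_closed (mem H) -> H a ->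
  (forall x, H x -> f x <= g x) -> forall x, H x -> avg n a f x <= avg n a g x.
Proof.
move=> sH Ha fg x Hx; rewrite ler_pM2l ?invr_gt0 ?ltr0n//.
apply: ler_sum => k _; apply: fg.
by apply: (subgroupD sH) => //; exact: subgroupMn.
Qed.

Lemma box_avgD i f g : box_avg i (fun x => f x + g x) =
  fun x => box_avg i f x + box_avg i g x.
Proof. by case: i => s n; rewrite /box_avg/=; elim: s => //= a s ->; exact: avgD. Qed.

Lemma box_avgZ i c f : box_avg i (fun x => c * f x) =
  fun x => c * box_avg i f x.
Proof. by case: i => s n; rewrite /box_avg/=; elim: s => //= a s ->; exact: avgZ. Qed.

Lemma box_avg_cst i c : box_avg i (fun=> c) = fun=> c.
Proof.
by case: i => s n; rewrite /box_avg/=; elim: s => //= a s ->; exact: avg_cst.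
Qed.

Lemma box_avg_shift i b f :
  box_avg i (fun x => f (x + b)) = fun x => box_avg i f (x + b).
Proof.
by case: i => s n; rewrite /box_avg/=; elim: s => //= a s ->; exact: avg_shift.
Qed.

Lemma box_avg_le (H : set G) i f g : zmod_closed (mem H) ->
  (forall a, a \in i.1 -> H a) -> (forall x, H x -> f x <= g x) ->
  forall x, H x -> box_avg i f x <= box_avg i g x.
Proof.
move=> sH; case: i => s n; rewrite /box_avg/=; elim: s => //= a s IH sHs fg.
apply: avg_le => //; first by apply: sHs; rewrite mem_head.
by apply: IH => // b bs; apply: sHs; rewrite inE bs orbT.
Qed.

Lemma zmod_closed_setT : zmod_closed (mem [set: G]).
Proof. by split=> [|x y _ _]; rewrite inE. Qed.

Lemma box_avg_norm i f C : (forall x, `|f x| <= C) ->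
  forall x, `|box_avg i f x| <= C.
Proof.
move=> fC x; rewrite ler_norml; apply/andP; split.
- rewrite -[- C]/((fun=> - C) x) -(box_avg_cst i).
  apply: (box_avg_le zmod_closed_setT) => // y _.
  by have := fC y; rewrite ler_norml => /andP[].
- rewrite -[C]/((fun=> C) x) -(box_avg_cst i).
  apply: (box_avg_le zmod_closed_setT) => // y _.
  by have := fC y; rewrite ler_norml => /andP[].
Qed.

(** The average in direction [a] telescopes to two end terms. The averages in the other directions
    commute with translation and do not increase a bound. *)
Lemma box_avg_almost_invariant i a f C : a \in i.1 ->
  (forall x, `|f x| <= C) ->
  forall x, `|box_avg i f (x + a) - box_avg i f x| <= 2 * C / i.2.+1%:R.
Proof.
case: i => s n; rewrite /box_avg/= => + fC.
elim: s => //= b s IH; rewrite inE => /orP[/eqP <-{b}|].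
  move=> x; set h := foldr _ _ _; rewrite /avg -mulrBr -sumrB.
  have hC y : `|h y| <= C by exact: (box_avg_norm (s, n)).
  under eq_bigr do rewrite -addrA -mulrS.
  rewrite -(big_mkord xpredT (fun k => h (x + a *+ k.+1) - h (x + a *+ k))).
  rewrite telescope_sumr// mulr0n addr0 normrM.
  rewrite ger0_norm ?invr_ge0// mulrC ler_pM2r ?invr_gt0 ?ltr0n//.
  by rewrite (le_trans (ler_normB _ _))// mulrDl mul1r lerD.
move=> /IH{}IH x; have := box_avg_norm ([:: b], n) IH x.
rewrite /box_avg/=.
suff -> : (fun x0 => foldr (avg n) f s (x0 + a) - foldr (avg n) f s x0) =
  (fun x0 => foldr (avg n) f s (x0 + a) + (-1) * foldr (avg n) f s x0).
  by rewrite avgD avgZ avg_shift mulN1r.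
by apply/funext => y; rewrite mulN1r.
Qed.

End box_average.

Lemma ultra_bounded_cvg (I : Type) (U : set_system I) (f : I -> R) :
  UltraFilter U -> bdd f -> cvg (f @ U).
Proof.
move=> UU [C fC].
have /= := @segment_compact R (- C) C; rewrite compact_ultra => /(_ (f @ U)).
case=> [||p [_ fp]].
- split; first exact: fmap_proper_filter.
  move=> V VF fUV; rewrite predeqE => A; split=> [VA|]; last exact: fUV.
  have [fA|UCA] := in_ultra_setVsetC (f @^-1` A) UU; first exact: fA.
  by have [x []] := filter_ex (filterI VA (fUV (~` A) UCA)).
- by apply: nearW => i /=; rewrite in_itv/= -ler_norml.
- by apply/cvg_ex; exists p.
Qed.

(* The mean only sees the values on [H]: the box averages run over boxes of [H]
   and are evaluated at 0. *)
Lemma invariant_mean_exists (G : zmodType) (H : set G) :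
  zmod_closed (mem H) -> exists M : (G -> R) -> R, invariant_mean H M.
Proof.
move=> sH.
pose D := [set i : seq G * nat | forall a, a \in i.1 -> H a].
pose B (i : seq G * nat) :=
  [set j | D j /\ ({subset i.1 <= j.1} /\ (i.2 <= j.2)%N)].
have FF : ProperFilter (filter_from D B).
  apply: filter_from_proper; last first.
    by move=> i Di; exists i; split=> //; split.
  apply: filter_from_filter; first by exists ([::], 0).
  move=> i j Di Dj; exists (i.1 ++ j.1, maxn i.2 j.2).
    by move=> a; rewrite mem_cat => /orP[/Di|/Dj].
  move=> k /= [Dk [sk nk]]; split; split=> //; split.
  - by move=> a ai; apply: sk; rewrite mem_cat ai.
  - exact: leq_trans (leq_maxl _ _) nk.
  - by move=> a ai; apply: sk; rewrite mem_cat ai orbT.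
  - exact: leq_trans (leq_maxr _ _) nk.
(* Along an ultrafilter finer than the filter of growing boxes, every bounded family of averages has
   a limit. *)
have [U [UU FU]] := ultraFilterLemma FF.
have H0 := subgroup0 sH.
pose A (f : G -> R) i := box_avg i f 0.
have cvA (f : G -> R) : bdd f -> cvg (A f @ U).
  move=> [C fC]; apply: ultra_bounded_cvg; exists C => i.
  exact: box_avg_norm.
have UD : U D.
  by apply: FU; exists ([::], 0) => //= i [].
pose M (f : G -> R) := lim (A f @ U).
have MD f g : bdd f -> bdd g -> M (fun x => f x + g x) = M f + M g.
  move=> bf bg; rewrite /M -limD; try exact: cvA.
  by congr (lim (_ @ U)); apply/funext => i; rewrite /A box_avgD.
have MZ c f : bdd f -> M (fun x => c * f x) = c * M f.
  move=> bf; apply: cvg_lim => //.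
  rewrite (_ : A _ = fun i => c * A f i); last first.
    by apply/funext => i; rewrite /A box_avgZ.
  by apply: cvgM; [exact: cvg_cst|exact: cvA].
have Mc c : M (fun=> c) = c.
  rewrite /M (_ : A (fun=> c) = fun=> c) ?lim_cst//.
  by apply/funext => i; rewrite /A box_avg_cst.
have Mle f g : bdd f -> bdd g -> (forall x, H x -> f x <= g x) -> M f <= M g.
  move=> bf bg fg; have cf := cvA f bf; have cg := cvA g bg.
  rewrite -subr_ge0 -limB//; apply: limr_ge; first exact: is_cvgB.
  near=> i; rewrite subr_ge0; apply: (@box_avg_le _ H) => //; exact: (near UD i).
have Msh a f : H a -> bdd f -> M (fun x => f (x + a)) = M f.
  move=> Ha bf; apply/eqP; rewrite /M -subr_eq0 -limB; last 2 first.
  + by apply: cvA; exact: bdd_comp.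
  + exact: cvA.
  apply/eqP; apply: cvg_lim => //; apply/cvgr0Pnorm_le => e e0.
  have [C C0 fC] := bddP bf.
  have [n nP] : exists n : nat, 2 * C / n.+1%:R <= e.
    exists (Num.truncn (2 * C / e)).
    rewrite ler_pdivrMr ?ltr0n// -ler_pdivrMl// [e^-1 * _]mulrC.
    exact/ltW/truncnS_gt.
  apply: FU; exists ([:: a], n).
    by move=> b /=; rewrite inE => /eqP ->.
  move=> i [_ /= [sa ni]]; rewrite /A.
  rewrite [X in `|X|](_ : _ = box_avg i f (0 + a) - box_avg i f 0); last first.
    by rewrite -[box_avg i f (0 + a)]/((fun x => box_avg i f (x + a)) 0)
      -box_avg_shift.
  have ai : a \in i.1 by apply: sa; rewrite inE.
  rewrite (le_trans (box_avg_almost_invariant ai fC 0))//.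
  rewrite (le_trans _ nP)// ler_wpM2l//; first by rewrite mulr_ge0// ltW.
  by rewrite lef_pV2 ?posrE ?ltr0n// ler_nat.
have bN (f : G -> R) : bdd f -> bdd (fun x => f (- x)) by exact: bdd_comp.
(* Averaging with the reflected mean forces invariance under [- x]; a translation by [a] moves the
   reflected function by [- a], which is still in [H]. *)
exists (fun f => 2^-1 * (M f + M (fun x => f (- x)))); split.
- by move=> f g bf bg; rewrite !MD//; [rewrite addrACA mulrDr|exact: bN..].
- by move=> c f bf; rewrite !MZ//; [rewrite -mulrDr mulrCA|exact: bN].
- by move=> c; rewrite Mc; lra.
- move=> f g bf bg fg; rewrite ler_pM2l ?invr_gt0// lerD ?Mle//.
  + exact: bN.
  + exact: bN.
  + by move=> x Hx; apply/fg/(subgroupN sH).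
- move=> a f Ha bf; rewrite (Msh a f)//; congr (_ * (_ + _)).
  rewrite -(Msh (- a) (fun x => f (- x))); last 2 first.
  + exact: subgroupN.
  + exact: bN.
  by under [in RHS]eq_fun do rewrite opprB addrC.
- by move=> f bf; under [X in _ + M X]eq_fun do rewrite opprK; rewrite addrC.
Unshelve. all: by end_near.
Qed.

Section mean_theory.
Context (G : zmodType) (H : set G) (M : (G -> R) -> R).
Hypothesis HM : invariant_mean H M.

Lemma meanN f : bdd f -> M (fun x => - f x) = - M f.
Proof.
move=> bf; rewrite -mulN1r -(meanZ HM)//.
by under [in RHS]eq_fun do rewrite mulN1r.
Qed.

Lemma meanB f g : bdd f -> bdd g -> M (fun x => f x - g x) = M f - M g.
Proof. by move=> bf bg; rewrite (meanD HM)// ?meanN//; exact: bddN. Qed.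

Lemma mean_eq f g : bdd f -> bdd g -> (forall x, H x -> f x = g x) -> M f = M g.
Proof.
move=> bf bg fg; apply/le_anti/andP; split; apply: (mean_le HM) => // x Hx;
  by rewrite fg.
Qed.

Lemma mean_ge f c : bdd f -> (forall x, H x -> c <= f x) -> c <= M f.
Proof.
move=> bf fc; rewrite -[leLHS](mean_cst HM); apply: (mean_le HM) => //.
exact: bdd_cst.
Qed.

Lemma mean_norm f C : bdd f -> (forall x, H x -> `|f x| <= C) -> `|M f| <= C.
Proof.
move=> bf fC; rewrite ler_norml; apply/andP; split.
  by apply: mean_ge => // x /fC; rewrite ler_norml => /andP[].
rewrite -[leRHS](mean_cst HM); apply: (mean_le HM) => //; first exact: bdd_cst.
by move=> x /fC; rewrite ler_norml => /andP[].
Qed.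

Lemma mean_dist f g e : bdd f -> bdd g ->
  (forall x, H x -> `|f x - g x| <= e) -> `|M f - M g| <= e.
Proof.
move=> bf bg fg; rewrite -meanB//; apply: mean_norm => //.
by apply: bddD => //; exact: bddN.
Qed.

Lemma bdd_sum (T I : Type) (s : seq I) (f : I -> T -> R) :
  (forall i, bdd (f i)) -> bdd (fun x => \sum_(i <- s) f i x).
Proof.
move=> bf; elim: s => [|i s IH].
  by under eq_fun do rewrite big_nil; exact: bdd_cst.
by under eq_fun do rewrite big_cons; exact: bddD.
Qed.

Lemma mean_sum (I : Type) (s : seq I) (f : I -> G -> R) :
  (forall i, bdd (f i)) ->
  M (fun x => \sum_(i <- s) f i x) = \sum_(i <- s) M (f i).
Proof.
move=> bf; elim: s => [|i s IH].
  by under eq_fun do rewrite big_nil; rewrite big_nil (mean_cst HM).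
under eq_fun do rewrite big_cons.
by rewrite big_cons (meanD HM)// ?IH//; exact: bdd_sum.
Qed.

(* Finitely many translates of [W] cover [H], so one of them, hence each of
   them, has positive mean. *)
Lemma mean_gt0 (s : seq G) (W : set G) : (forall a, a \in s -> H a) ->
  (forall x, H x -> exists2 a, a \in s & W (x - a)) ->
  0 < M (\1_W).
Proof.
move=> sH sW.
have b1 : bdd (\1_W : G -> R).
  by exists 1 => x; rewrite indicE; case: (_ \in _); rewrite ?normr1 ?normr0.
rewrite lt_neqAle; apply/andP; split; last first.
  by apply: mean_ge => // x _; rewrite indicE.
apply/eqP => M0.
have : 1 <= M (fun x => \sum_(a <- s | a \in s) (\1_W (x - a) : R)).
  under eq_fun do rewrite -big_seq.
  apply: mean_ge.
    by apply: bdd_sum => a; exact: bdd_comp.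
  move=> x /sW[a sa Wxa]; rewrite (big_rem a)//= indicE mem_set//.
  by rewrite lerDl sumr_ge0.
under eq_fun do rewrite -big_seq.
rewrite mean_sum; last by move=> a; exact: bdd_comp.
rewrite big_seq big1 ?ler10// => a sa.
by rewrite -[LHS](mean_shift HM (sH a sa)) //; [under eq_fun do rewrite addrK|exact: bdd_comp].
Qed.

End mean_theory.

End mean.

(** * The circle and characters *)

Section circle.
Context (R : realType).
Implicit Types (z w : circle R) (x y : R).

Local Notation proj := (@circle_proj R).

(** Coordinates on the unit circle. [repr] picks some real representative, and periodicity makes the
    choice harmless. *)
Definition circ_cos z : R := cos (2 * pi * repr z).
Definition circ_sin z : R := sin (2 * pi * repr z).

Lemma circle_projD x y : proj (x + y) = proj x + proj y.
Proof. by rewrite /circle_proj Quotient.pi_add. Qed.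

Lemma circle_proj0 : proj 0 = 0.
Proof. by apply: (@addrI _ (proj 0)); rewrite -circle_projD !addr0. Qed.

Lemma circle_projN x : proj (- x) = - proj x.
Proof.
by apply/eqP; rewrite -subr_eq0 opprK -circle_projD addNr circle_proj0.
Qed.

Lemma circle_projK z : proj (repr z) = z.
Proof. exact: reprK. Qed.

Lemma circle_proj_eqP x y :
  reflect (exists n : int, x - y = n%:~R) (proj x == proj y).
Proof.
have -> : (proj x == proj y) = (x - y \is a Num.int).
  by rewrite /circle_proj -Quotient.idealrBE.
exact: intrP.
Qed.

Lemma cos_sin2piDint x (n : int) :
  cos (2 * pi * (x + n%:~R)) = cos (2 * pi * x) /\
  sin (2 * pi * (x + n%:~R)) = sin (2 * pi * x).
Proof.
have nat_case y (m : nat) : cos (2 * pi * (y + m%:R)) = cos (2 * pi * y) /\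
    sin (2 * pi * (y + m%:R)) = sin (2 * pi * y).
  have -> : 2 * pi * (y + m%:R) = 2 * pi * y + (pi *+ 2) *+ m.
    by rewrite mulrDr -[(pi *+ 2) *+ m]mulr_natr -[pi *+ 2]mulr_natl.
  by rewrite (periodicn (@cosD2pi R)) (periodicn (@sinD2pi R)).
case: n => m; first exact: nat_case.
have := nat_case (x + (Negz m)%:~R) m.+1; rewrite NegzE mulrNz.
by rewrite -[m.+1%:~R]/(m.+1%:R) subrK => -[-> ->].
Qed.

Lemma circ_cos_proj x : circ_cos (proj x) = cos (2 * pi * x).
Proof.
have /circle_proj_eqP[n xn] : proj x == proj (repr (proj x)).
  by rewrite circle_projK.
have -> : x = repr (proj x) + n%:~R by rewrite -xn addrC subrK.
by rewrite (cos_sin2piDint _ n).1 -xn addrC subrK.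
Qed.

Lemma circ_sin_proj x : circ_sin (proj x) = sin (2 * pi * x).
Proof.
have /circle_proj_eqP[n xn] : proj x == proj (repr (proj x)).
  by rewrite circle_projK.
have -> : x = repr (proj x) + n%:~R by rewrite -xn addrC subrK.
by rewrite (cos_sin2piDint _ n).2 -xn addrC subrK.
Qed.

Lemma circ_cosD z w :
  circ_cos (z + w) = circ_cos z * circ_cos w - circ_sin z * circ_sin w.
Proof.
rewrite -[z]circle_projK -[w]circle_projK -circle_projD.
by rewrite !circ_cos_proj !circ_sin_proj mulrDr cosD.
Qed.

Lemma circ_sinD z w :
  circ_sin (z + w) = circ_sin z * circ_cos w + circ_cos z * circ_sin w.
Proof.
rewrite -[z]circle_projK -[w]circle_projK -circle_projD.
by rewrite !circ_cos_proj !circ_sin_proj mulrDr sinD.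
Qed.

Lemma circ_cos0 : circ_cos 0 = 1.
Proof. by rewrite -circle_proj0 circ_cos_proj mulr0 cos0. Qed.

Lemma circ_cosN z : circ_cos (- z) = circ_cos z.
Proof.
by rewrite -[z]circle_projK -circle_projN !circ_cos_proj mulrN cosN.
Qed.

Lemma circ_sinN z : circ_sin (- z) = - circ_sin z.
Proof.
by rewrite -[z]circle_projK -circle_projN !circ_sin_proj mulrN sinN.
Qed.

Lemma circ_cos2Dsin2 z : circ_cos z ^+ 2 + circ_sin z ^+ 2 = 1.
Proof. exact: cos2Dsin2. Qed.

Lemma circ_cos_le1 z : circ_cos z <= 1.
Proof. exact: cos_le1. Qed.

Lemma circ_cos_geN1 z : -1 <= circ_cos z.
Proof. exact: cos_geN1. Qed.

Lemma circ_cos_max z : `|circ_cos z| <= 1.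
Proof. exact: cos_max. Qed.

Lemma circ_sin_max z : `|circ_sin z| <= 1.
Proof. exact: sin_max. Qed.

Lemma circle_proj_half z : exists2 x, `|x| <= 2^-1 & z = proj x.
Proof.
exists (repr z - (Num.floor (repr z + 2^-1))%:~R).
  have := floor_itv (repr z + 2^-1); rewrite intrD1.
  set n := (Num.floor _)%:~R; set t : R := repr z => /andP[h1 h2].
  rewrite ler_norml; apply/andP; split; lra.
rewrite -[LHS]circle_projK; apply/eqP/circle_proj_eqP.
by exists (Num.floor (repr z + 2^-1)); rewrite opprB addrC subrK.
Qed.

Lemma mem_itv_2pi x : 0 <= x <= 2^-1 -> 2 * pi * x \in `[0, pi].
Proof.
move=> /andP[x0 x2]; have p0 := @pi_gt0 R.
rewrite in_itv/= -[2 * pi * x]mulrA mulrCA; apply/andP; split.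
  by rewrite mulr_ge0 ?(ltW p0)// mulr_ge0.
by rewrite -[leRHS]mulr1 ler_pM2l//; lra.
Qed.

Lemma circ_cos_gt_norm x y : `|x| <= 2^-1 -> 0 < y -> y <= 2^-1 ->
  cos (2 * pi * y) < circ_cos (proj x) -> `|x| < y.
Proof.
move=> x2 y0 y2; have p0 := @pi_gt0 R.
rewrite circ_cos_proj -[ltRHS]cos_norm normrM gtr0_norm; last by rewrite mulr_gt0.
rewrite ltr_cos; last 2 first.
- by apply: mem_itv_2pi; rewrite normr_ge0.
- by apply: mem_itv_2pi; rewrite ltW.
by rewrite ltr_pM2l// mulr_gt0.
Qed.

Lemma circ_cos_eq1 z : circ_cos z = 1 -> z = 0.
Proof.
have [x x2 ->] := circle_proj_half z => x1.
suff -> : x = 0 by rewrite circle_proj0.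
apply/eqP; rewrite -normr_eq0; apply/eqP/le_anti; rewrite normr_ge0 andbT.
apply/ler_addgt0Pl => e e0; rewrite addr0.
have [e2|/ltW e2] := leP e 2^-1; last exact: le_trans e2.
apply/ltW/(circ_cos_gt_norm x2 e0 e2); rewrite x1.
have p0 := @pi_gt0 R.
rewrite -[ltRHS](@cos0 R) ltr_cos ?mulr_gt0//.
  by rewrite in_itv/= lexx ltW.
by apply: mem_itv_2pi; rewrite ltW.
Qed.

Lemma circ_inj z w :
  circ_cos z = circ_cos w -> circ_sin z = circ_sin w -> z = w.
Proof.
move=> zw1 zw2; apply/eqP; rewrite -subr_eq0; apply/eqP/circ_cos_eq1.
rewrite circ_cosD circ_cosN circ_sinN zw1 zw2 mulrN opprK -!expr2.
exact: circ_cos2Dsin2.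
Qed.

Lemma circ_surj (c s : R) : c ^+ 2 + s ^+ 2 = 1 ->
  exists z, circ_cos z = c /\ circ_sin z = s.
Proof.
move=> cs1.
have c1 : -1 <= c <= 1.
  by apply/andP; have := sqr_ge0 s; split; nra.
have p0 := @pi_gt0 R.
have p20 : (2 * pi : R) != 0 by rewrite mulf_neq0// gt_eqF.
have s2 : Num.sqrt (1 - c ^+ 2) = `|s|.
  by rewrite -cs1 addrAC subrr add0r sqrtr_sqr.
have [s0|s0] := leP 0 s.
- exists (proj (acos c / (2 * pi))).
  rewrite circ_cos_proj circ_sin_proj mulrC divfK// acosK ?in_itv//=.
  by rewrite sin_acos// s2 ger0_norm.
- exists (proj (- (acos c / (2 * pi)))).
  rewrite circ_cos_proj circ_sin_proj mulrN cosN sinN mulrC divfK//.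
  by rewrite acosK ?in_itv//= sin_acos// s2 ltr0_norm// opprK.
Qed.

Lemma continuous_circle_proj : continuous proj.
Proof. by apply/continuousP => U. Qed.

Lemma continuous_circ_cos : continuous circ_cos.
Proof.
apply/continuousP => U oU.
suff : open ((fun x => cos (2 * pi * x)) @^-1` U).
  by under eq_fun do rewrite -circ_cos_proj.
move: U oU; apply/continuousP => x; apply: continuous_comp.
  exact: mulrl_continuous.
exact: continuous_cos.
Qed.

Lemma continuous_circ_sin : continuous circ_sin.
Proof.
apply/continuousP => U oU.
suff : open ((fun x => sin (2 * pi * x)) @^-1` U).
  by under eq_fun do rewrite -circ_sin_proj.
move: U oU; apply/continuousP => x; apply: continuous_comp.
  exact: mulrl_continuous.
exact: continuous_sin.
Qed.

(** Representatives of [w - z] can be taken in [[-1/2, 1/2]], where the cosine of [2 * pi * x]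
    decreases with [|x|]. A lower bound on the cosine is thus an upper bound on the distance. *)
Lemma nbhs_circleP z (U : set (circle R)) : nbhs z U ->
  exists2 d, 0 < d & forall w, 1 - d < circ_cos (w - z) -> U w.
Proof.
rewrite nbhsE => -[V [oV Vz] VU].
have : nbhs (repr z) (proj @^-1` V).
  by apply: open_nbhs_nbhs; split=> //=; rewrite circle_projK.
move=> /nbhs_ballP[r /= r0 rV].
pose r' := Num.min r 2^-1.
have r'0 : 0 < r' by rewrite lt_min r0/= invr_gt0.
have r'2 : r' <= 2^-1 by rewrite ge_min lexx orbT.
exists (1 - cos (2 * pi * r')).
  have p0 := @pi_gt0 R.
  rewrite subr_gt0 -[ltRHS](@cos0 R) ltr_cos ?mulr_gt0//.
    by rewrite in_itv/= lexx ltW.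
  by apply: mem_itv_2pi; rewrite ltW.
move=> w; rewrite subKr; have [x x2 wz] := circle_proj_half (w - z).
rewrite wz => /(circ_cos_gt_norm x2 r'0 r'2) xr; apply: VU.
rewrite -[w](subrK z) wz -[z]circle_projK -circle_projD.
apply: rV; rewrite /ball/= opprD addrCA subrr addr0 normrN.
by rewrite (lt_le_trans xr)// ge_min lexx.
Qed.

Lemma nbhs0_circ_cos (d : R) : 0 < d ->
  nbhs (0 : circle R) [set w | 1 - d < circ_cos w].
Proof.
move=> d0; apply: (@continuous_circ_cos 0 [set y | 1 - d < y]).
by apply: lt_nbhsr; rewrite circ_cos0 gtrBl.
Qed.

(** The circle has no small subgroups. Were all these cosines above [- 2^-1], the duplication
    formula would make them positive, and then [1 - circ_cos] would at least double along
    [z *+ (2 ^ k)] while staying below 1. *)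
Lemma circ_cos_mulrn_le z : z != 0 -> exists n, circ_cos (z *+ n) <= - 2^-1.
Proof.
move=> z0; apply: contrapT => /forallNP h.
have {}h n : - 2^-1 < circ_cos (z *+ n) by rewrite ltNge; exact/negP.
have dbl n : circ_cos (z *+ n.*2) = 2 * circ_cos (z *+ n) ^+ 2 - 1.
  rewrite -addnn mulrnDr circ_cosD; have := circ_cos2Dsin2 (z *+ n); lra.
have c1 n : circ_cos (z *+ n) <= 1 by exact: circ_cos_le1.
have pos n : 1 - circ_cos (z *+ n) < 1.
  have := h n.*2; rewrite dbl; have := h n; have := c1 n.
  set c := circ_cos _ => c1' hc hd; nra.
pose s k := 1 - circ_cos (z *+ (2 ^ k)).
have sS k : 2 * s k <= s k.+1.
  rewrite /s expnS mul2n dbl; have := pos (2 ^ k)%N; have := c1 (2 ^ k)%N.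
  set c := circ_cos _ => c1' hc; nra.
have s_ge k : (2 ^ k)%:R * s 0%N <= s k.
  elim: k => [|k IH]; first by rewrite mul1r.
  by rewrite expnS natrM -mulrA (le_trans _ (sS k))// ler_pM2l.
have s0 : 0 < s 0%N.
  rewrite /s mulr1n subr_gt0 lt_neqAle circ_cos_le1 andbT.
  by apply: contra z0 => /eqP/circ_cos_eq1 ->.
have [k kP] : exists k : nat, (s 0%N)^-1 < k%:R.
  by exists (Num.truncn (s 0%N)^-1).+1; exact: truncnS_gt.
have := s_ge k; rewrite leNgt => /negP; apply.
have h1 : 1 <= (2 ^ k)%:R * s 0%N.
  by rewrite -ler_pdivrMr// mul1r (le_trans (ltW kP))// ler_nat ltnW// ltn_expl.
exact: lt_le_trans (pos _) h1.
Qed.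

End circle.

Section character.
Context (R : realType) (K : topologicalZmodType).

Lemma continuous_translate (a : K) : continuous (fun x : K => x + a).
Proof.
move=> x; apply: (@continuous_comp _ _ _ (fun x => (x, a))
  (fun x : K * K => x.1 + x.2)); last exact: add_continuous.
by apply: cvg_pair; [exact: cvg_id|exact: cvg_cst].
Qed.

Definition character (f : K -> circle R) : Prop :=
  (forall x y, f (x + y) = f x + f y) /\ continuous f.

Lemma character0 f : character f -> f 0 = 0.
Proof. by move=> [fD _]; apply: (@addrI _ (f 0)); rewrite -fD !addr0. Qed.

Lemma characterN f x : character f -> f (- x) = - f x.
Proof.
move=> cf; have [fD _] := cf; apply: (@addrI _ (f x)).
by rewrite -fD !subrr character0.
Qed.

Lemma characterB f x y : character f -> f (x - y) = f x - f y.
Proof. by move=> cf; rewrite cf.1 characterN. Qed.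

Lemma characterMn f x n : character f -> f (x *+ n) = f x *+ n.
Proof.
move=> cf; elim: n => [|n IH]; first by rewrite !mulr0n character0.
by rewrite !mulrS cf.1 IH.
Qed.

(** By additivity [f y - f x = f (y - x)], and closeness to 0 in the circle is measured by the
    cosine, so continuity of the cosine at 0 suffices. *)
Lemma character_continuous_cos f : (forall x y, f (x + y) = f x + f y) ->
  continuous (fun x => circ_cos (f x)) -> character f.
Proof.
move=> fD cf; split=> // x U /nbhs_circleP[d d0 dU].
have f0 : f 0 = 0 by apply: (@addrI _ (f 0)); rewrite -fD !addr0.
have fN y : f (- y) = - f y.
  by apply: (@addrI _ (f y)); rewrite -fD !subrr.
have : \forall y \near x, 1 - d < circ_cos (f (y - x)).
  have : (fun y => circ_cos (f (y - x))) @ x --> circ_cos (f (x - x)).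
    apply: (@continuous_comp _ _ _ (fun y => y - x) (fun y => circ_cos (f y)) x).
      exact: continuous_translate.
    exact: cf.
  by move=> /cvgr_gt; apply; rewrite subrr f0 circ_cos0 gtrBl.
by apply: filterS => y; rewrite fD fN => /dU.
Qed.

Lemma continuous_cos_character f :
  character f -> continuous (fun x => circ_cos (f x)).
Proof.
by move=> [_ cf] x; apply: continuous_comp; [exact: cf|exact: continuous_circ_cos].
Qed.

Lemma continuous_sin_character f :
  character f -> continuous (fun x => circ_sin (f x)).
Proof.
by move=> [_ cf] x; apply: continuous_comp; [exact: cf|exact: continuous_circ_sin].
Qed.

Lemma character_cst0 : character (fun=> 0).
Proof. by split=> [x y|x]; [rewrite addr0|exact: cvg_cst]. Qed.

Lemma characterD_character f g :
  character f -> character g -> character (fun x => f x + g x).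
Proof.
move=> cf cg; apply: character_continuous_cos.
  by move=> x y; rewrite cf.1 cg.1 addrACA.
move=> x; under eq_fun do rewrite circ_cosD.
apply: cvgB; apply: cvgM.
- exact: continuous_cos_character.
- exact: continuous_cos_character.
- exact: continuous_sin_character.
- exact: continuous_sin_character.
Qed.

Lemma characterN_character f : character f -> character (fun x => - f x).
Proof.
move=> cf; apply: character_continuous_cos.
  by move=> x y; rewrite cf.1 opprD.
under eq_fun do rewrite circ_cosN.
exact: continuous_cos_character.
Qed.

End character.

(** Total boundedness with representatives in the image of an arbitrary map [f]. Otherwise the
    points sharing no [U x] with a given list generate a filter, and a cluster point [x] of its
    image has in [U x] both some [f a] and some [f t] with [t] avoiding [a]. *)
Lemma compact_finite_reps (T : eqType) (X : topologicalType) (f : T -> X)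
    (U : X -> set X) : compact [set: X] -> (forall x, nbhs x (U x)) ->
  exists s : seq T, forall t, exists2 a, a \in s &
    exists x, U x (f t) /\ U x (f a).
Proof.
move=> cX nU; apply: contrapT => /forallNP no.
pose B (s : seq T) := [set t | forall a, a \in s ->
  forall x, ~ (U x (f t) /\ U x (f a))].
have BF : ProperFilter (filter_from setT B).
  apply: filter_from_proper; last first.
    move=> s _; apply: contrapT => Bs; apply: (no s) => t.
    apply: contrapT => h; apply: Bs; exists t => a sa x Ux.
    by apply: h; exists a => //; exists x.
  apply: filter_from_filter; first by exists [::].
  move=> s t _ _; exists (s ++ t) => // x Bx; split=> a sa; apply: Bx;
    by rewrite mem_cat sa ?orbT.
have [x [_ xB]] := cX (f @ filter_from setT B) _ filterT.
have [_ [[t _ <-] Ut]] : (f @` [set: T]) `&` U x !=set0.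
  apply: xB (nU x); exists [::] => // t _; exact: imageP.
have [_ [[a Ba <-] Ua]] : (f @` B [:: t]) `&` U x !=set0.
  apply: xB (nU x); exists [:: t] => // a Ba; exact: imageP.
by apply: (Ba t _ x); rewrite ?inE.
Qed.

(** * Convolution and separation by characters *)

Section compact_group.
Context (R : realType) (K : topologicalZmodType).
Hypothesis cK : compact [set: K].
Implicit Types f g h : K -> R.

Lemma continuous_bdd f : continuous f -> bdd f.
Proof.
move=> cf; have : compact (f @` setT).
  by apply: continuous_compact => //; exact: continuous_subspaceT.
move=> /compact_bounded[C [_ HC]]; exists (C + 1) => x.
by apply: (HC (C + 1)); [rewrite ltrDl|exists x].
Qed.

Lemma uniform_continuity f e : continuous f -> 0 < e ->
  \forall v \near (0 : K), forall x, `|f (x + v) - f x| < e.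
Proof.
move=> cf e0.
have H : \forall v \near (0 : K), [set: K] `<=` (fun x => `|f (x + v) - f x| < e).
  apply: ((compact_near_coveringP [set: K]).1 cK K (nbhs 0)
    (fun v x => `|f (x + v) - f x| < e)) => x _.
  have c1 : continuous (fun p : K * K => f (p.1 + p.2)).
    move=> p; apply: (@continuous_comp _ _ _ (fun p : K * K => p.1 + p.2) f).
      exact: add_continuous.
    exact: cf.
  have c2 : continuous (fun p : K * K => f p.1).
    move=> p; apply: (@continuous_comp _ _ _ fst f); last exact: cf.
    exact: cvg_fst.
  have c3 : f (p.1 + p.2) - f p.1 @[p --> (x, 0 : K)] --> (0 : R).
    have -> : (0 : R) = f ((x, 0 : K).1 + (x, 0 : K).2) - f (x, 0 : K).1.
      by rewrite /= addr0 subrr.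
    by apply: cvgB; [exact: c1|exact: c2].
  by move/cvgr0_norm_lt : c3 => /(_ e e0); apply: filterS => -[].
by apply: filterS H => v Hv x; exact: Hv.
Qed.

(** One list serves both functions, since in the proof of associativity two factors of the integrand
    vary at once. *)
Lemma uniform_cover2 f g (e : R) : continuous f -> continuous g -> 0 < e ->
  exists s : seq K, forall x, exists2 a, a \in s &
    forall y, `|f (x + y) - f (a + y)| <= e /\ `|g (x + y) - g (a + y)| <= e.
Proof.
move=> cf cg e0; have e20 : 0 < e / 2 by rewrite divr_gt0.
pose V := [set v | forall x, `|f (x + v) - f x| < e / 2] `&`
  [set v | forall x, `|g (x + v) - g x| < e / 2].
have V0 : nbhs 0 V by apply: filterI; exact: uniform_continuity.
have nV (x : K) : nbhs x [set y | V (y - x)].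
  by apply: (@continuous_translate _ (- x) x V); rewrite subrr.
have [s sP] := compact_finite_reps (@id K) cK nV.
exists s => x; have [a sa [z [[xz xz'] [az az']]]] := sP x; exists a => // y.
have est h : (forall y, `|h (y + (x - z)) - h y| < e / 2) ->
    (forall y, `|h (y + (a - z)) - h y| < e / 2) ->
    `|h (x + y) - h (a + y)| <= e.
  move=> /(_ (z + y)) h1 /(_ (z + y)) h2.
  have zK w : z + y + (w - z) = w + y by rewrite addrC addrA subrK.
  rewrite !zK in h1 h2.
  have -> : h (x + y) - h (a + y) =
    (h (x + y) - h (z + y)) - (h (a + y) - h (z + y)) by ring.
  by rewrite (le_trans (ler_normB _ _))// [e]splitr lerD// ltW.
by split; apply: est.
Qed.

Section convolution.
Context (M : (K -> R) -> R).
Hypothesis HM : invariant_mean [set: K] M.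

(** Finitely many slices [F a] approximate all slices uniformly. Replacing [F x] by the nearby slice
    [F (i x)] turns the kernel into a finite sum of products, for which the exchange is
    linearity. *)
Lemma mean_fubini (F : K -> K -> R) : (exists C, forall x y, `|F x y| <= C) ->
  (forall e : R, 0 < e -> exists s : seq K, forall x, exists2 a, a \in s &
     forall y, `|F x y - F a y| <= e) ->
  M (fun x => M (F x)) = M (fun y => M (fun x => F x y)).
Proof.
move=> [C FC] Fs; apply/eqP; rewrite -subr_eq0 -normr_eq0; apply/eqP/le_anti.
rewrite normr_ge0 andbT; apply/ler_addgt0Pl => e e0; rewrite addr0.
have e20 : 0 < e / 2 by rewrite divr_gt0.
have [s sP] := Fs _ e20.
have sP' x : exists a, a \in s /\ forall y, `|F x y - F a y| <= e / 2.
  by have [a sa aP] := sP x; exists a.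
have [i iP] := choice sP'.
have is_ x : i x \in s by case: (iP x).
have iF x y : `|F x y - F (i x) y| <= e / 2 by case: (iP x).
have b1 x : bdd (F x) by exists C.
have b2 y : bdd (F^~ y) by exists C.
have MC x : `|M (F x)| <= C by apply: (mean_norm HM).
have MC' y : `|M (F^~ y)| <= C by apply: (mean_norm HM).
have b2' y : bdd (fun x => F (i x) y) by exists C.
have MC2 y : `|M (fun x => F (i x) y)| <= C by apply: (mean_norm HM).
have spl x y : F (i x) y = \sum_(a <- undup s) (i x == a)%:R * F a y.
  rewrite (bigD1_seq (i x)) ?mem_undup ?undup_uniq//= eqxx mul1r.
  by rewrite big1 ?addr0// => a /negPf; rewrite eq_sym => ->; rewrite mul0r.
have bi a : bdd (fun x => (i x == a)%:R : R).
  by exists 1 => x; case: eqP; rewrite ?normr1 ?normr0.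
have e1 x : M (F (i x)) = \sum_(a <- undup s) (i x == a)%:R * M (F a).
  rewrite (funext (spl x)) (mean_sum HM); last first.
    by move=> a; apply: bddM => //; exact: bdd_cst.
  by apply: eq_bigr => a _; rewrite (meanZ HM).
have e2 y : M (fun x => F (i x) y) =
    \sum_(a <- undup s) M (fun x => (i x == a)%:R) * F a y.
  rewrite (funext (spl^~ y)) (mean_sum HM); last first.
    by move=> a; apply: bddM => //; exact: bdd_cst.
  apply: eq_bigr => a _; rewrite mulrC -(meanZ HM)//.
  by congr M; apply/funext => x; rewrite mulrC.
have mid : M (fun x => M (F (i x))) = M (fun y => M (fun x => F (i x) y)).
  rewrite (funext e1) (funext e2) !(mean_sum HM); last 2 first.
  - by move=> a; apply: bddM => //; exact: bdd_cst.
  - by move=> a; apply: bddM => //; exact: bdd_cst.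
  apply: eq_bigr => a _; rewrite (meanZ HM)// mulrC -(meanZ HM)//.
  by congr M; apply/funext => x; rewrite mulrC.
have -> : M (fun x => M (F x)) - M (fun y => M (F^~ y)) =
  (M (fun x => M (F x)) - M (fun x => M (F (i x)))) +
  (M (fun y => M (fun x => F (i x) y)) - M (fun y => M (F^~ y))).
  by rewrite mid; ring.
rewrite (le_trans (ler_normD _ _))// [e]splitr lerD//.
  apply: (mean_dist HM) => [||x _]; [by exists C|by exists C|].
  exact: (mean_dist HM).
apply: (mean_dist HM) => [||y _]; [by exists C|by exists C|].
by apply: (mean_dist HM) => // x _; rewrite distrC.
Qed.

Definition convolve f g : K -> R := fun x => M (fun y => f (x - y) * g y).

Lemma continuous_subr f x : continuous f -> continuous (fun y => f (x - y)).
Proof.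
move=> cf y; apply: (@continuous_comp _ _ _ (fun y => x - y) f); last exact: cf.
apply: (@continuous_comp _ _ _ (fun y => (x, y)) (fun p : K * K => p.1 - p.2)).
  by apply: cvg_pair; [exact: cvg_cst|exact: cvg_id].
exact: sub_continuous.
Qed.

Lemma continuous_opp f : continuous f -> continuous (fun y => f (- y)).
Proof. by move=> cf; under eq_fun do rewrite -sub0r; exact: continuous_subr. Qed.

Lemma continuous_shiftr f x : continuous f -> continuous (fun y => f (y + x)).
Proof.
move=> cf y; apply: (@continuous_comp _ _ _ (fun y => y + x) f); last exact: cf.
exact: continuous_translate.
Qed.

Lemma bdd_convolve f g x : continuous f -> continuous g ->
  bdd (fun y => f (x - y) * g y).
Proof.
by move=> cf cg; apply: bddM; apply: continuous_bdd => //; exact: continuous_subr.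
Qed.

Lemma continuous_convolve f g : continuous f -> continuous g ->
  continuous (convolve f g).
Proof.
move=> cf cg x; have [C C0 gC] := bddP (continuous_bdd cg).
apply/cvgrPdist_le => e e0.
pose V := [set v | forall x, `|f (x + v) - f x| < e / C].
have V0 : nbhs 0 V by apply: uniform_continuity; rewrite ?divr_gt0.
have : nbhs x [set y | V (y - x)].
  by apply: (@continuous_translate _ (- x) x V); rewrite subrr.
apply: filterS => z Vz; rewrite distrC.
apply: (mean_dist HM); [exact: bdd_convolve|exact: bdd_convolve|] => y _.
rewrite -mulrBl normrM -(divfK (lt0r_neq0 C0) e) ler_pM//.
have -> : z - y = x - y + (z - x) by rewrite [RHS]addrC addrA subrK.
exact/ltW/Vz.
Qed.

Lemma convolveC f g : continuous f -> continuous g -> convolve f g = convolve g f.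
Proof.
move=> cf cg; apply/funext => x; rewrite /convolve.
rewrite -(mean_opp HM); last exact: bdd_convolve.
rewrite -(mean_shift HM (a := - x))//; last first.
  by have [C Cb] := bdd_convolve x cf cg; exists C => y.
congr M; apply/funext => y.
by rewrite !opprB mulrC addrCA subrr addr0.
Qed.

Lemma convolve_shift f g a :
  convolve (fun x => f (x + a)) g = fun x => convolve f g (x + a).
Proof.
by apply/funext => x; congr M; apply/funext => y; rewrite addrAC.
Qed.

Lemma convolveDl f g h : continuous f -> continuous g -> continuous h ->
  convolve (fun x => f x + g x) h = fun x => convolve f h x + convolve g h x.
Proof.
move=> cf cg ch; apply/funext => x; rewrite /convolve -(meanD HM).
- by congr M; apply/funext => y; rewrite mulrDl.
- exact: bdd_convolve.
- exact: bdd_convolve.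
Qed.

Lemma convolveZl c f h : continuous f -> continuous h ->
  convolve (fun x => c * f x) h = fun x => c * convolve f h x.
Proof.
move=> cf ch; apply/funext => x; rewrite /convolve -(meanZ HM).
- by congr M; apply/funext => y; rewrite mulrA.
- exact: bdd_convolve.
Qed.

Lemma convolve_opp f g : continuous f -> continuous g ->
  convolve (fun x => f (- x)) (fun x => g (- x)) = fun x => convolve f g (- x).
Proof.
move=> cf cg; apply/funext => x; rewrite /convolve.
rewrite -[RHS](mean_opp HM); last exact: bdd_convolve.
by congr M; apply/funext => y; rewrite -opprB opprK addrC opprK.
Qed.

Lemma convolveA f g h : continuous f -> continuous g -> continuous h ->
  convolve (convolve f g) h = convolve f (convolve g h).
Proof.
move=> cf cg ch; apply/funext => x.
transitivity (M (fun z => M (fun y => f (x - y) * (g (y - z) * h z)))).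
  congr M; apply/funext => z; rewrite /convolve mulrC -(meanZ HM); last exact: bdd_convolve.
  rewrite -(mean_shift HM (a := - z))//; last first.
    apply: bddM; first exact: bdd_cst.
    exact: bdd_convolve.
  congr M; apply/funext => y.
  by rewrite opprB addrA subrK mulrC mulrA.
have [Cf Cf0 fC] := bddP (continuous_bdd cf).
have [Cg Cg0 gC] := bddP (continuous_bdd cg).
have [Ch Ch0 hC] := bddP (continuous_bdd ch).
have bF : exists C, forall y z, `|f (x - y) * (g (y - z) * h z)| <= C.
  exists (Cf * (Cg * Ch)) => y z; rewrite !normrM ler_pM ?mulr_ge0//.
  by rewrite ler_pM.
rewrite -(mean_fubini bF) => [|e e0].
  congr M; apply/funext => y; rewrite (meanZ HM)//.
  exact: bdd_convolve.
(* The variable [y] enters through [f (x - y)] and [g (y - z)], hence the cover for the reflected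
   [f] and for [g]. With [d] this quotient, the errors add up to [(d * Cg + Cf * d) * Ch = e]. *)
have d0 : 0 < e / ((Cf + Cg) * Ch) by rewrite divr_gt0// mulr_gt0// addr_gt0.
have [s sP] := uniform_cover2 (continuous_opp cf) cg d0.
exists s => y; have [a sa aP] := sP y; exists a => // z.
have [_ gz] := aP (- z); have [fx _] := aP (- x).
rewrite !opprD !opprK in fx.
rewrite ![- _ + x]addrC in fx.
have -> : f (x - y) * (g (y - z) * h z) - f (x - a) * (g (a - z) * h z) =
  ((f (x - y) - f (x - a)) * g (y - z) + f (x - a) * (g (y - z) - g (a - z))) * h z.
  by ring.
set d := e / _ in d0 gz fx.
have -> : e = (d * Cg + Cf * d) * Ch.
  by rewrite [d * _]mulrC -mulrDl mulrAC [Cg + _]addrC mulrC /d divfK// lt0r_neq0// mulr_gt0// addr_gt0.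
by rewrite normrM ler_pM// (le_trans (ler_normD _ _))// lerD// normrM ler_pM.
Qed.

End convolution.

End compact_group.

Lemma nbhs0_sub (K : topologicalZmodType) (V : set K) : nbhs 0 V ->
  exists2 W, nbhs 0 W & forall x y, W x -> W y -> V (x - y).
Proof.
move=> V0; have := @sub_continuous K (0, 0) V.
rewrite /= subrr => /(_ V0)[[W1 W2] /= [W10 W20] W12].
exists (W1 `&` W2); first exact: filterI.
by move=> x y [Wx _] [_ Wy]; apply: (W12 (x, y)).
Qed.

(** The translates are centred at points of [H], so that a mean invariant only under [H] gives them
    equal values. *)
Lemma subgroup_finite_cover (K : topologicalZmodType) (H V : set K) :
  compact [set: K] -> nbhs 0 V ->
  exists s : seq K, (forall a, a \in s -> H a) /\
    forall x, H x -> exists2 a, a \in s & V (x - a).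
Proof.
move=> cK /nbhs0_sub[W W0 WV].
have nW (x : K) : nbhs x [set y | W (y - x)].
  by apply: (@continuous_translate _ (- x) x W); rewrite subrr.
have [s sP] := compact_finite_reps (set_val : H -> K) cK nW.
exists (map set_val s); split.
  by move=> _ /mapP[a _ ->]; exact: set_valP.
move=> x Hx; have [a sa [z [xz az]]] := sP (SigSub (mem_set Hx)).
exists (set_val a); first exact: map_f.
have -> : x - set_val a = (x - z) - (set_val a - z) by rewrite opprB addrA subrK.
exact: WV.
Qed.

(** * Growth rates, uniform limits and the top eigenvalue of a convolution *)

Lemma sq_le_of_quad (R : realFieldType) (a b d : R) :
  0 <= d ->
  (forall t, 0 <= a + 2 * t * b + t ^+ 2 * d) -> b ^+ 2 <= a * d.
Proof.
rewrite le_eqVlt => /orP[/eqP<-|d0] q.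
- rewrite mulr0; have [->|b0] := eqVneq b 0; first by rewrite expr0n.
  exfalso; have := q (- (a + 1) / (2 * b)).
  have -> : a + 2 * (- (a + 1) / (2 * b)) * b +
    (- (a + 1) / (2 * b)) ^+ 2 * 0 = -1 by field.
  by lra.
- have := q (- b / d).
  have -> : a + 2 * (- b / d) * b + (- b / d) ^+ 2 * d = a - b ^+ 2 / d.
    by field; rewrite gt_eqF.
  by rewrite subr_ge0 ler_pdivrMr.
Qed.

(** Log-convexity makes the ratios [b k.+1 / b k] nondecreasing, and the last hypothesis at [l = 0]
    bounds them by [b 0]; [mu] is their limit. For the lower bound, [b (n + k).+1] is at least
    [r n ^+ k.+1 * b n] and at most [b n * b k]; then [n] tends to infinity. *)
Lemma log_convex_growth (R : realType) (b : nat -> R) :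
  (forall k, 0 < b k) -> (forall k, b k.+1 ^+ 2 <= b k * b k.+2) ->
  (forall k l, b (k + l).+1 <= b k * b l) ->
  exists2 mu, 0 < mu & forall k, b k.+1 <= mu * b k /\ mu ^+ k.+1 <= b k.
Proof.
move=> b0 blc bsub; pose r k := b k.+1 / b k.
have r0 k : 0 < r k by rewrite divr_gt0.
have rS k : r k <= r k.+1.
  rewrite /r ler_pdivrMr// mulrAC ler_pdivlMr// -expr2 mulrC.
  exact: blc.
have rnd : nondecreasing_seq r by exact/nondecreasing_seqP.
have rb k : r k <= b 0%N.
  by rewrite /r ler_pdivrMr// -[k in b k.+1]addn0 mulrC.
have rub : has_ubound (range r) by exists (b 0%N) => _ [k _ <-].
have cr := nondecreasing_cvgn rnd rub.
set mu := sup _ in cr.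
have rmu k : r k <= mu by apply: ub_le_sup => //; exists k.
exists mu; first exact: lt_le_trans (r0 0%N) (rmu 0%N).
move=> k; split; first by rewrite -ler_pdivrMr//; exact: rmu.
have rk n : r n ^+ k.+1 <= b k.
  have h m : r n ^+ m * b n <= b (n + m)%N.
    elim: m => [|m IH]; first by rewrite mul1r addn0.
    rewrite exprS -mulrA addnS.
    rewrite (@le_trans _ _ (r (n + m)%N * b (n + m)%N))//.
      rewrite ler_pM//; first exact: ltW.
        by rewrite mulr_ge0// ltW// exprn_gt0.
      by apply: rnd; exact: leq_addr.
    by rewrite /r divfK// gt_eqF.
  have := le_trans (h k.+1) _; rewrite addnS => /(_ _ (bsub n k)).
  by rewrite [b n * _]mulrC ler_pM2r.
have : (fun n => r n ^+ k.+1) @ \oo --> mu ^+ k.+1.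
  elim: k.+1 => [|m IH].
    by under eq_fun do rewrite expr0; rewrite expr0; exact: cvg_cst.
  by under eq_fun do rewrite exprS; rewrite exprS; exact: cvgM.
move=> /(@cvgr_to_le _ _ _ _ _ _ (b k)); apply.
by apply: nearW => n /=; exact: rk.
Qed.

Lemma real_cvg_unique (R : realType) (u : nat -> R) (a b : R) :
  u @ \oo --> a -> u @ \oo --> b -> a = b.
Proof. by move=> ua ub; apply: cvg_unique ua ub. Qed.

Section uniform_limit.
Context (R : realType) (K : topologicalType).

Definition ucvg (f_ : nat -> K -> R) (f : K -> R) :=
  forall e, 0 < e -> exists N, forall n, (N <= n)%N ->
    forall x, `|f_ n x - f x| <= e.

Lemma ucvg_cvg f_ f x : ucvg f_ f -> f_^~ x @ \oo --> f x.
Proof.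
move=> uf; apply/cvgrPdist_le => e /uf[N NP]; exists N => // n /= Nn.
by rewrite distrC; exact: NP.
Qed.

Lemma ucvg_cauchy f_ : (forall e : R, 0 < e -> exists N, forall j k,
    (N <= j)%N -> (N <= k)%N -> forall x, `|f_ j x - f_ k x| <= e) ->
  exists f, ucvg f_ f.
Proof.
move=> cf; have cv x : cvg (f_^~ x @ \oo).
  apply/cauchy_cvgP/cauchy_ballP => e e0.
  have [N NP] := cf _ (divr_gt0 e0 (ltr0Sn _ 1)).
  pose A := f_^~ x @` [set n | (N <= n)%N].
  have FA : (f_^~ x @ \oo) A by exists N => // n Nn; exists n.
  exists (A, A) => [//|[_ _] /= [[j Nj <-] [k Nk <-]]]; rewrite /ball/=.
  by rewrite (le_lt_trans (NP j k Nj Nk x))// gtr_pMr// invf_lt1// ltr1n.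
exists (fun x => lim (f_^~ x @ \oo)) => e /cf[N NP]; exists N => n Nn x.
have : (fun k => `|f_ n x - f_ k x|) @ \oo --> `|f_ n x - lim (f_^~ x @ \oo)|.
  by apply: cvg_norm; apply: cvgB; [exact: cvg_cst|exact: cv].
move=> /(@cvgr_to_le _ _ _ _ _ _ e); apply.
by exists N => // k /= Nk; exact: NP.
Qed.

Lemma ucvg_continuous f_ f : (forall n, continuous (f_ n)) -> ucvg f_ f ->
  continuous f.
Proof.
move=> cf uf x; apply/cvgrPdist_le => e e0.
have e30 : 0 < e / 3 by rewrite divr_gt0.
have [N /(_ N (leqnn N)) NP] := uf _ e30.
have /cvgrPdist_le/(_ _ e30) := cf N x; apply: filterS => y xy.
have -> : f x - f y = (f_ N x - f_ N y) - (f_ N x - f x) + (f_ N y - f y).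
  by ring.
have -> : e = e / 3 + e / 3 + e / 3 by field.
rewrite (le_trans (ler_normD _ _))// lerD//.
by rewrite (le_trans (ler_normB _ _))// lerD.
Qed.

End uniform_limit.

Section spectral.
Context (R : realType) (K : topologicalZmodType).
Hypothesis cK : compact [set: K].
Context (M : (K -> R) -> R).
Hypothesis HM : invariant_mean [set: K] M.
Implicit Types f g h : K -> R.

Local Notation "f ** g" := (convolve M f g) (at level 40, left associativity).

Definition ip f g := M (fun y => f y * g y).

Definition even f := forall x, f (- x) = f x.

Lemma continuous_bddM f g : continuous f -> continuous g ->
  bdd (fun y => f y * g y).
Proof. by move=> cf cg; apply: bddM; exact: continuous_bdd. Qed.

Lemma ipC f g : ip f g = ip g f.
Proof. by congr M; apply/funext => y; rewrite mulrC. Qed.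

Lemma ipDl f g h : continuous f -> continuous g -> continuous h ->
  ip (fun x => f x + g x) h = ip f h + ip g h.
Proof.
move=> cf cg ch; rewrite /ip -(meanD HM); [|exact: continuous_bddM..].
by congr M; apply/funext => y; rewrite mulrDl.
Qed.

Lemma ipZl c f h : continuous f -> continuous h ->
  ip (fun x => c * f x) h = c * ip f h.
Proof.
move=> cf ch; rewrite /ip -(meanZ HM); last exact: continuous_bddM.
by congr M; apply/funext => y; rewrite mulrA.
Qed.

Lemma ip_ge0 f : continuous f -> 0 <= ip f f.
Proof.
move=> cf; apply: (mean_ge HM); first exact: continuous_bddM.
by move=> x _; rewrite -expr2 sqr_ge0.
Qed.

Lemma continuous_cmul c f : continuous f -> continuous (fun x => c * f x).
Proof. by move=> cf x; apply: cvgM; [exact: cvg_cst|exact: cf]. Qed.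

Lemma continuous_add2 f g : continuous f -> continuous g ->
  continuous (fun x => f x + g x).
Proof. by move=> cf cg x; apply: cvgD; [exact: cf|exact: cg]. Qed.

Lemma continuous_sub2 f g : continuous f -> continuous g ->
  continuous (fun x => f x - g x).
Proof. by move=> cf cg x; apply: cvgB; [exact: cf|exact: cg]. Qed.

Lemma cauchy_schwarz f g : continuous f -> continuous g ->
  ip f g ^+ 2 <= ip f f * ip g g.
Proof.
move=> cf cg; apply: sq_le_of_quad => [|t]; first exact: ip_ge0.
have ctg : continuous (fun x => t * g x) by exact: continuous_cmul.
have cs := continuous_add2 cf ctg.
have := ip_ge0 cs; rewrite ipDl// ipZl// ![ip _ (fun x => f x + _)]ipC.
by rewrite !ipDl// !ipZl// [ip g f]ipC; congr (_ <= _); ring.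
Qed.

(** [f] stays away from 0 on a translate of a neighbourhood of 0, and such a set has positive mean
    because finitely many translates cover [K]. *)
Lemma ip_gt0 f x : continuous f -> f x != 0 -> 0 < ip f f.
Proof.
move=> cf fx; set c := `|f x| / 2.
have c0 : 0 < c by rewrite divr_gt0// normr_gt0.
pose W := [set y | c < `|f (y + x)|].
have W0 : nbhs 0 W.
  have := @continuous_shiftr _ _ f x cf 0 [set z | c < `|z|]; apply.
  have : nbhs `|f (0 + x)| [set z | c < z].
    apply: lt_nbhsr; rewrite add0r /c ltr_pdivrMr// ltr_pMr ?normr_gt0//.
    by rewrite ltr1n.
  exact: (@norm_continuous _ _ (f (0 + x))).
have [s [_ sP]] := subgroup_finite_cover [set: K] cK W0.
have := mean_gt0 HM (s := s) (W := W) (fun _ _ => I) sP => M0.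
rewrite (@lt_le_trans _ _ (c ^+ 2 * M (\1_W)))//.
  by rewrite mulr_gt0// exprn_gt0.
have b1 : bdd (\1_W : K -> R).
  by exists 1 => y; rewrite indicE; case: (_ \in _); rewrite ?normr1 ?normr0.
rewrite -(meanZ HM)// -[leRHS](mean_shift HM (a := x))//; last first.
  exact: continuous_bddM.
apply: (mean_le HM).
- by apply: bddM => //; exact: bdd_cst.
- by apply: continuous_bddM; exact: continuous_shiftr.
- move=> y _; rewrite indicE; case: (boolP (y \in W)) => [/set_mem Wy|_].
    rewrite mulr1 -expr2 -[leRHS](real_normK (num_real _)).
    by rewrite ler_pXn2r ?nnegrE ?normr_ge0 ?(ltW c0)//; exact: ltW.
  by rewrite mulr0 -expr2 sqr_ge0.
Qed.

Lemma convolve_sq_le f g x : continuous f -> continuous g ->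
  (f ** g) x ^+ 2 <= ip f f * ip g g.
Proof.
move=> cf cg; have cfx := continuous_subr (x := x) cf.
have := cauchy_schwarz cfx cg; congr (_ <= _ * _).
rewrite /ip -(mean_opp HM); last exact: continuous_bddM.
rewrite -[RHS](mean_shift HM (a := x))//; last exact: continuous_bddM.
by congr M; apply/funext => y; rewrite opprK addrC.
Qed.

Lemma convolve_norm_le f x : continuous f -> `|(f ** f) x| <= ip f f.
Proof.
move=> cf; rewrite -(@ler_pXn2r _ 2)// ?nnegrE ?ip_ge0//.
by rewrite real_normK ?num_real// [leRHS]expr2; exact: convolve_sq_le.
Qed.

Lemma convolve0 f g : even f -> (f ** g) 0 = ip f g.
Proof. by move=> ef; congr M; apply/funext => y; rewrite sub0r ef. Qed.

Lemma even_convolve f g : continuous f -> continuous g -> even f -> even g ->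
  even (f ** g).
Proof.
move=> cf cg ef eg x.
have /(congr1 (@^~ x)) := convolve_opp cK HM cf cg.
by rewrite (funext ef) (funext eg).
Qed.

Lemma convolveDr f g h : continuous f -> continuous g -> continuous h ->
  h ** (fun x => f x + g x) = fun x => (h ** f) x + (h ** g) x.
Proof.
move=> cf cg ch; rewrite convolveC ?convolveDl//; last exact: continuous_add2.
by rewrite (convolveC _ _ cf)// (convolveC _ _ cg).
Qed.

Lemma convolveZr c f h : continuous f -> continuous h ->
  h ** (fun x => c * f x) = fun x => c * (h ** f) x.
Proof.
move=> cf ch; rewrite convolveC ?convolveZl//; last exact: continuous_cmul.
by rewrite (convolveC _ _ cf).
Qed.

Lemma convolveBl f g h : continuous f -> continuous g -> continuous h ->
  (fun x => f x - g x) ** h = fun x => (f ** h) x - (g ** h) x.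
Proof.
move=> cf cg ch.
have -> : (fun x => f x - g x) = (fun x => f x + (-1) * g x).
  by apply/funext => x; rewrite mulN1r.
rewrite convolveDl ?convolveZl//; last exact: continuous_cmul.
by apply/funext => x; rewrite mulN1r.
Qed.

Lemma convolveBr f g h : continuous f -> continuous g -> continuous h ->
  h ** (fun x => f x - g x) = fun x => (h ** f) x - (h ** g) x.
Proof.
move=> cf cg ch; rewrite convolveC ?convolveBl//; last exact: continuous_sub2.
by rewrite (convolveC _ _ cf)// (convolveC _ _ cg).
Qed.

Lemma ucvg_convolve h (f_ : nat -> K -> R) f x : continuous h -> (forall n, continuous (f_ n)) ->
  continuous f -> ucvg f_ f -> (fun n => (h ** f_ n) x) @ \oo --> (h ** f) x.
Proof.
move=> ch cf_ cf uf; have [C C0 hC] := bddP (continuous_bdd cK ch).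
apply/cvgrPdist_le => e e0.
have [N NP] := uf _ (divr_gt0 e0 C0); exists N => // n /= Nn.
apply: (mean_dist HM) => [||y _]; [exact: bdd_convolve|exact: bdd_convolve|].
rewrite -mulrBr normrM -[e](divfK (lt0r_neq0 C0)) mulrC ler_pM//.
by rewrite distrC NP.
Qed.

(* Power iteration for the positive operator of convolution by [g ** g]: its
   normalized powers converge uniformly to the idempotent of its top
   eigenvalue [mu], the growth rate of the log-convex sequence [b]. *)
Lemma spectral_idempotent g : continuous g -> even g -> (exists x, g x != 0) ->
  exists mu e, [/\ 0 < mu, continuous e /\ even e, e 0 != 0, e ** e = e &
    (g ** g) ** e = fun x => mu * e x].
Proof.
move=> cg eg [x0 gx0].
(* [P n] is the convolution power of [g] of exponent [n.+1], whence the shift in [PD]. *)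
pose P n := iter n (convolve M g) g.
have cP n : continuous (P n) by elim: n => //= n IH; exact: continuous_convolve.
have eP n : even (P n) by elim: n => //= n IH; exact: even_convolve.
have PD m n : P m ** P n = P (m + n).+1.
  by elim: m => //= m IH; rewrite convolveA// IH.
have ipP m n : ip (P m) (P n) = P (m + n).+1 0 by rewrite -PD convolve0.
pose b k := ip (P k) (P k).
have bE k l : ip (P k) (P l) = P (k + l).+1 0 by exact: ipP.
have b0 k : 0 < b k.
  suff [x Px] : exists x, P k x != 0 by exact: ip_gt0 Px.
  case: k => [|k]; first by exists x0.
  elim: k => [|k [x Px]].
    exists 0; rewrite -[P 1%N]/(P 0%N ** P 0%N) convolve0// gt_eqF//.
    exact: ip_gt0 gx0.
  have : 0 < ip (P k.+1) (P k.+1) by exact: ip_gt0 Px.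
  have -> : ip (P k.+1) (P k.+1) = ip (P k.+2) (P k) by rewrite !bE; congr (P _ 0); lia.
  move=> ip0; apply: contrapT => /forallNP P0.
  have {}P0 : P k.+2 = fun=> 0.
    by apply/funext => y; apply/eqP/negbNE/negP; exact: P0.
  move: ip0; rewrite P0 /ip.
  by under eq_fun do rewrite mul0r; rewrite (mean_cst HM) ltxx.
have blc k : b k.+1 ^+ 2 <= b k * b k.+2.
  rewrite /b; have -> : ip (P k.+1) (P k.+1) = ip (P k) (P k.+2).
    by rewrite !bE; congr (P _ 0); lia.
  exact: cauchy_schwarz.
have PDk k x : `|P (k + k).+1 x| <= b k by rewrite -PD; exact: convolve_norm_le.
have bsub k l : b (k + l).+1 <= b k * b l.
  have -> : b (k + l).+1 = ip (P (k + k).+1) (P (l + l).+1).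
    by rewrite /b !bE; congr (P _.+1 0); lia.
  rewrite (le_trans (ler_norm _))//; apply: (mean_norm HM).
    exact: continuous_bddM.
  by move=> x _; rewrite normrM ler_pM.
have [mu mu0 muP] := log_convex_growth b0 blc bsub.
have mun k : mu ^+ k != 0 by rewrite expf_neq0// gt_eqF.
pose c k := b k / mu ^+ k.+1.
have c1 k : 1 <= c k by rewrite ler_pdivlMr ?exprn_gt0// mul1r; case: (muP k).
have cS k : c k.+1 <= c k.
  rewrite /c ler_pdivrMr ?exprn_gt0// [mu ^+ k.+2]exprS mulrCA divfK//.
  by case: (muP k).
have cc : c @ \oo --> inf (range c).
  apply: nonincreasing_cvgn; first exact/nonincreasing_seqP.
  by exists 1 => _ [k _ <-].
set l := inf _ in cc.
(* The convolution power of exponent [k.+1] of [g ** g] divided by [mu]. Its value at 0 is [c k],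
   which decreases but stays at least 1, so the limit is not 0. *)
pose phi k x := (mu ^+ k.+1)^-1 * P (k + k).+1 x.
have cphi k : continuous (phi k) by exact: continuous_cmul.
have ephi k : even (phi k) by move=> x; rewrite /phi eP.
have phiD j k : phi j ** phi k = phi (j + k).+1.
  have h : P (j + j).+1 ** phi k = fun x => (mu ^+ k.+1)^-1 *
      (P (j + j).+1 ** P (k + k).+1) x by exact: convolveZr.
  transitivity (fun x => (mu ^+ j.+1)^-1 * (P (j + j).+1 ** phi k) x).
    exact: convolveZl.
  rewrite h PD; apply/funext => x; rewrite /phi.
  rewrite mulrA -invfM -exprD; congr (_ ^-1 * P _ x).
    by congr (_ ^+ _); lia.
  by lia.
have phi0 k : phi k 0 = c k by rewrite /phi mulrC /c /b bE.
have ipphi j k : ip (phi j) (phi k) = c (j + k).+1.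
  by rewrite -convolve0// phiD phi0.
have uphi k : (g ** g) ** phi k = fun x => mu * phi k.+1 x.
  have -> : (g ** g) ** phi k = fun x => (mu ^+ k.+1)^-1 *
      (P 1%N ** P (k + k).+1) x.
    by apply: convolveZr; [exact: cP|exact: (cP 1%N)].
  rewrite PD; apply/funext => x; rewrite /phi.
  rewrite [mu ^+ k.+2]exprS invfM mulrA [mu * (_ * _)]mulrA mulfV ?gt_eqF//.
  by rewrite mul1r; congr (_ * P _ x); lia.
have cu : continuous (g ** g) by exact: continuous_convolve.
set u := g ** g in uphi cu.
clearbody phi.
(* One more convolution by [u] turns control in mean square into uniform control: the second factor
   is the squared norm of [phi j - phi k], small because [c] converges. *)
have phi_dist j k x : (mu * (phi j.+1 x - phi k.+1 x)) ^+ 2 <=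
    ip u u * (c (j + j).+1 - c (j + k).+1 *+ 2 + c (k + k).+1).
  have -> : mu * (phi j.+1 x - phi k.+1 x) =
    (u ** (fun x => phi j x - phi k x)) x.
    by rewrite convolveBr// !uphi mulrBr.
  have cd : continuous (fun x => phi j x - phi k x) by exact: continuous_sub2.
  rewrite (le_trans (convolve_sq_le x cu cd))// ler_wpM2l ?ip_ge0//.
  rewrite le_eqVlt; apply/orP; left; apply/eqP.
  have -> : (fun x => phi j x - phi k x) = (fun x => phi j x + (-1) * phi k x).
    by apply/funext => y; rewrite mulN1r.
  have ck : continuous (fun x => -1 * phi k x) by exact: continuous_cmul.
  have cs := continuous_add2 (cphi j) ck.
  rewrite ipDl// ipZl// ![ip _ (fun x => _ + _)]ipC !ipDl// !ipZl// !ipphi.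
  by rewrite [(k + j)%N]addnC; ring.
have [e ue] : exists e, ucvg phi e.
  apply: ucvg_cauchy => d d0.
  pose t := (mu * d) ^+ 2 / (4 * (ip u u + 1)).
  have u0 : 0 <= ip u u by exact: ip_ge0.
  have u1 : 0 < ip u u + 1 by lra.
  have t0 : 0 < t by rewrite divr_gt0 ?exprn_gt0 ?mulr_gt0.
  have /cvgrPdist_le/(_ _ t0)[N _ NP] := cc.
  exists N.+1 => -[//|j] [//|k] Nj Nk x.
  rewrite -(@ler_pXn2r _ 2)// ?nnegrE ?(ltW d0)// real_normK ?num_real//.
  rewrite -(@ler_pM2l _ (mu ^+ 2)) ?exprn_gt0// -!exprMn.
  rewrite (le_trans (phi_dist j k x))//.
  have h m n : (N <= m)%N -> `|l - c (m + n).+1| <= t.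
    by move=> Nm; apply: NP => /=; lia.
  have := h j j; have := h j k; have := h k k.
  rewrite !ltnS in Nj Nk; move=> /(_ Nk) h1 /(_ Nj) h2 /(_ Nj) h3.
  have h4 : c (j + j).+1 - c (j + k).+1 *+ 2 + c (k + k).+1 <= 4 * t.
    by move: h1 h2 h3; rewrite !ler_norml => /andP[? ?] /andP[? ?] /andP[? ?]; lra.
  rewrite (@le_trans _ _ (ip u u * (4 * t)))//; first by rewrite ler_wpM2l.
  rewrite (@le_trans _ _ ((ip u u + 1) * (4 * t)))//.
    by apply: ler_wpM2r; [rewrite mulr_ge0// ltW|rewrite lerDl].
  rewrite le_eqVlt; apply/orP; left; apply/eqP; rewrite /t; field.
  by rewrite gt_eqF.
have ce := ucvg_continuous cphi ue.
have pe x : phi^~ x @ \oo --> e x by exact: ucvg_cvg.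
have ee : even e.
  move=> x; apply: (@real_cvg_unique _ (phi^~ x)); last exact: pe.
  by have := pe (- x); under eq_fun do rewrite ephi.
have e0 : 1 <= e 0.
  move: (pe 0) => /(@cvgr_to_ge _ _ _ _ _ _ 1); apply.
  by apply: nearW => n /=; rewrite phi0.
have phie k : phi k ** e = e.
  apply/funext => x; apply: (@real_cvg_unique _ (fun j => (phi k ** phi j) x)).
    exact: ucvg_convolve.
  apply/cvgrPdist_le => d /ue[N NP]; exists N => // n /= Nn.
  by rewrite phiD distrC NP// ; lia.
exists mu, e; split=> //.
- by rewrite gt_eqF// (lt_le_trans ltr01).
- apply/funext => x; apply: (@real_cvg_unique _ (fun j => (e ** phi j) x)).
    exact: ucvg_convolve.
  under eq_fun do rewrite convolveC// phie.
  exact: cvg_cst.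
- apply/funext => x; apply: (@real_cvg_unique _ (fun j => (u ** phi j) x)).
    exact: ucvg_convolve.
  under eq_fun do rewrite uphi.
  apply: cvgM; first exact: cvg_cst.
  apply/cvgrPdist_le => d /ue[N NP]; exists N => // n /= Nn.
  by rewrite distrC NP//; lia.
Qed.

End spectral.

(** * Minimal idempotents are multiples of cosines of characters *)

Section minimal_idempotent.
Context (R : realType) (K : topologicalZmodType).
Hypothesis cK : compact [set: K].
Context (M : (K -> R) -> R).
Hypothesis HM : invariant_mean [set: K] M.
Implicit Types e f g h j : K -> R.

Local Notation "f ** g" := (convolve M f g) (at level 40, left associativity).
Local Notation ip := (ip M).

Definition idem e :=
  [/\ continuous e, even e, e ** e = e & exists x, e x != 0].

Lemma idem_ip e : idem e -> e 0 = ip e e.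
Proof. by move=> [_ ee e2 _]; rewrite -{1}e2 convolve0. Qed.

Lemma idem_norm e x : idem e -> `|e x| <= e 0.
Proof.
by move=> ie; have [ce _ e2 _] := ie; rewrite (idem_ip ie) -{1}e2 convolve_norm_le.
Qed.

(** [e 0] is the mean of the square of [e], hence at most [e 0 ^+ 2]. It plays the part of a
    dimension. *)
Lemma idem_ge1 e : idem e -> 1 <= e 0.
Proof.
move=> ie; have [ce _ _ [x ex]] := ie.
have e0 : 0 < e 0 by rewrite (idem_ip ie); exact: ip_gt0 ex.
rewrite -(ler_pM2l e0) mulr1 {1}(idem_ip ie) (le_trans (ler_norm _))//.
apply: (mean_norm HM); first exact: continuous_bddM.
by move=> y _; rewrite normrM ler_pM// idem_norm.
Qed.

(** [e' ** e = e'] is the usual order on idempotents: the range of convolution by [e'] lies in that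
    of [e]. *)
Definition minimal_idem e := idem e /\
  forall e', idem e' -> e' ** e = e' -> e' = e.

(** It suffices that [e 0] be within 1 of the infimum: a smaller idempotent [e'] would leave the
    idempotent [e - e'], whose value at 0 is lower by at least 1. *)
Lemma minimal_idem_exists e0 : idem e0 ->
  exists2 e, minimal_idem e & e ** e0 = e.
Proof.
move=> ie0; have [_ _ e02 _] := ie0.
pose S := [set t | exists e, [/\ idem e, e ** e0 = e & t = e 0]].
have S1 t : S t -> 1 <= t by move=> [e [ie _ ->]]; exact: idem_ge1.
have hS : has_inf S.
  by split; [exists (e0 0), e0|exists 1 => t /S1].
have [_ [e [ie ee0 ->]] einf] := inf_adherent ltr01 hS.
exists e => //; split=> // e' ie' e'e; apply: contrapT => e'ne.
have [ce ve e2 _] := ie; have [ce' ve' e'2 _] := ie'.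
have [ce0 _ _ _] := ie0.
have ed : idem (fun x => e x - e' x).
  split.
  - exact: continuous_sub2.
  - by move=> x; rewrite ve ve'.
  - rewrite convolveBl// ?convolveBr//; last exact: continuous_sub2.
    rewrite e2 e'2 (convolveC cK HM ce)// e'e.
    by apply/funext => x; rewrite subrr subr0.
  - apply: contrapT => /forallNP h; apply: e'ne; apply/funext => x.
    by apply/esym/eqP; rewrite -subr_eq0; apply/negbNE/negP; exact: h.
have : inf S <= e 0 - e' 0.
  apply: ge_inf; first by case: hS.
  exists (fun x => e x - e' x); split=> //.
  rewrite convolveBl// ee0.
  suff -> : e' ** e0 = e' by [].
  by rewrite -{1}e'e convolveA// ee0.
have := idem_ge1 ie'; lra.
Qed.

Section fixed_minimal.
Context (e : K -> R).
Hypothesis me : minimal_idem e.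

Let ie : idem e. Proof. by case: me. Qed.
Let ce : continuous e. Proof. by case: ie. Qed.
Let ve : even e. Proof. by case: ie. Qed.
Let e2 : e ** e = e. Proof. by case: ie. Qed.
Let e0 : 0 < e 0. Proof. exact: lt_le_trans ltr01 (idem_ge1 ie). Qed.

(** For nonzero [g], the idempotent of the top eigenvalue of [g ** g] lies below [e], hence equals
    [e] by minimality. *)
Lemma minimal_even_sq g : continuous g -> even g -> g ** e = g ->
  exists t, g ** g = fun x => t * e x.
Proof.
move=> cg vg ge; have [gx|/forallNP g0] := pselect (exists x, g x != 0); last first.
  exists 0; apply/funext => x; rewrite mul0r -[RHS](mean_cst HM 0).
  congr M; apply/funext => y; have /negP := g0 y.
  by rewrite negbK => /eqP ->; rewrite mulr0.
have [mu [f [mu0 [cf vf] f0 f2 uf]]] := spectral_idempotent cK HM cg vg gx.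
have cu : continuous (g ** g) by exact: continuous_convolve.
have ue : g ** g ** e = g ** g by rewrite convolveA// ge.
have fe : f ** e = f.
  have h : (fun x => mu * (f ** e) x) = (fun x => mu * f x).
    rewrite -convolveZl// -uf convolveA// (convolveC cK HM cf)//.
    by rewrite -convolveA// ue.
  apply/funext => x; have /(congr1 (@^~ x)) := h.
  by move/(mulfI (lt0r_neq0 mu0)).
have fE : f = e by apply: me.2 => //; split=> //; exists 0.
by exists mu; rewrite -fE -uf fE ue.
Qed.

(** Polarization: [e] is a unit for [g], so the squares of [g + e], [g] and [e] determine
    [2 * g]. *)
Lemma minimal_even g : continuous g -> even g -> g ** e = g ->
  exists t, g = fun x => t * e x.
Proof.
move=> cg vg ge; have [t gg] := minimal_even_sq cg vg ge.
have [s] : exists s, (fun x => g x + e x) ** (fun x => g x + e x) = fun x => s * e x.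
  apply: minimal_even_sq; first exact: continuous_add2.
    by move=> x; rewrite vg ve.
  by rewrite convolveDl// ge e2.
have cs : continuous (fun x => g x + e x) by exact: continuous_add2.
rewrite convolveDl// !convolveDr// gg (convolveC cK HM ce)// ge e2 => h.
exists ((s - t - 1) / 2); apply/funext => x.
have /(congr1 (@^~ x)) /= := h; lra.
Qed.

(** D'Alembert's equation for the cosine. The symmetrized translate is even and fixed by [e], hence
    a multiple of [e]; the factor is read off at 0. *)
Lemma minimal_shiftD a x : e (x - a) + e (x + a) = 2 * (e a / e 0) * e x.
Proof.
pose p x := e (x - a) + e (x + a).
have c1 : continuous (fun x => e (x - a)) by exact: continuous_shiftr.
have c2 : continuous (fun x => e (x + a)) by exact: continuous_shiftr.
have [t pt] : exists t, p = fun x => t * e x.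
  apply: minimal_even; first exact: continuous_add2.
    move=> z; rewrite /p -opprD ve addrC; congr (_ + _).
    by rewrite -ve opprD opprK.
  by rewrite convolveDl// !convolve_shift e2.
have := congr1 (@^~ 0) pt; rewrite /p /= sub0r add0r ve => ta.
have := congr1 (@^~ x) pt; rewrite /p /= => ->; congr (_ * _).
by rewrite mulrA mulr_natl mulr2n ta mulfK// gt_eqF.
Qed.

Definition odd_fun f := forall x, f (- x) = - f x.

Lemma convolve_odd f g : continuous f -> continuous g ->
  odd_fun f -> odd_fun g -> even (f ** g).
Proof.
move=> cf cg of_ og x; have /(congr1 (@^~ x)) := convolve_opp cK HM cf cg.
move=> /= <-; congr M; apply/funext => y; rewrite of_ og; ring.
Qed.

(* A minimal even idempotent is a multiple of [cos chi] for a character [chi];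
   [j] is the matching multiple of [sin chi], the normalized odd part of a
   translate of [e]. *)
Lemma minimal_odd : exists j : K -> R, [/\ continuous j, odd_fun j, j ** e = j,
  (forall a x, e (x - a) = e a / e 0 * e x + j a / e 0 * j x) &
  (forall a x, j (x - a) = e a / e 0 * j x - j a / e 0 * e x)].
Proof.
have cl a : continuous (fun x => e (x - a)) by exact: continuous_shiftr.
have cr a : continuous (fun x => e (x + a)) by exact: continuous_shiftr.
(* In this case the character takes only values of order at most 2, and its sine is 0. *)
have [allq|] := pselect (forall a x, e (x - a) = e (x + a)).
  exists (fun=> 0); split.
  - by move=> x; exact: cvg_cst.
  - by move=> x; rewrite oppr0.
  - apply/funext => x; rewrite -[RHS](mean_cst HM 0).
    by congr M; apply/funext => y; rewrite mul0r.
  - move=> a x; have := minimal_shiftD a x; have := allq a x.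
    by rewrite !mul0r addr0; lra.
  - by move=> a x; rewrite !(mulr0, mul0r, subr0).
move=> /existsNP[a0 /existsNP[x0 q0x]].
pose q a x := e (x - a) - e (x + a).
have cq a : continuous (q a) by exact: continuous_sub2.
have oq a : odd_fun (q a).
  move=> x; rewrite /q opprB -[e (- x - a)]ve -[e (- x + a)]ve.
  by rewrite !opprD !opprK.
have qe a : q a ** e = q a by rewrite convolveBl// !convolve_shift e2.
have ipq : 0 < ip (q a0) (q a0).
  by apply: (@ip_gt0 _ _ cK _ HM _ x0) => //; rewrite subr_eq0; exact/eqP.
have [t qt] : exists t, q a0 ** q a0 = fun x => t * e x.
  apply: minimal_even; first exact: continuous_convolve.
    exact: convolve_odd.
  by rewrite convolveA// qe.
have t0 : t * e 0 = - ip (q a0) (q a0).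
  have <- := congr1 (@^~ 0) qt; rewrite -(meanN HM); last exact: continuous_bddM.
  by congr M; apply/funext => y; rewrite sub0r oq mulNr.
have tn : t < 0 by rewrite -(pmulr_llt0 _ e0) t0 oppr_lt0.
have nt : 0 < - t by rewrite oppr_gt0.
(* Normalization for [j ** j = - e]; [t] is negative because [t * e 0] is minus a squared norm. *)
pose k := (Num.sqrt (- t))^-1.
have k2 : k * k * t = - 1.
  rewrite -expr2 /k exprVn sqr_sqrtr ?ltW// -[X in _ * X]opprK mulrN.
  by rewrite mulVf// gt_eqF.
pose j x := k * q a0 x.
have cj : continuous j by exact: continuous_cmul.
have oj : odd_fun j by move=> x; rewrite /j oq mulrN.
have je : j ** e = j by rewrite convolveZl// qe.
have jj : j ** j = fun x => - e x.
  rewrite /j convolveZl// convolveZr// qt; apply/funext => x.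
  by rewrite !mulrA k2 mulN1r.
clearbody j.
have cNe : continuous (fun x => - e x) by move=> x; apply: cvgN; exact: ce.
(* [q a ** j] is even, hence a multiple of [e]. Convolving again with [j] gives [- q a] on one side
   and a multiple of [j] on the other. *)
have qj a : exists s, forall x, q a x = 2 * s * j x.
  have [s qjs] : exists s, q a ** j = fun x => s * e x.
    apply: minimal_even; first exact: continuous_convolve.
      exact: convolve_odd.
    by rewrite convolveA// je.
  exists (- s / 2) => x; have : (q a ** j) ** j = fun x => s * j x.
    by rewrite qjs convolveZl// (convolveC cK HM ce)// je.
  rewrite convolveA// jj => /(congr1 (@^~ x)) /=.
  have -> : (fun x => - e x) = (fun x => (-1) * e x).
    by apply/funext => y; rewrite mulN1r.
  by rewrite convolveZr// qe; lra.
have ej a : exists s, forall x, e (x - a) = e a / e 0 * e x + s * j x.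
  have [s sP] := qj a; exists s => x; have := sP x; have := minimal_shiftD a x.
  rewrite /q; lra.
have je' a s : (forall x, e (x - a) = e a / e 0 * e x + s * j x) ->
    forall x, j (x - a) = e a / e 0 * j x - s * e x.
  move=> h x.
  have /(congr1 (@^~ x)) /= : (fun x => e (x - a)) ** j = fun x => j (x - a).
    by rewrite convolve_shift (convolveC cK HM ce)// je.
  move=> <-; rewrite (funext h).
  have c1 : continuous (fun x => e a / e 0 * e x) by exact: continuous_cmul.
  have c2 : continuous (fun x => s * j x) by exact: continuous_cmul.
  by rewrite convolveDl// !convolveZl// jj (convolveC cK HM ce)// je mulrN.
have j0 : j 0 = 0 by have := oj 0; rewrite oppr0; lra.
have sE a s : (forall x, e (x - a) = e a / e 0 * e x + s * j x) -> s = j a / e 0.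
  move=> /je'/(_ 0); rewrite sub0r oj j0 mulr0 sub0r => /oppr_inj ->.
  by rewrite mulfK// gt_eqF.
exists j; split=> // a x; have [s sP] := ej a.
  by rewrite -(sE _ _ sP).
by rewrite -(sE _ _ sP); exact: je'.
Qed.

(** [e / e 0] and [j / e 0] satisfy the addition formulas of cosine and sine; the formula at [x - x]
    makes their squares add up to 1, so together they give a point of the circle. *)
Lemma minimal_character : exists2 chi : K -> circle R, character chi &
  forall x, e x = e 0 * circ_cos (chi x).
Proof.
have [j [cj oj je eD jD]] := minimal_odd.
pose c x := e x / e 0; pose s x := j x / e 0.
have en0 : e 0 != 0 by rewrite gt_eqF.
have cD a b : c (a + b) = c a * c b - s a * s b.
  rewrite /c -ve opprD addrC eD ve oj /s; field.
  by [].
have sD a b : s (a + b) = s a * c b + c a * s b.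
  have -> : a + b = - (- b - a) by rewrite opprB opprK.
  rewrite /s oj jD ve oj /c; field.
  by [].
have cs x : c x ^+ 2 + s x ^+ 2 = 1.
  have := cD x (- x); rewrite subrr /c /s ve oj divff// => ->; ring.
have [chi chiP] := choice (fun x => circ_surj (cs x)).
exists chi; last first.
  by move=> x; case: (chiP x) => -> _; rewrite /c mulrC divfK.
apply: character_continuous_cos.
  move=> x y; apply: circ_inj.
    by rewrite circ_cosD !(chiP _).1 !(chiP _).2 cD.
  by rewrite circ_sinD !(chiP _).1 !(chiP _).2 sD.
have -> : (fun x => circ_cos (chi x)) = (fun x => (e 0)^-1 * e x).
  by apply/funext => x; rewrite (chiP _).1 mulrC.
exact: continuous_cmul.
Qed.

End fixed_minimal.

End minimal_idempotent.

(* [f] is the average over [S] of a Urysohn function separating [S] from the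
   cosets of [y] and [-y], and [g] its second difference in direction [y].  A
   minimal idempotent below an eigenspace of convolution by [g ** g] is
   [S]-invariant as [g] is; were it [y]-invariant, convolution by [g] would
   kill it. *)
Theorem character_separation (R : realType) (K : topologicalZmodType)
    (S : set K) (y : K) : compact [set: K] -> hausdorff_space K ->
  zmod_closed (mem S) -> closed S -> ~ S y ->
  exists2 chi : K -> circle R, character chi &
    (forall s, S s -> chi s = 0) /\ chi y != 0.
Proof.
move=> cK hK sS cS nSy.
have [M HM] := invariant_mean_exists R (zmod_closed_setT K).
have [N HN] := invariant_mean_exists R sS.
pose A := [set x | S (x - y)] `|` [set x | S (x + y)].
have cA : closed A.
  have ct (a : K) : closed [set x | S (x + a)].
    apply: (@closed_comp _ _ (fun x => x + a) S) => // x _.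
    exact: continuous_translate.
  by apply: closedU.
have AS : A `&` S = set0.
  rewrite -subset0 => x [[] /= Sxy Sx]; apply: nSy.
    rewrite -[y](subKr x); exact: (subgroupB sS).
  have -> : y = (x + y) - x by rewrite addrC addKr.
  exact: (subgroupB sS).
have nK : normal_space K by exact: compact_normal.
have /(@uniform_separatorP _ R)[F [cF F01 FA FS]] :=
  (@normal_separatorP R K).1 nK A S cA cS AS.
have bF z : bdd (fun s => F (z + s)).
  exists 1 => s; have := F01 (F (z + s)); rewrite /= in_itv/= => /(_ _)/andP[].
    by exists (z + s).
  by move=> F0 F1; rewrite ger0_norm.
pose f0 z := N (fun s => F (z + s)).
have f0S z s : S s -> f0 (z + s) = f0 z.
  move=> Ss; rewrite /f0 -(mean_shift HN Ss (bF z)).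
  by congr N; apply/funext => t; rewrite -addrA [s + t]addrC.
have f00 : f0 0 = 1.
  rewrite /f0 -[RHS](mean_cst HN 1); apply: (mean_eq HN) => //.
    exact: bdd_cst.
  by move=> s Ss; rewrite add0r; apply: FS; exists s.
have f0A z : (forall s, S s -> A (z + s)) -> f0 z = 0.
  move=> zA; rewrite /f0 -[RHS](mean_cst HN 0); apply: (mean_eq HN) => //.
    exact: bdd_cst.
  by move=> s Ss; apply: FA; exists (z + s) => //; exact: zA.
have f0y : f0 y = 0.
  by apply: f0A => s Ss; left; rewrite /= addrC addrA addNr add0r.
have f0Ny : f0 (- y) = 0.
  by apply: f0A => s Ss; right; rewrite /= addrC addrA subrr add0r.
have cf0 : continuous f0.
  move=> z; apply/cvgrPdist_le => d d0.
  pose V := [set v | forall x, `|F (x + v) - F x| < d].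
  have V0 : nbhs 0 V by exact: uniform_continuity.
  have : nbhs z [set t | V (t - z)].
    by apply: (@continuous_translate _ (- z) z V); rewrite subrr.
  apply: filterS => t Vt; rewrite distrC.
  apply: (mean_dist HN) => // s _.
  have -> : t + s = z + s + (t - z) by rewrite [RHS]addrC addrA subrK.
  exact/ltW/Vt.
pose f z := f0 z + f0 (- z).
have cf : continuous f.
  by apply: continuous_add2 => //; exact: continuous_opp.
have vf : even f by move=> z; rewrite /f opprK addrC.
have fS z s : S s -> f (z + s) = f z.
  by move=> Ss; rewrite /f opprD !f0S//; exact: (subgroupN sS).
pose g x := 2 * f x - (f (x - y) + f (x + y)).
have c1 : continuous (fun x => f (x - y)) by exact: continuous_shiftr.
have c2 : continuous (fun x => f (x + y)) by exact: continuous_shiftr.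
have c3 : continuous (fun x => 2 * f x) by exact: continuous_cmul.
have c4 : continuous (fun x => f (x - y) + f (x + y)) by exact: continuous_add2.
have cg : continuous g by exact: continuous_sub2.
have vg : even g.
  move=> x; rewrite /g vf; congr (_ - _).
  by rewrite -[f (x - y)]vf -[f (x + y)]vf !opprD opprK addrC.
(* The value is 4: [f 0 = 2], while [f] vanishes at [y] and at [- y], which is why the Urysohn
   function vanishes on both cosets. *)
have g0 : g 0 != 0.
  rewrite /g /f oppr0 !add0r opprK f00 f0y f0Ny.
  by apply/eqP; lra.
have gS s : S s -> (fun x => g (x + s)) = g.
  move=> Ss; apply/funext => x; rewrite /g fS//; congr (_ - (_ + _)).
    by rewrite addrAC fS.
  by rewrite addrAC fS.
have [mu [e0 [mu0 [ce0 ve0] e00 e02 ue0]]] :=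
  spectral_idempotent cK HM cg vg (ex_intro _ 0 g0).
have ie0 : idem M e0 by split=> //; exists 0.
have [e me ee0] := minimal_idem_exists cK HM ie0.
have [[ce ve e2 _] _] := me.
have cu := continuous_convolve cK HM cg cg.
have ue : convolve M (convolve M g g) e = fun x => mu * e x.
  rewrite -{1}ee0 (convolveC cK HM ce)// -(convolveA cK HM)// ue0.
  by rewrite (convolveZl cK HM)// (convolveC cK HM ce0)// ee0.
have [chi chic chiP] := minimal_character cK HM me.
have e0_0 : e 0 != 0.
  by have := idem_ge1 cK HM me.1 => e1; rewrite gt_eqF// (lt_le_trans ltr01).
exists chi => //; split=> [s Ss|].
  apply: circ_cos_eq1.
  have es : e s = e 0.
    apply: (mulfI (lt0r_neq0 mu0)).
    have /(congr1 (@^~ s)) /= <- := ue.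
    have /(congr1 (@^~ 0)) /= <- := ue.
    have /(congr1 (@^~ 0)) /= := convolve_shift M (convolve M g g) e s.
    rewrite add0r => <-; congr (convolve M _ e 0).
    by rewrite -convolve_shift gS.
  by apply: (mulfI e0_0); rewrite -chiP mulr1.
apply/eqP => chiy.
have ey x : e (x + y) = e x by rewrite chiP chic.1 chiy addr0 -chiP.
have eNy x : e (x - y) = e x by rewrite -(ey (x - y)) subrK.
have ge : convolve M g e = fun=> 0.
  have h a : (forall x, e (x + a) = e x) ->
      convolve M (fun x => f (x + a)) e = convolve M f e.
    move=> ea; rewrite convolve_shift (convolveC cK HM cf)// -convolve_shift.
    by rewrite (funext ea).
  rewrite /g (convolveBl cK HM)// (convolveZl cK HM)// (convolveDl cK HM)//.
  rewrite !h//; apply/funext => x; ring.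
have := ue; rewrite (convolveA cK HM)// ge => /(congr1 (@^~ 0)) /= h.
have : mu * e 0 = 0.
  rewrite -h -[RHS](mean_cst HM 0); congr M; apply/funext => x.
  by rewrite mulr0.
by apply/eqP; rewrite mulf_neq0// gt_eqF.
Qed.

(** * Continuous characters of a subgroup of the dual *)

Section pairing.
Context (R : realType) (G X : zmodType) (b : G -> X -> circle R).
Hypothesis bDl : forall u v x, b (u + v) x = b u x + b v x.
Hypothesis bDr : forall u x y, b u (x + y) = b u x + b u y.

Let b0l x : b 0 x = 0.
Proof. by apply: (@addrI _ (b 0 x)); rewrite -bDl !addr0. Qed.

Let b0r u : b u 0 = 0.
Proof. by apply: (@addrI _ (b u 0)); rewrite -bDr !addr0. Qed.

Let bNl u x : b (- u) x = - b u x.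
Proof. by apply: (@addrI _ (b u x)); rewrite -bDl !subrr b0l. Qed.

Let bNr u x : b u (- x) = - b u x.
Proof. by apply: (@addrI _ (b u x)); rewrite -bDr !subrr b0r. Qed.

(** Since [2 * (1 - cos)] is the squared length of a chord from 1, this is [|a - b| ^+ 2 <= 2 * |a|
    ^+ 2 + 2 * |b| ^+ 2]. *)
Lemma circ_cosB_le (z w : circle R) :
  1 - circ_cos (z - w) <= 2 * (1 - circ_cos z) + 2 * (1 - circ_cos w).
Proof.
rewrite circ_cosD circ_cosN circ_sinN.
have := circ_cos2Dsin2 z; have := circ_cos2Dsin2 w.
have := sqr_ge0 (circ_cos z + circ_cos w - 2).
have := sqr_ge0 (circ_sin z + circ_sin w).
nra.
Qed.

Lemma circle_compact : compact [set: circle R].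
Proof.
have -> : [set: circle R] = @circle_proj R @` `[- 2^-1, 2^-1].
  apply/esym; rewrite -subTset => z _.
  have [x x2 ->] := circle_proj_half z; exists x => //.
  by rewrite /= in_itv/= -ler_norml.
apply: continuous_compact; last exact: segment_compact.
by apply: continuous_subspaceT; exact: continuous_circle_proj.
Qed.

(** [G] has no topology, but [u] is sent to [b u] in a power of the circle, compact by Tychonoff.
    The quarter of [d] pays for the two factors 2 in [circ_cosB_le]. *)
Lemma pairing_finite_cover (l : seq X) (d : R) : 0 < d ->
  exists s : seq G, forall u, exists2 a, a \in s &
    forall x, x \in l -> 1 - d < circ_cos (b (u - a) x).
Proof.
move=> d0; have d4 : 0 < d / 4 by rewrite divr_gt0.
pose T : topologicalType := {ptws X -> circle R}.
have cT : compact [set: T].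
  have := @tychonoff X (fun=> circle R) (fun=> setT) (fun=> circle_compact).
  by congr (compact _); apply/seteqP; split.
pose U (g : T) : set T :=
  [set g' | forall x, x \in l -> 1 - d / 4 < circ_cos (g' x - g x)].
have nU g : nbhs g (U g).
  rewrite /U {U}; elim: l => [|x l' IH].
    by apply: filterS filterT => g' _ x; rewrite in_nil.
  have Ux : nbhs g [set g' : T | 1 - d / 4 < circ_cos (g' x - g x)].
    have cp : (fun g' : T => circ_cos (g' x - g x)) @ g -->
        circ_cos (g x - g x).
      have px := @proj_continuous X (fun=> circle R) x g.
      have c1 : (fun g' : T => circ_cos (g' x)) @ g --> circ_cos (g x).
        by apply: continuous_comp; [exact: px|exact: continuous_circ_cos].
      have c2 : (fun g' : T => circ_sin (g' x)) @ g --> circ_sin (g x).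
        by apply: continuous_comp; [exact: px|exact: continuous_circ_sin].
      rewrite [in X in _ --> X]circ_cosD circ_cosN circ_sinN.
      under eq_fun do rewrite circ_cosD circ_cosN circ_sinN.
      exact: (cvgB (cvgM c1 (cvg_cst _)) (cvgM c2 (cvg_cst _))).
    move/cvgr_gt : cp; apply.
    by rewrite subrr circ_cos0 gtrBl.
  apply: filterS (filterI Ux IH) => g' [g1 g2] z.
  by rewrite inE => /orP[/eqP->|/g2].
have [s sP] := compact_finite_reps (fun u => b u : T) cT nU.
exists s => u; have [a sa [g [gu ga]]] := sP u; exists a => // x xl.
have := gu x xl; have := ga x xl => h1 h2.
have := circ_cosB_le (b u x - g x) (b a x - g x).
by rewrite opprB addrA subrK -bNl -bDl; lra.
Qed.

(* The product kernel [\prod_(x <- l) (1 + cos (b u x)) / 2] is a nonnegative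
   trigonometric polynomial, at most 1, and close to 1 only where all the
   [b u x] are close to 0. *)
Definition trig_kernel (l : seq X) (u : G) : R :=
  \prod_(x <- l) ((1 + circ_cos (b u x)) / 2).

Lemma trig_factor x u : 0 <= (1 + circ_cos (b u x)) / 2 <= 1.
Proof.
have := circ_cos_le1 (b u x); have := circ_cos_geN1 (b u x).
by move=> ? ?; apply/andP; split; lra.
Qed.

Lemma trig_kernel_bound l u : 0 <= trig_kernel l u <= 1.
Proof.
rewrite /trig_kernel; elim: l => [|x l /andP[IH0 IH1]].
  by rewrite big_nil ler01 lexx.
rewrite big_cons; have /andP[t0 t1] := trig_factor x u.
by rewrite mulr_ge0//= mulr_ile1.
Qed.

Lemma bdd_trig_kernel l : bdd (trig_kernel l).
Proof.
by exists 1 => u; have /andP[k0 k1] := trig_kernel_bound l u; rewrite ger0_norm.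
Qed.

Lemma bdd_circ_cos (T : Type) (f : T -> circle R) : bdd (fun t => circ_cos (f t)).
Proof. by exists 1 => t; exact: circ_cos_max. Qed.

Lemma bdd_circ_sin (T : Type) (f : T -> circle R) : bdd (fun t => circ_sin (f t)).
Proof. by exists 1 => t; exact: circ_sin_max. Qed.

Lemma trig_kernel_gt (l : seq X) u d x : x \in l ->
  1 - d < trig_kernel l u -> 1 - 2 * d < circ_cos (b u x).
Proof.
move=> xl; rewrite /trig_kernel (big_rem x)//= => h.
have /andP[k0 k1] := trig_kernel_bound (rem x l) u.
have /andP[t0 t1] := trig_factor x u.
have : (1 + circ_cos (b u x)) / 2 * trig_kernel (rem x l) u <=
  (1 + circ_cos (b u x)) / 2 by rewrite ler_piMr.
rewrite /trig_kernel; move: h; lra.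
Qed.

Lemma trig_kernel_ge (l : seq X) u :
  1 - \sum_(x <- l) (1 - circ_cos (b u x)) <= trig_kernel l u.
Proof.
elim: l => [|x l IH]; first by rewrite /trig_kernel !big_nil subr0.
rewrite /trig_kernel !big_cons -/(trig_kernel l u).
have /andP[k0 k1] := trig_kernel_bound l u.
have := circ_cos_le1 (b u x); have := circ_cos_geN1 (b u x).
move: IH; nra.
Qed.

Section kernel_mean.
Context (H : set G) (M : (G -> R) -> R).
Hypothesis HM : invariant_mean H M.

(** Translation by [v] rotates the vector of means of cosine and sine by [b v x], and a nontrivial
    rotation fixes only 0. *)
Lemma mean_cos_eq0 x : (exists2 u, H u & b u x != 0) -> forall w : circle R,
  M (fun u => circ_cos (b u x + w)) = 0.
Proof.
move=> [v Hv vx]; pose C := M (fun u => circ_cos (b u x)).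
pose S := M (fun u => circ_sin (b u x)).
have bc : bdd (fun u => circ_cos (b u x)) by exact: bdd_circ_cos.
have bs : bdd (fun u => circ_sin (b u x)) by exact: bdd_circ_sin.
have expand w : M (fun u => circ_cos (b u x + w)) = circ_cos w * C - circ_sin w * S.
  rewrite -(meanZ HM)// -(meanZ HM)// -(meanB HM).
  - by congr M; apply/funext => u; rewrite circ_cosD; ring.
  - by apply: bddM => //; exact: bdd_cst.
  - by apply: bddM => //; exact: bdd_cst.
have expand' w : M (fun u => circ_sin (b u x + w)) = circ_cos w * S + circ_sin w * C.
  rewrite -(meanZ HM)// -(meanZ HM)// -(meanD HM).
  - by congr M; apply/funext => u; rewrite circ_sinD; ring.
  - by apply: bddM => //; exact: bdd_cst.
  - by apply: bddM => //; exact: bdd_cst.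
have e1 : C = circ_cos (b v x) * C - circ_sin (b v x) * S.
  rewrite -expand /C -(mean_shift HM Hv bc).
  by congr M; apply/funext => u; rewrite bDl.
have e2 : S = circ_cos (b v x) * S + circ_sin (b v x) * C.
  rewrite -expand' /S -(mean_shift HM Hv bs).
  by congr M; apply/funext => u; rewrite bDl.
have c1 : circ_cos (b v x) != 1.
  by apply: contra vx => /eqP/circ_cos_eq1 ->.
have h : (1 - circ_cos (b v x)) * (C ^+ 2 + S ^+ 2) = 0.
  have -> : (1 - circ_cos (b v x)) * (C ^+ 2 + S ^+ 2) =
    C * (C - (circ_cos (b v x) * C - circ_sin (b v x) * S)) +
    S * (S - (circ_cos (b v x) * S + circ_sin (b v x) * C)) by ring.
  by rewrite -e1 -e2 !subrr !mulr0 addr0.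
move/eqP : h; rewrite mulf_eq0 subr_eq0 eq_sym (negPf c1)/= => /eqP CS.
have C0 : C = 0.
  by apply/eqP; rewrite -sqrf_eq0 eq_le sqr_ge0 andbT; have := sqr_ge0 S; lra.
have S0 : S = 0.
  by apply/eqP; rewrite -sqrf_eq0 eq_le sqr_ge0 andbT; have := sqr_ge0 C; lra.
by move=> w; rewrite expand C0 S0 !mulr0 subr0.
Qed.

(* By the product-to-sum formula the kernel times [cos (b u x)] is a combination
   of the functions [cos (b u (x + y))] with [y] in the group spanned by [l]. *)
Lemma mean_trig_kernel_eq0 (A : set X) (l : seq X) x : zmod_closed (mem A) ->
  (forall y, y \in l -> A y) ->
  (forall y, A y -> exists2 u, H u & b u (x + y) != 0) ->
  M (fun u => trig_kernel l u * circ_cos (b u x)) = 0.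
Proof.
move=> sA; elim: l x => [|y l IH] x lA nA.
  rewrite -[RHS](@mean_cos_eq0 x _ 0); last first.
    by rewrite -[x]addr0; apply: nA; exact: subgroup0.
  by congr M; apply/funext => u; rewrite /trig_kernel big_nil mul1r addr0.
have {}lA' z : z \in l -> A z by move=> zl; apply: lA; rewrite inE zl orbT.
have Ay : A y by apply: lA; rewrite mem_head.
have bk z : bdd (fun u => trig_kernel l u * circ_cos (b u z)).
  by apply: bddM; [exact: bdd_trig_kernel|exact: bdd_circ_cos].
have h0 z : A z -> M (fun u => trig_kernel l u * circ_cos (b u (x + z))) = 0.
  move=> Az; apply: IH => // t At; rewrite -addrA; apply: nA.
  exact: subgroupD.
have -> : (fun u => trig_kernel (y :: l) u * circ_cos (b u x)) =
    (fun u => 2^-1 * (trig_kernel l u * circ_cos (b u (x + 0))) +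
      4^-1 * (trig_kernel l u * circ_cos (b u (x + y)) +
              trig_kernel l u * circ_cos (b u (x - y)))).
  apply/funext => u; rewrite /trig_kernel big_cons -/(trig_kernel l u).
  rewrite !bDr b0r addr0 bNr !circ_cosD circ_cosN circ_sinN; by field.
pose f z u := trig_kernel l u * circ_cos (b u z).
have bf z : bdd (f z) by exact: bk.
have b1 : bdd (fun u => 2^-1 * f (x + 0) u) by apply: bddM => //; exact: bdd_cst.
have b2 : bdd (fun u => f (x + y) u + f (x - y) u) by exact: bddD.
have b3 : bdd (fun u => 4^-1 * (f (x + y) u + f (x - y) u)).
  by apply: bddM => //; exact: bdd_cst.
transitivity (2^-1 * M (f (x + 0)) + 4^-1 * (M (f (x + y)) + M (f (x - y)))).
  rewrite -(meanD HM (bf _) (bf _)) -(meanZ HM _ (bf _)) -(meanZ HM _ b2).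
  exact: (meanD HM b1 b3).
rewrite /f !h0//; last 2 first.
- exact: subgroupN.
- exact: subgroup0.
by rewrite addr0 !mulr0 addr0.
Qed.

End kernel_mean.

Lemma trig_kernel_nseq (l : seq X) n u :
  trig_kernel (flatten (nseq n l)) u = trig_kernel l u ^+ n.
Proof.
elim: n => [|n IH]; first by rewrite /trig_kernel big_nil.
by rewrite exprS -IH /trig_kernel /= big_cat.
Qed.

(* If [y] were not represented by an element of [A], the mean of
   [trig_kernel l u ^+ n * cos (b u y)] would vanish for all [n]; but these
   functions concentrate where [cos (b u y) >= 1/2]. *)
Lemma continuous_char_represented (A : set X) (y : X) (l : seq X) (d : R) :
  zmod_closed (mem A) -> (forall x, x \in l -> A x) -> 0 < d ->
  (forall u, (forall x, x \in l -> 1 - d < circ_cos (b u x)) ->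
     2^-1 <= circ_cos (b u y)) ->
  exists2 x, A x & forall u, b u y = b u x.
Proof.
move=> sA lA d0 ly; apply: contrapT => nA.
have [M HM] := invariant_mean_exists R (zmod_closed_setT G).
have nA' x : A x -> exists2 u, [set: G] u & b u (y + x) != 0.
  move=> Ax; apply: contrapT => h; apply: nA; exists (- x).
    exact: subgroupN.
  move=> u; apply/eqP; rewrite bNr -addr_eq0 -bDr; apply/negbNE/negP => bu.
  by apply: h; exists u.
pose P := trig_kernel l.
have M0 n : M (fun u => P u ^+ n * circ_cos (b u y)) = 0.
  under eq_fun do rewrite -trig_kernel_nseq.
  apply: (mean_trig_kernel_eq0 HM sA) => // x.
  by move=> /flattenP[l' /nseqP[-> _]]; exact: lA.
pose d' := Num.min d 1.
have d'0 : 0 < d' by rewrite lt_min d0 ltr01.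
have d'1 : d' <= 1 by rewrite ge_min lexx orbT.
have d'd : d' <= d by rewrite ge_min lexx.
(* Above [r], the kernel forces every cosine on [l] above [1 - d']; the gap up to [r'] makes
   [r ^+ n] negligible against [r' ^+ n]. Capping [d'] at 1 keeps [r] positive. *)
pose r := 1 - d' / 2; pose r' := 1 - d' / 4.
have r0 : 0 < r by rewrite /r; lra.
have rr' : r < r' by rewrite /r /r'; lra.
have r'1 : r' < 1 by rewrite /r'; lra.
have Pr u : r < P u -> 2^-1 <= circ_cos (b u y).
  move=> ru; apply: ly => x xl; have := trig_kernel_gt xl ru; lra.
pose W := [set u | r' < P u].
have [s sP] : exists s : seq G, forall u, exists2 a, a \in s & W (u - a).
  have n0 : 0 < ((size l).+1)%:R :> R by rewrite ltr0n.
  have e0 : 0 < d' / 4 / (size l).+1%:R by rewrite !divr_gt0.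
  have [s sP] := pairing_finite_cover l e0; exists s => u.
  have [a sa aP] := sP u; exists a => //.
  rewrite /W/=; apply: lt_le_trans (trig_kernel_ge _ _).
  rewrite /r' ltrD2l ltrN2.
  rewrite (@le_lt_trans _ _ (\sum_(x <- l) (d' / 4 / (size l).+1%:R)))//.
    rewrite big_seq [leRHS]big_seq; apply: ler_sum => x xl.
    rewrite lerBlDr addrC -lerBlDr; exact: ltW (aP x xl).
  rewrite big_const_seq count_predT iter_addr_0.
  set t := d' / 4 / _ in e0 *.
  have -> : d' / 4 = t *+ (size l).+1.
    by rewrite -[RHS]mulr_natr divfK// gt_eqF.
  by rewrite mulrSr ltrDl.
have k0 : 0 < M (\1_W).
  by apply: (mean_gt0 HM (s := s)) => // u _; exact: sP.
set k := M _ in k0.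
have b1 : bdd (\1_W : G -> R).
  by exists 1 => u; rewrite indicE; case: (_ \in _); rewrite ?normr1 ?normr0.
(* The function [P u ^+ n * circ_cos (b u y)] is at least [2^-1 * r' ^+ n] on [W] and at least
   [- r ^+ n] everywhere, while its mean is 0. *)
have ineq n : 2^-1 * r' ^+ n * k - r ^+ n <= 0.
  rewrite -(M0 n) -[r ^+ n in leLHS](mean_cst HM) -(meanZ HM)// -(meanB HM); last 2 first.
  - by apply: bddM => //; exact: bdd_cst.
  - exact: bdd_cst.
  apply: (mean_le HM).
  - by apply: bddD; [apply: bddM => //; exact: bdd_cst|exact: bdd_cst].
  - apply: bddM; last exact: bdd_circ_cos.
    exists 1 => u; have /andP[p0 p1] := trig_kernel_bound l u.
    by rewrite ger0_norm ?exprn_ge0// exprn_ile1.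
  - move=> u _; have /andP[p0 p1] := trig_kernel_bound l u.
    rewrite indicE; case: (leP (P u) r) => [Pur|rP].
      have -> : (u \in W) = false.
        apply/negP => /set_mem; rewrite /W/= => h.
        by have := lt_le_trans h Pur; rewrite ltNge ltW.
      rewrite mulr0 sub0r.
      have h1 : P u ^+ n <= r ^+ n by rewrite lerXn2r ?nnegrE// ltW.
      have h2 : 0 <= P u ^+ n by rewrite exprn_ge0.
      have := circ_cos_geN1 (b u y); nra.
    have h2 : 0 <= r ^+ n by rewrite exprn_ge0// ltW.
    have h3 : 0 <= P u ^+ n by rewrite exprn_ge0.
    have := Pr u rP; case: (boolP (u \in W)) => [/set_mem Wu|_] hc; last first.
      by rewrite mulr0 sub0r; nra.
    have h1 : r' ^+ n <= P u ^+ n.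
      by rewrite lerXn2r ?nnegrE// ltW// (lt_trans r0).
    rewrite mulr1; nra.
have q1 : `|r / r'| < 1.
  have r'0 := lt_trans r0 rr'.
  by rewrite gtr0_norm ?divr_gt0// ltr_pdivrMr// mul1r.
have k2 : 0 < k / 4 by rewrite divr_gt0.
have /cvgr0_norm_lt/(_ _ k2)[n _ /(_ n (leqnn n))] := cvg_expr q1.
have r'0 := lt_trans r0 rr'.
rewrite ger0_norm; last by rewrite exprn_ge0// divr_ge0// ltW.
rewrite expr_div_n ltr_pdivrMr ?exprn_gt0// => h.
have := ineq n; have : 0 < r' ^+ n by rewrite exprn_gt0.
nra.
Qed.

End pairing.

(** * The closure operator in terms of sequences of characters *)

Section dual_group.
Context (R : realType) (K : topologicalZmodType).

Lemma character_of_dual (x : dual R K) : character (fun a => eval_char a x).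
Proof. by case: x => f cf; split=> // a c; rewrite /eval_char/= raddfD. Qed.

Lemma dual_of_character (f : K -> circle R) : character f ->
  exists x : dual R K, forall a, eval_char a x = f a.
Proof.
move=> cf; have fB : zmod_morphism f by move=> x y; rewrite characterB.
pose f' : {additive K -> circle R} :=
  HB.pack f (GRing.isZmodMorphism.Build K (circle R) f fB).
have cf' : continuous f' by exact: cf.2.
by exists (exist _ f' cf').
Qed.

Section integer_combinations.
Context (chi : nat -> K -> circle R).
Hypothesis cchi : forall n, character (chi n).

(** Integer polynomials encode finitely supported integer sequences: a free group, countable as the
    filter bases require, with ['X^n] sent to [chi n]. *)
Definition poly_char (p : {poly int}) (x : K) : circle R :=
  \sum_(i < size p) chi i x *~ p`_i.

Lemma poly_char_widen (p : {poly int}) n x : (size p <= n)%N ->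
  poly_char p x = \sum_(i < n) chi i x *~ p`_i.
Proof.
move=> pn; rewrite /poly_char (big_ord_widen n (fun i => chi i x *~ p`_i))//.
rewrite big_mkcond/=; apply: eq_bigr => i _.
by case: ltnP => // h; rewrite nth_default// mulr0z.
Qed.

Lemma poly_charDl p q x : poly_char (p + q) x = poly_char p x + poly_char q x.
Proof.
pose n := maxn (size p) (size q).
rewrite !(@poly_char_widen _ n) ?leq_maxl ?leq_maxr ?size_polyD//.
by rewrite -big_split; apply: eq_bigr => i _; rewrite coefD mulrzDr.
Qed.

Lemma poly_charDr p x y : poly_char p (x + y) = poly_char p x + poly_char p y.
Proof.
rewrite /poly_char -big_split; apply: eq_bigr => i _.
by rewrite (cchi i).1 mulrzDl.
Qed.

Lemma poly_charXn n x : poly_char 'X^n x = chi n x.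
Proof.
rewrite /poly_char size_polyXn big_ord_recr/= coefXn eqxx big1 ?add0r//.
by move=> i _; rewrite coefXn ltn_eqF// mulr0z.
Qed.

Lemma character_mulz (f : K -> circle R) (m : int) :
  character f -> character (fun x => f x *~ m).
Proof.
move=> cf; have cn (n : nat) : character (fun x => f x *+ n).
  elim: n => [|n IH]; first by under eq_fun do rewrite mulr0n; exact: character_cst0.
  by under eq_fun do rewrite mulrS; exact: characterD_character.
case: m => n; first exact: cn.
by under eq_fun do rewrite NegzE mulrNz; exact/characterN_character/cn.
Qed.

Lemma character_poly_char p : character (poly_char p).
Proof.
rewrite /poly_char; elim: (size p) => [|n IH].
  by under eq_fun do rewrite big_ord0; exact: character_cst0.
under eq_fun do rewrite big_ord_recr.
by apply: characterD_character => //; exact: character_mulz.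
Qed.

End integer_combinations.

(* The closure is the closure for the countable intersections of open sets:
   [y] belongs to it when every coset of a countable intersection of kernels
   containing [y] meets [H]. *)
Lemma l_closureP (H : set K) (y : K) : zmod_closed (mem H) ->
  l_closure R H y <-> forall chi : nat -> K -> circle R,
    (forall n, character (chi n)) -> exists2 h, H h & forall n, chi n y = chi n h.
Proof.
move=> sH; split; last first.
  move=> Hy F [[[_ F0 FI] [A FA cA]] HF].
  have [a0 Aa0] := F0 _ FA.
  (* [e] enumerates the countable member [A], with gaps filled by members of [A]. If [h] agrees with
     [y] on [A], convergence passes from [h] to [y], since members of [F] can be shrunk into [A]. *)
  have /countable_injP[f finj] := cA.
  have ex (n : nat) : exists a, A a /\ ((exists2 c, A c & f c = n) -> f a = n).
    have [[a Aa fa]|no] := pselect (exists2 a, A a & f a = n); first by exists a.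
    by exists a0; split=> // /no.
  have [e eP] := choice ex.
  have [h Hh yh] := Hy _ (fun n => character_of_dual (e n)).
  have yhA a : A a -> eval_char y a = eval_char h a.
    move=> Aa; have [Ae ea] := eP (f a).
    have -> : a = e (f a).
      by apply: finj; rewrite ?inE// ea//; exists a.
    exact: yh.
  move=> U U0; have [_ [B FB <-] BU] := HF h Hh U U0.
  have [C FC CAB] := FI _ _ FA FB.
  exists (eval_char y @` C); first by exists C.
  move=> _ [c Cc <-]; have [Ac Bc] := CAB c Cc.
  by rewrite yhA//; apply: BU; exists c.
move=> Hy chi cchi.
have [D DP] := choice (fun p => dual_of_character (character_poly_char cchi p)).
pose B (l : seq K) (d : R) := D @` [set p | forall h, h \in l ->
  1 - d < circ_cos (poly_char chi p h)].
pose F := [set A | exists l d, [/\ (forall h, h \in l -> H h), 0 < d & A = B l d]].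
have D0 h : poly_char chi 0 h = 0 by rewrite /poly_char size_poly0 big_ord0.
have FC : countable_filter_bases F.
  split; last first.
    exists (B [::] 1); first by exists [::], 1.
    exact: (sub_countable (card_image_le _ _) (countableP _)).
  split.
  - by exists (B [::] 1), [::], 1.
  - move=> _ [l [d [_ d0 ->]]]; exists (D 0), 0 => // h _.
    by rewrite D0 circ_cos0 gtrBl.
  - move=> _ _ [l [d [lH d0 ->]]] [l' [d' [l'H d'0 ->]]].
    exists (B (l ++ l') (Num.min d d')).
      exists (l ++ l'), (Num.min d d'); split=> //; last by rewrite lt_min d0.
      by move=> h; rewrite mem_cat => /orP[/lH|/l'H].
    move=> _ [p pP <-]; split; exists p => // h hl.
      have := pP h; rewrite mem_cat hl => /(_ isT); apply: le_lt_trans.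
      by rewrite lerD2l lerN2 ge_min lexx.
    have := pP h; rewrite mem_cat hl orbT => /(_ isT); apply: le_lt_trans.
    by rewrite lerD2l lerN2 ge_min lexx orbT.
have HF : H `<=` z_ F.
  move=> h Hh U /nbhs_circleP[d d0 dU].
  exists (eval_char h @` B [:: h] d).
    exists (B [:: h] d) => //; exists [:: h], d; split=> //.
    by move=> k; rewrite inE => /eqP ->.
  move=> _ [_ [p pP <-] <-]; rewrite DP; apply: dU; rewrite subr0.
  by apply: pP; rewrite inE.
have half0 : 0 < 2^-1 :> R by rewrite invr_gt0.
have [_ [_ [l [d [lH d0 ->]]] <-] BU] := Hy F (conj FC HF) _ (nbhs0_circ_cos half0).
(* Convergence at [y] makes evaluation at [y] continuous at 0 for the topology given by evaluations
   on [H]; level 1/2 is what the representation by a point of [H] asks for. *)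
have ly p : (forall h, h \in l -> 1 - d < circ_cos (poly_char chi p h)) ->
    2^-1 <= circ_cos (poly_char chi p y).
  move=> pl; have /BU : (eval_char y @` B l d) (eval_char y (D p)).
    by exists (D p) => //; exists p.
  by rewrite /= DP; lra.
have [h Hh yh] := continuous_char_represented (poly_charDl chi)
  (poly_charDr cchi) sH lH d0 ly.
by exists h => // n; rewrite -!poly_charXn.
Qed.

End dual_group.

(** Otherwise the points outside [U] where given characters are small would cluster at some [x].
    Every character vanishes at [x], so [x = 0] by separation from the trivial subgroup, and [U]
    would meet its complement. *)
Lemma nbhs0_characters (R : realType) (K : topologicalZmodType) (U : set K) :
  compact [set: K] -> hausdorff_space K -> nbhs 0 U ->
  exists (l : seq (K -> circle R)) (d : R),
    [/\ forall f, f \in l -> character f, 0 < d &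
        forall x, (forall f, f \in l -> 1 - d < circ_cos (f x)) -> U x].
Proof.
move=> cK hK U0; apply: contrapT => no.
pose D := [set i : seq (K -> circle R) * R |
  (forall f, f \in i.1 -> character f) /\ 0 < i.2].
pose B (i : seq (K -> circle R) * R) := ~` U `&`
  [set x | forall f, f \in i.1 -> 1 - i.2 < circ_cos (f x)].
have BF : ProperFilter (filter_from D B).
  apply: filter_from_proper; last first.
    move=> [l d] [/= lc d0]; apply: contrapT => Bld; apply: no.
    exists l, d; split=> // x xl; apply: contrapT => nUx.
    by apply: Bld; exists x.
  apply: filter_from_filter; first by exists ([::], 1); split=> //=.
  move=> [l d] [l' d'] [/= lc d0] [/= l'c d'0].
  exists (l ++ l', Num.min d d').
    split=> /=; last by rewrite lt_min d0.
    by move=> f; rewrite mem_cat => /orP[/lc|/l'c].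
  move=> x [nUx /= xP]; split; split=> // f fl /=.
    have := xP f; rewrite mem_cat fl => /(_ isT); apply: le_lt_trans.
    by rewrite lerD2l lerN2 ge_min lexx.
  have := xP f; rewrite mem_cat fl orbT => /(_ isT); apply: le_lt_trans.
  by rewrite lerD2l lerN2 ge_min lexx orbT.
have [x [_ xB]] := cK _ BF filterT.
have chix (f : K -> circle R) : character f -> f x = 0.
  move=> cf; apply: circ_cos_eq1; apply/le_anti; rewrite circ_cos_le1/=.
  apply/ler_addgt0Pl => e e0; rewrite leNgt; apply/negP => fx.
  have ccf := continuous_cos_character cf.
  have Bf : filter_from D B (B ([:: f], e / 2)).
    exists ([:: f], e / 2) => //; split=> /=; last by rewrite divr_gt0.
    by move=> g; rewrite inE => /eqP ->.
  have Nx : nbhs x [set z | circ_cos (f z) < circ_cos (f x) + e / 2].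
    by move/cvgr_lt : (ccf x); apply; rewrite ltrDl divr_gt0.
  have [z [[_ /= Bz] Nz]] := xB _ _ Bf Nx.
  have := Bz f; rewrite inE => /(_ (eqxx _)); move: Nz => /=; lra.
have x0 : x = 0.
  apply: contrapT => x0.
  have s0 : zmod_closed (mem [set (0 : K)]).
    by split=> [|a c]; rewrite !inE// => -> ->; rewrite subr0.
  have c0 : closed [set (0 : K)].
    by apply: accessible_closed_set1; exact: hausdorff_accessible.
  have [f cf [_ /eqP]] := @character_separation R K [set 0] x cK hK s0 c0 x0.
  by apply; exact: chix.
have [z [[nUz _] Uz]] := xB (B ([::], 1)) U
  (ex_intro2 _ _ ([::], 1) (conj (fun _ h => False_ind _ (notF h)) ltr01) (fun _ h => h))
  (eq_ind_r (fun t => nbhs t U) U0 x0).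
by [].
Qed.

Section annihilators.
Context (R : realType) (K : topologicalZmodType).
Hypotheses (cK : compact [set: K]) (hK : hausdorff_space K).

Lemma nbhs0_character_seq (U : set K) : nbhs 0 U ->
  exists2 chi : nat -> K -> circle R, forall n, character (chi n) &
    forall x, (forall n, chi n x = 0) -> U x.
Proof.
move=> U0; have [l [d [lc d0 lU]]] := nbhs0_characters R cK hK U0.
exists (nth (fun=> 0) l).
  move=> n; have [nl|nl] := ltnP n (size l); first by apply: lc; exact: mem_nth.
  by rewrite nth_default//; exact: character_cst0.
move=> x xl; apply: lU => f fl; rewrite -(nth_index (fun=> 0) fl) xl.
by rewrite circ_cos0 gtrBl.
Qed.

Lemma sub_l_closure (H : set K) : H `<=` l_closure R H.
Proof. by move=> x Hx F [_ HF]; exact: HF. Qed.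

(** A neighbourhood of [y] missing [H] contains the translate by [y] of an intersection of kernels,
    so no element of [H] agrees with [y] on the corresponding characters. *)
Lemma closed_l_closed (H : set K) : zmod_closed (mem H) -> closed H ->
  l_closed R H.
Proof.
move=> sH cH; apply/seteqP; split; last exact: sub_l_closure.
move=> y /(l_closureP R y sH) yH; apply: contrapT => nHy.
have U0 : nbhs 0 [set x | ~ H (y + x)].
  have : nbhs y (~` H) by apply: open_nbhs_nbhs; split=> //; exact: closed_openC.
  move=> nH; have h : nbhs (0 : K) [set x | (~` H) (x + y)].
    by apply: (@continuous_translate _ y 0 (~` H)); rewrite /= add0r.
  by apply: filterS h => x /=; rewrite addrC.
have [chi cchi chiU] := nbhs0_character_seq U0.
have [h Hh yh] := yH chi cchi; apply: (chiU (h - y)).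
  by move=> n; rewrite characterB// yh subrr.
by rewrite addrC subrK.
Qed.

End annihilators.

(** * Metrics from countably many characters *)

Section supremum_pseudometric.
Context (R : realType) (T : Type) (f : nat -> T -> R).
Hypothesis f1 : forall n x, `|f n x| <= 1.

(** A supremum gives the triangle inequality term by term, as a series would, with no summation; the
    weights make the tail uniformly small, so that it is continuous. *)
Definition sdist (x y : T) : R :=
  sup (range (fun n => 2^-1 ^+ n * `|f n x - f n y|)).

Let term_le2 x y n : 2^-1 ^+ n * `|f n x - f n y| <= 2.
Proof.
have h : 2^-1 ^+ n <= 1 :> R by rewrite exprn_ile1// ?invf_le1// ler1n.
have h0 : 0 <= 2^-1 ^+ n :> R by rewrite exprn_ge0.
have d2 : `|f n x - f n y| <= 2.
  rewrite (le_trans (ler_normB _ _))//.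
  by have := f1 n x; have := f1 n y; lra.
by rewrite -[leRHS]mul1r ler_pM.
Qed.

Let hub x y : has_ubound (range (fun n => 2^-1 ^+ n * `|f n x - f n y|)).
Proof. by exists 2 => _ [n _ <-]; exact: term_le2. Qed.

Lemma sdist_ge x y n : 2^-1 ^+ n * `|f n x - f n y| <= sdist x y.
Proof. by apply: ub_le_sup => //; exists n. Qed.

Lemma sdist_le x y c : (forall n, 2^-1 ^+ n * `|f n x - f n y| <= c) ->
  sdist x y <= c.
Proof.
move=> h; apply: ge_sup; last by move=> _ [n _ <-].
by exists (2^-1 ^+ 0 * `|f 0%N x - f 0%N y|), 0%N.
Qed.

Lemma sdist_ge0 x y : 0 <= sdist x y.
Proof. by apply: le_trans (sdist_ge x y 0); rewrite mulr_ge0// exprn_ge0. Qed.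

Lemma sdistxx x : sdist x x = 0.
Proof.
apply/le_anti; rewrite sdist_ge0 andbT.
by apply: sdist_le => n; rewrite subrr normr0 mulr0.
Qed.

Lemma sdistC x y : sdist x y = sdist y x.
Proof. by congr sup; apply: eq_imagel => n _; rewrite distrC. Qed.

Lemma sdist_triangle y x z : sdist x z <= sdist x y + sdist y z.
Proof.
apply: sdist_le => n; apply: (@le_trans _ _ (2^-1 ^+ n * `|f n x - f n y| +
  2^-1 ^+ n * `|f n y - f n z|)); last by rewrite lerD// sdist_ge.
by rewrite -mulrDr ler_wpM2l ?exprn_ge0// ler_distD.
Qed.

Lemma sdist_eq0 x y : sdist x y = 0 -> forall n, f n x = f n y.
Proof.
move=> xy n; apply/eqP; rewrite -subr_eq0 -normr_le0.
have h0 : 0 < 2^-1 ^+ n :> R by rewrite exprn_gt0.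
by have := sdist_ge x y n; rewrite xy pmulr_rle0.
Qed.

End supremum_pseudometric.

Lemma sdist_near (R : realType) (T : topologicalType) (f : nat -> T -> R) x e :
  (forall n x, `|f n x| <= 1) -> (forall n, continuous (f n)) -> 0 < e ->
  \forall z \near x, sdist f z x < e.
Proof.
move=> f1 cf e0; have e2 : 0 < e / 2 by rewrite divr_gt0.
have q1 : `|2^-1| < 1 :> R by rewrite gtr0_norm// invf_lt1// ltr1n.
have e4 : 0 < e / 4 by rewrite divr_gt0.
have /cvgr0_norm_lt/(_ _ e4)[N _ NP] := cvg_expr q1.
have : \forall z \near x, forall n, (n < N)%N -> `|f n z - f n x| <= e / 2.
  elim: N {NP} => [|N IH]; first by apply: nearW => z n; rewrite ltn0.
  have /cvgrPdist_le/(_ _ e2) h := cf N x.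
  apply: filterS2 IH h => z IH h n; rewrite ltnS leq_eqVlt => /orP[/eqP->|/IH//].
  by rewrite distrC.
apply: filterS => z zP; apply: (@le_lt_trans _ _ (e / 2)).
  apply: sdist_le => n; have [nN|Nn] := ltnP n N.
    have h : 2^-1 ^+ n <= 1 :> R by rewrite exprn_ile1// ?invf_le1// ler1n.
    have h0 : 0 <= 2^-1 ^+ n :> R by rewrite exprn_ge0.
    rewrite -[leRHS]mul1r ler_pM//; exact: zP.
  have := NP n Nn; rewrite ger0_norm ?exprn_ge0// => h.
  have h0 : 0 <= 2^-1 ^+ n :> R by rewrite exprn_ge0.
  have d2 : `|f n z - f n x| <= 2.
    rewrite (le_trans (ler_normB _ _))//.
    by have := f1 n z; have := f1 n x; lra.
  apply: (@le_trans _ _ (2^-1 ^+ n * 2)); first by rewrite ler_wpM2l.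
  lra.
by rewrite gtr_pMr// invf_lt1// ltr1n.
Qed.

Lemma continuous_sdist (R : realType) (T : topologicalType) (f : nat -> T -> R) y :
  (forall n x, `|f n x| <= 1) -> (forall n, continuous (f n)) ->
  continuous (fun z => sdist f z y).
Proof.
move=> f1 cf x; apply/cvgrPdist_lt => e e0.
apply: filterS (sdist_near x f1 cf e0) => z; apply: le_lt_trans.
rewrite ler_norml; apply/andP; split.
  by rewrite lerNl opprB lerBlDr sdist_triangle.
by rewrite lerBlDr [sdist f z x]sdistC sdist_triangle.
Qed.

Section metric_of_distance.
Context (R : realType) (T : choiceType) (d : T -> T -> R).
Hypotheses (dxx : forall x, d x x = 0) (d0 : forall x y, d x y = 0 -> x = y).
Hypotheses (dC : forall x y, d x y = d y x).
Hypothesis (dD : forall y x z, d x z <= d x y + d y z).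

(** A synonym of [T], so that the metric topology stays apart from a topology that [T] already
    has. *)
Definition distance_space : Type := T.

HB.instance Definition _ := Choice.on distance_space.
HB.instance Definition _ := isMetric.Build R distance_space dxx d0 dC dD.

Lemma metricType_of_distance :
  exists (M : metricType R) (f : T -> M) (g : M -> T),
    [/\ cancel f g, cancel g f & forall x r y, ball (f x) r (f y) <-> d x y < r].
Proof.
by exists distance_space, (fun x => x), (fun x => x).
Qed.

End metric_of_distance.

Lemma compact_zero_nbhs (R : realType) (T : topologicalType) (p : T -> R) x U :
  compact [set: T] -> continuous p -> (forall z, 0 <= p z) ->
  (forall z, p z = 0 -> z = x) -> nbhs x U ->
  exists2 r, 0 < r & forall z, p z < r -> U z.
Proof.
move=> cT cp p0 px Ux; apply: contrapT => no.
pose B (r : R) := [set z | p z < r /\ ~ U z].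
have BF : ProperFilter (filter_from [set r | 0 < r] B).
  apply: filter_from_proper; last first.
    move=> r /= r0; apply: contrapT => h; apply: no; exists r => // z zr.
    by apply: contrapT => nUz; apply: h; exists z.
  apply: filter_from_filter; first by exists 1 => /=.
  move=> r r' /= r0 r'0; exists (Num.min r r'); first by rewrite /= lt_min r0.
  by move=> z [/=]; rewrite lt_min => /andP[].
have [z [_ zB]] := cT _ BF filterT.
suff zx : z = x.
  have B1 : filter_from [set r | 0 < r] B (B 1) by exists 1 => /=.
  have Uz : nbhs z U by rewrite zx.
  by have [w [[_ nUw] Uw]] := zB _ _ B1 Uz.
apply: px; apply/le_anti; rewrite p0 andbT; apply/ler_addgt0Pl => e e0.
rewrite addr0 leNgt; apply/negP => ez.
have Be : filter_from [set r | 0 < r] B (B e) by exists e.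
have Nz : nbhs z [set w | e < p w] by move/cvgr_gt : (cp z); apply.
have [w [[we _] /= ew]] := zB _ _ Be Nz.
by have := lt_trans we ew; rewrite ltxx.
Qed.

Section circle_coordinates.
Context (R : realType) (K : topologicalZmodType) (chi : nat -> K -> circle R).
Hypothesis cchi : forall n, character (chi n).

Definition circ_coord (n : nat) (x : K) : R :=
  if odd n then circ_sin (chi n./2 x) else circ_cos (chi n./2 x).

Lemma circ_coord_le1 n x : `|circ_coord n x| <= 1.
Proof. by rewrite /circ_coord; case: odd; [exact: circ_sin_max|exact: circ_cos_max]. Qed.

Lemma continuous_circ_coord n : continuous (circ_coord n).
Proof.
rewrite /circ_coord; case: odd; first exact: continuous_sin_character.
exact: continuous_cos_character.
Qed.

Lemma circ_coord_inj x y : (forall n, circ_coord n x = circ_coord n y) ->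
  forall n, chi n x = chi n y.
Proof.
move=> xy n; apply: circ_inj.
  by have := xy n.*2; rewrite /circ_coord odd_double doubleK.
by have := xy n.*2.+1; rewrite /circ_coord/= odd_double/= uphalf_double.
Qed.

Lemma metrizable_of_character_seq : compact [set: K] -> hausdorff_space K ->
  (forall x, (forall n, chi n x = 0) -> x = 0) -> metrizable R K.
Proof.
move=> cK hK chi0; pose d := sdist circ_coord.
have d0 x y : d x y = 0 -> x = y.
  move=> /(sdist_eq0 circ_coord_le1)/circ_coord_inj xy.
  apply/eqP; rewrite -subr_eq0; apply/eqP/chi0 => n.
  by rewrite characterB// xy subrr.
have [M [f [g [fK gK fgP]]]] := metricType_of_distance
  (sdistxx circ_coord_le1) d0 (sdistC circ_coord) (sdist_triangle circ_coord_le1).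
exists M, f, g.
have cf : continuous f.
  move=> x U /nbhs_ballP[r /= r0 rU].
  have := sdist_near x circ_coord_le1 continuous_circ_coord r0.
  by apply: filterS => z; rewrite sdistC => /fgP/rU.
split=> // u U; rewrite /= -{1}[u]gK => Ugu.
have cd : continuous (fun z => d z (g u)).
  exact: continuous_sdist circ_coord_le1 continuous_circ_coord.
have dge0 z : 0 <= d z (g u) by exact: sdist_ge0 circ_coord_le1 _ _.
have deq0 z : d z (g u) = 0 -> z = g u by exact: d0.
rewrite gK in Ugu.
have [r r0 rU] := compact_zero_nbhs cK cd dge0 deq0 Ugu.
apply/nbhs_ballP; exists r => //= v vr.
have /fgP : ball (f (g u)) r (f (g v)) by rewrite !gK.
by rewrite sdistC => /rU.
Qed.

End circle_coordinates.

Lemma countable_character_seq (R : realType) (K : topologicalZmodType)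
    (T : countType) (chi : T -> nat -> K -> circle R) :
  (forall t n, character (chi t n)) ->
  exists2 eta : nat -> K -> circle R, forall n, character (eta n) &
    forall t n, exists m, eta m = chi t n.
Proof.
move=> cchi.
pose eta m := if choice.unpickle m is Some (t, n) then chi t n else (fun=> 0).
exists eta.
  move=> m; rewrite /eta; case: choice.unpickle => [[t n]//|].
  exact: character_cst0.
by move=> t n; exists (choice.pickle (t, n)); rewrite /eta choice.pickleK.
Qed.

Lemma countable_set_seq (T : Type) (A : set T) (x0 : T) : countable A ->
  exists2 e : nat -> T, forall x, A x -> exists n, e n = x &
    forall n, A (e n) \/ e n = x0.
Proof.
move=> /countable_injP[f finj].
have ex n : exists y, (forall x, A x -> f x = n -> y = x) /\ (A y \/ y = x0).
  have [[x Ax fx]|no] := pselect (exists2 x, A x & f x = n).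
    exists x; split; last by left.
    by move=> z Az fz; apply: finj; rewrite ?inE// fx fz.
  exists x0; split; last by right.
  by move=> x Ax fx; exfalso; apply: no; exists x.
have [e eP] := choice ex; exists e; last by move=> n; case: (eP n).
by move=> x Ax; exists (f x); case: (eP (f x)) => + _; apply.
Qed.

Definition char_nbhs (R : realType) (K : topologicalZmodType)
    (l : seq (K -> circle R)) (d : R) : set K :=
  [set x | forall f, f \in l -> 1 - d < circ_cos (f x)].

Lemma char_nbhs_open (R : realType) (K : topologicalZmodType)
    (l : seq (K -> circle R)) (d : R) x :
  (forall f, f \in l -> character f) -> char_nbhs l d x ->
  nbhs x (char_nbhs l d).
Proof.
elim: l => [|f l IH] lc lx; first by apply: filterS filterT => z _ f; rewrite in_nil.
have h : nbhs x (char_nbhs l d).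
  by apply: IH => [g gl|g gl]; [apply: lc|apply: lx]; rewrite inE gl orbT.
have cf : character f by apply: lc; rewrite mem_head.
have : nbhs x [set z | 1 - d < circ_cos (f z)].
  have ccf := continuous_cos_character cf.
  move/cvgr_gt : (ccf x); apply.
  by apply: lx; rewrite mem_head.
apply: filterS2 h => z hl hf g; rewrite inE => /orP[/eqP->//|]; exact: hl.
Qed.

(** * Real functions on subgroups of compact groups *)

Section subgroup_of_compact.
Context (R : realType) (K : topologicalZmodType).
Hypotheses (cK : compact [set: K]) (hK : hausdorff_space K).
Context (H : set K).
Hypothesis sH : zmod_closed (mem H).

(* The countable chain condition for [H], from the invariant mean: the translates
   of a neighbourhood have positive mean, and those of a disjoint family add up
   to at most 1. *)
Lemma disjoint_translates_countable (I : choiceType) (A : set I) (S : I -> set K) :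
  trivIset A (fun i => S i `&` H) ->
  (forall i, A i -> exists2 x, H x & nbhs x (S i)) -> countable A.
Proof.
move=> tA nS; have [M HM] := invariant_mean_exists R sH.
have b1 (W : set K) : bdd (\1_W : K -> R).
  by exists 1 => u; rewrite indicE; case: (_ \in _); rewrite ?normr1 ?normr0.
have M0 i : A i -> 0 < M (\1_(S i)).
  move=> Ai; have [x Hx nx] := nS i Ai.
  pose V := [set z | S i (z + x)].
  have V0 : nbhs 0 V.
    have := @continuous_translate _ x 0 (S i); rewrite add0r; exact.
  have [s [sH' sV]] := subgroup_finite_cover H cK V0.
  have := mean_gt0 HM (s := s) (W := V) sH' sV.
  have -> : (\1_V : K -> R) = fun u => \1_(S i) (u + x).
    by apply/funext => u; rewrite !indicE; congr (_%:R); apply/idP/idP;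
      rewrite !inE.
  by rewrite (mean_shift HM Hx (b1 _)).
(* The indicators of a disjoint family add up to at most 1 on [H], so fewer than [n.+1] of them have
   mean above [n.+1%:R^-1]. *)
pose B n := [set i | A i /\ n.+1%:R^-1 < M (\1_(S i))].
have -> : A = \bigcup_n B n.
  apply/seteqP; split=> [i Ai|i [n _ []]//].
  have := M0 i Ai => m0.
  exists (Num.truncn (M (\1_(S i)))^-1) => //; split=> //.
  by rewrite invf_plt ?posrE// ?ltr0n// truncnS_gt.
apply: bigcup_countable => // n _; apply: finite_set_countable.
apply: contrapT => /(infinite_set_fset n.+1)[F FB Fn].
have FA i : i \in F -> A i by move=> iF; have [] := FB i iF.
have : n.+1%:R * n.+1%:R^-1 < \sum_(i <- F) M (\1_(S i)).
  apply: (@le_lt_trans _ _ (\sum_(i <- F) n.+1%:R^-1)).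
    rewrite big_const_seq count_predT iter_addr_0 -[leRHS]mulr_natl.
    by rewrite ler_pM2r ?invr_gt0 ?ltr0n// ler_nat.
  rewrite big_seq [ltRHS]big_seq; apply: ltr_sum.
    have [i iF] : exists i, i \in F.
      by apply/fset0Pn; rewrite -cardfs_gt0 (leq_trans _ Fn).
    by apply/hasP; exists i.
  by move=> i iF; have [] := FB i iF.
rewrite divff ?pnatr_eq0// -(mean_sum HM); last by move=> i; exact: b1.
rewrite ltNge => /negP; apply; rewrite -[leRHS](mean_cst HM 1).
apply: (mean_le HM); [by apply: bdd_sum => i; exact: b1|exact: bdd_cst|].
move=> x Hx; have [[i0 iF Six]|no] := pselect (exists2 i, i \in F & S i x).
  rewrite (bigD1_seq i0)//= big_seq_cond big1 ?addr0.
    by rewrite indicE; case: (_ \in _); rewrite ?ler01.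
  move=> i /andP[iF' ii0]; rewrite indicE; case: (boolP (x \in S i)) => // /set_mem Sx.
  exfalso; move/eqP : ii0; apply; apply: tA.
  - exact: FA.
  - exact: FA.
  - by exists x.
rewrite big_seq big1 ?ler01// => i iF; rewrite indicE.
by case: (boolP (x \in S i)) => // /set_mem Sx; exfalso; apply: no; exists i.
Qed.

(* A maximal disjoint family of basic open pieces of [U], countable by the chain
   condition, is dense in [U]; membership in a piece only depends on finitely
   many characters. *)
Lemma closure_open_character_invariant (U : set K) : open U ->
  exists2 chi : nat -> K -> circle R, forall n, character (chi n) &
    forall y h, closure H y -> H h -> (forall n, chi n h = chi n y) ->
      closure (U `&` H) y -> closure (U `&` H) h.
Proof.
move=> oU.
pose I := (K * (seq (K -> circle R) * R))%type.
pose S (i : I) := [set z | char_nbhs i.2.1 i.2.2 (z - i.1)].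
pose D := [set i : I | [/\ H i.1, (forall f, f \in i.2.1 -> character f),
  0 < i.2.2 & S i `&` H `<=` U]].
have [A [AD tA Amax]] := ex_maximal_disjoint_subcollection
  (fun i => S i `&` H) D.
have Sx i : D i -> S i i.1.
  by move=> [_ lc d0 _] f fl; rewrite subrr (character0 (lc f fl)) circ_cos0 gtrBl.
have nS i x : D i -> S i x -> nbhs x (S i).
  move=> [_ lc d0 _] Six; apply: (@continuous_translate _ (- i.1) x).
  exact: char_nbhs_open.
have cA : countable A.
  apply: (@disjoint_translates_countable _ A S) => // i /AD Di.
  by have [Hx _ _ _] := Di; exists i.1 => //; apply: nS => //; exact: Sx.
pose L := \bigcup_(i in A) [set f : K -> circle R | f \in i.2.1].
have cL : countable L.
  apply: bigcup_countable => // i _; apply: finite_set_countable.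
  exact: finite_seq.
have [chi Lchi chiL] := countable_set_seq (fun=> 0) cL.
exists chi.
  move=> n; have [[i Ai /= il]|->] := chiL n; last exact: character_cst0.
  by have [_ lc _ _] := AD i Ai; exact: lc.
(* The point produced is [a - c + h], with [a] in a piece and [c] in [H], both near [y]. The
   characters of the piece take the same values there as at [a - c + y], which is still in the piece
   for [c] close enough to [y]. *)
move=> y h Hy Hh yh cUy O nO.
have [a1 a2] : exists Q : set K, nbhs y Q /\ forall a c, Q a -> Q c -> O (a - c + h).
  have ct : {for (y, y), continuous (fun p : K * K => p.1 - p.2 + h)}.
    apply: (@continuous_comp _ _ _ (fun p : K * K => p.1 - p.2) (fun z => z + h)).
      exact: sub_continuous.
    exact: continuous_translate.
  have /ct : nbhs (y - y + h) O by rewrite subrr add0r.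
  move=> [[Q1 Q2] /= [Q1y Q2y] QO]; exists (Q1 `&` Q2); split; first exact: filterI.
  by move=> a c [Qa _] [_ Qc]; apply: (QO (a, c)).
move: a1 a2 => Q [nQ QO].
have [a [i Ai [Sia Ha]] Qa] : exists2 a, (exists2 i, A i & S i a /\ H a) & Q a.
  apply: contrapT => no.
  have [N1 [[oN1 N1y] N1Q]] : exists N1, open_nbhs y N1 /\ N1 `<=` Q.
    by move: nQ; rewrite nbhsE => -[N1 o1 ?]; exists N1.
  have [x [[Ux Hx] N1x]] := cUy _ (open_nbhs_nbhs (conj oN1 N1y)).
  have nx : nbhs 0 [set z | (U `&` N1) (z + x)].
    have := @continuous_translate _ x 0 (U `&` N1); rewrite add0r; apply.
    by apply: open_nbhs_nbhs; split=> //; exact: openI.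
  have [l [d [lc d0 lU]]] := nbhs0_characters R cK hK nx.
  pose i : I := (x, (l, d)).
  have SU z : S i z -> (U `&` N1) z.
    by move=> Siz; have := lU _ Siz; rewrite /= subrK.
  have Di : D i by split=> // z [/SU[]].
  have nAi : ~ A i.
    by move=> Ai; apply: no; exists x; [exists i => //; split=> //; exact: (Sx i)|exact: N1Q].
  (* A basic piece around [x] inside [U] and [N1] would be disjoint on [H] from all members of [A],
     against maximality. *)
  apply: (Amax (A `|` [set i])).
  - by split; [exact: subsetUl|move=> AE; apply: nAi; apply: AE; right].
  - by move=> j [/AD//|->].
  - have dis j z : A j -> S j z -> H z -> S i z -> False.
      move=> Aj Sjz Hz /SU[_ N1z]; apply: no; exists z; last exact: N1Q.
      by exists j.
    move=> j k [Aj|->] [Ak|->] [z [[Sjz Hz] [Skz _]]] //.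
    + by apply: tA => //; exists z.
    + by have := dis j z Aj Sjz Hz Skz.
    + by have := dis k z Ak Skz Hz Sjz.
have Di := AD i Ai; have [_ lc d0 SiU] := Di.
have nQ' : nbhs y [set c | S i (a - c + y)].
  have ct : {for y, continuous (fun c : K => a - c + y)}.
    apply: (@continuous_comp _ _ _ (fun c => a - c) (fun z => z + y)).
      apply: (@continuous_comp _ _ _ (fun c : K => (a, c)) (fun p : K * K => p.1 - p.2)).
        by apply: cvg_pair; [exact: cvg_cst|exact: cvg_id].
      exact: sub_continuous.
    exact: continuous_translate.
  have /ct : nbhs (a - y + y) (S i) by rewrite subrK; exact: nS.
  by [].
have [c [Hc [Qc Sc]]] := Hy _ (filterI nQ nQ').
exists (a - c + h); split; last exact: QO.
have Hz : H (a - c + h) by apply: (subgroupD sH) => //; exact: (subgroupB sH).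
split=> //; apply: SiU; split=> // f fl.
have cf := lc f fl; have [n fn] : exists n, chi n = f.
  by apply: Lchi; exists i.
have := Sc f fl; rewrite !(characterB _ _ cf) !cf.1 -fn yh; exact.
Qed.

Lemma l_closure_sub_closure y : l_closure R H y -> closure H y.
Proof.
move=> /(l_closureP R y sH) yH O nO.
have U0 : nbhs 0 [set x | O (x + y)].
  by have := @continuous_translate _ y 0 O; rewrite add0r; apply.
have [chi cchi chiU] := nbhs0_character_seq R cK hK U0.
have [h Hh yh] := yH chi cchi; exists h; split=> //.
have := chiU (h - y); rewrite /= subrK; apply=> n.
by rewrite characterB// yh subrr.
Qed.

(* [h] agrees with [y] on the countably many characters that determine the
   closures of the preimages of the rational rays, so [f h] is the limit. *)
Lemma continuous_limit (f : H -> R) (y : K) : continuous f -> l_closure R H y ->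
  exists v, forall e, 0 < e -> exists2 O, nbhs y O &
    forall h : H, O (set_val h) -> `|f h - v| <= e.
Proof.
move=> cf yl.
have op (V : set R) : open V ->
    exists2 U : set K, open U & forall h : H, U (set_val h) <-> V (f h).
  move=> oV; have /continuousP/(_ V oV) := cf.
  move=> [U oU UE]; exists U => // h.
  by rewrite -[V (f h)]/((f @^-1` V) h) -UE.
have ex (t : rat * bool) : exists U : set K, open U /\
    forall h : H, U (set_val h) <->
      if t.2 then ratr t.1 < f h else f h < ratr t.1.
  case: t => q [] /=.
    by have [U oU UP] := op _ (@open_gt R (ratr q)); exists U.
  by have [U oU UP] := op _ (@open_lt R (ratr q)); exists U.
have [U UP] := choice ex.
have ex2 t : exists chi : nat -> K -> circle R, (forall n, character (chi n)) /\
    forall y h, closure H y -> H h -> (forall n, chi n h = chi n y) ->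
      closure (U t `&` H) y -> closure (U t `&` H) h.
  by have [chi ? ?] := closure_open_character_invariant (UP t).1; exists chi.
have [chi chiP] := choice ex2.
have [eta ceta etaP] := countable_character_seq (fun t n => (chiP t).1 n).
have [h Hh yh] := (l_closureP R y sH).1 yl eta ceta.
pose h' : H := SigSub (mem_set Hh).
have key t : closure (U t `&` H) y -> closure (U t `&` H) h.
  apply: (chiP t).2 => // [|n]; first exact: l_closure_sub_closure.
  by have [m <-] := etaP t n.
(* If [f h'] has a neighbourhood avoiding the ray of [t], then [h] is outside the closure of [U t]
   in [H]; by [key] so is [y]. *)
have away t (V : set R) : open V -> V (f h') ->
    (forall z : H, U t (set_val z) -> ~ V (f z)) ->
    exists2 O, nbhs y O & forall z : H, O (set_val z) -> ~ U t (set_val z).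
  move=> oV Vh UV.
  have : ~ closure (U t `&` H) y.
    move=> /key ch; have [U' oU' U'P] := op V oV.
    have U'h : nbhs h U'.
      by apply: open_nbhs_nbhs; split=> //; exact: ((U'P h').2 Vh).
    have [z [[Uz Hz] U'z]] := ch _ U'h.
    pose z' : H := SigSub (mem_set Hz).
    by apply: (UV z') => //; exact/(U'P z').
  move=> /existsNP[Q /not_implyP[nQ h0]]; exists Q => // z Qz Uz.
  by apply: h0; exists (set_val z); split=> //; split=> //; exact: set_valP.
have UP1 t (z : H) := (UP t).2 z.
exists (f h') => e e0.
have /rat_in_itvoo[q1] : f h' < f h' + e by rewrite ltrDl.
have /rat_in_itvoo[q2] : f h' - e < f h' by rewrite gtrBl.
rewrite !in_itv/= => /andP[q2l q2r] /andP[q1l q1r].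
have [N1 nN1 N1P] : exists2 O, nbhs y O & forall z : H, O (set_val z) ->
    ~ U (q1, true) (set_val z).
  apply: (away _ _ (@open_lt R (ratr q1))) => //.
  by move=> z /(UP1 (q1, true)) /= h1 h2; have := lt_trans h1 h2; rewrite ltxx.
have [N2 nN2 N2P] : exists2 O, nbhs y O & forall z : H, O (set_val z) ->
    ~ U (q2, false) (set_val z).
  apply: (away _ _ (@open_gt R (ratr q2))) => //.
  by move=> z /(UP1 (q2, false)) /= h1 h2; have := lt_trans h1 h2; rewrite ltxx.
exists (N1 `&` N2); first exact: filterI.
move=> z [/N1P h1 /N2P h2].
have z1 : f z <= ratr q1 by rewrite leNgt; apply/negP => h3; apply: h1; apply/(UP1 (q1, true)).
have z2 : ratr q2 <= f z by rewrite leNgt; apply/negP => h3; apply: h2; apply/(UP1 (q2, false)).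
rewrite ler_norml; apply/andP; split; lra.
Qed.

End subgroup_of_compact.

(** * Realcompact and pseudocompact subgroups *)

Lemma nbhs_set_type (X : topologicalType) (H : set X) (h : H) (A : set H) :
  nbhs h A -> exists2 O, nbhs (set_val h) O &
    forall z : H, O (set_val z) -> A z.
Proof.
move=> [_ [/= [W oW <-] Wh] WA]; exists W; first exact: open_nbhs_nbhs.
by move=> z Wz; exact: WA.
Qed.

Lemma set_type_nbhs (X : topologicalType) (H : set X) (h : H) (O : set X) :
  nbhs (set_val h) O -> nbhs h [set z : H | O (set_val z)].
Proof. exact: (@initial_continuous H X set_val h O). Qed.

Lemma ptws_coordinate (R : realType) (I : Type) (v : {ptws I -> R}) i
    (A : set R) :
  nbhs (v i) A -> nbhs v [set u | A (u i)].
Proof.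
move=> nA; have vv : nbhs v --> v by [].
move/cvg_sup : vv => /(_ i); apply.
exact: (@initial_continuous _ _ (fun u : {ptws I -> R} => u i) v A nA).
Qed.

Lemma ptws_cvg (R : realType) (I : Type) (F : set_system {ptws I -> R})
    (v : {ptws I -> R}) : Filter F ->
  (forall i, u i @[u --> F] --> v i) -> F --> v.
Proof.
move=> FF Fv; apply/cvg_sup => i A /=.
rewrite {1}/nbhs/= => -[B [[C oC <-] Cv] BA].
apply: (filterS BA); apply: (Fv i C); exact: open_nbhs_nbhs.
Qed.

Section realcompact_subgroup.
Context (R : realType) (K : topologicalZmodType).
Hypotheses (cK : compact [set: K]) (hK : hausdorff_space K).
Context (H : set K).
Hypothesis sH : zmod_closed (mem H).

Lemma characters_separate (x y : K) :
  (forall f : K -> circle R, character f -> f x = f y) -> x = y.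
Proof.
move=> xy; apply/eqP; rewrite -subr_eq0; apply/eqP.
have s0 : zmod_closed (mem [set (0 : K)]).
  by split=> [|a c]; rewrite !inE// => -> ->; rewrite subr0.
have c0 : closed [set (0 : K)].
  by apply: accessible_closed_set1; exact: hausdorff_accessible.
apply: contrapT => n0.
have [f cf [_ /eqP]] := @character_separation R K [set 0] _ cK hK s0 c0 n0.
by rewrite characterB// xy// subrr.
Qed.

Let dist_to (chi : nat -> K -> circle R) (y z : K) := sdist (circ_coord chi) z y.

(* [H] embeds as a closed subset of a power of the line through the cosines and
   sines of all characters, and, for every point [y] outside [H], the inverse of
   a distance to a coset of [y] missing [H]. *)
Lemma l_closed_realcompact : l_closed R H -> realcompact R H.
Proof.
move=> lH.
have exy (y : {y : K | ~ H y}) : exists chi : nat -> K -> circle R,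
    (forall n, character (chi n)) /\
    forall h, H h -> ~ forall n, chi n (sval y) = chi n h.
  case: y => y nHy /=.
  apply: contrapT => no; apply: nHy; rewrite -lH; apply/(l_closureP R y sH).
  move=> chi cchi; apply: contrapT => no2; apply: no; exists chi; split=> //.
  by move=> h Hh yh; apply: no2; exists h.
have [X XP] := choice exy.
pose g y z := dist_to (X y) (sval y) z.
have cX y n : continuous (circ_coord (X y) n).
  by apply: continuous_circ_coord; exact: (XP y).1.
have X1 y n z : `|circ_coord (X y) n z| <= 1 by exact: circ_coord_le1.
have cg y : continuous (g y).
  exact: continuous_sdist.
have g0 y h : H h -> 0 < g y h.
  move=> Hh; rewrite lt_neqAle sdist_ge0 ?andbT; last exact: X1.
  apply/eqP => /esym/(sdist_eq0 (X1 y))/circ_coord_inj hy.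
  by apply: ((XP y).2 h Hh) => n.
pose I := ({f : K -> circle R | character f} * bool + {y : K | ~ H y})%type.
pose coord (i : I) (z : K) : R := match i with
  | inl (f, true) => circ_cos (sval f z)
  | inl (f, false) => circ_sin (sval f z)
  | inr y => (g y z)^-1 end.
have ccoord i h : H h -> {for h, continuous (coord i)}.
  case: i => [[[f cf] []]|y] Hh /=.
  - exact: continuous_cos_character.
  - exact: continuous_sin_character.
  - have gn0 : g y h != 0 by rewrite gt_eqF// g0.
    by apply: (cvgV gn0); exact: cg.
pose F (h : H) : {ptws I -> R} := fun i => coord i (set_val h).
have cF i : continuous (fun h : H => F h i).
  move=> h; apply: (@continuous_comp _ _ _ (@set_val _ H) (coord i)).
    exact: initial_continuous.
  by apply: ccoord; exact: set_valP.
pose C : set {ptws I -> R} := range F.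
have nV (v : {ptws I -> R}) i (A : set R) : nbhs (v i) A -> nbhs v [set u | A (u i)].
  exact: ptws_coordinate.
have clC : closed C.
  move=> v vC.
  pose B (V : set {ptws I -> R}) := @set_val _ H @` (F @^-1` V).
  have BF : ProperFilter (filter_from (nbhs v) B).
    apply: filter_from_proper; last first.
      move=> V /vC[_ [[h _ <-] Vh]].
      by exists (set_val h), h.
    apply: filter_from_filter; first by exists setT; exact: filterT.
    move=> V W nVv nW; exists (V `&` W); first exact: filterI.
    by move=> _ [h [Vh Wh] <-]; split; exists h.
  have [k [_ kB]] : [set: K] `&` cluster (filter_from (nbhs v) B) !=set0.
    by apply: cK; exact: filterT.
  (* Near a point outside [H] the matching reciprocal coordinate is unbounded, while near [v] it
     stays bounded. *)
  have Hk : H k.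
    apply: contrapT => nHk; pose y : {y : K | ~ H y} := exist _ k nHk.
    pose c := `|v (inr y)| + 1; have c0 : 0 < c by rewrite ltr_wpDl.
    have nA : nbhs v [set u | u (inr y) < c].
      apply: (nV v (inr y) [set t | t < c]); apply: open_nbhs_nbhs; split; first exact: open_lt.
      by rewrite /= (le_lt_trans (ler_norm _))// ltrDl.
    have nk : nbhs k [set z | g y z < c^-1].
      have gk : g y k = 0 by exact: sdistxx (X1 y) k.
      by move/cvgr_lt : (cg y k); apply; rewrite gk invr_gt0.
    have [_ [[h /= hc <-] /= gc]] :=
      kB _ _ (ex_intro2 _ _ _ nA (fun _ => id)) nk.
    have gh : 0 < g y (set_val h) by apply: g0; exact: set_valP.
    by move: gc; rewrite ltNge; rewrite -[leRHS]invrK lef_pV2 ?posrE ?invr_gt0// ltW.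
  pose k' : H := SigSub (mem_set Hk).
  exists k' => //; apply/funext => i; apply/eqP; rewrite -subr_eq0 -normr_le0.
  apply/ler_addgt0Pl => e e0; rewrite addr0; have e2 : 0 < e / 2 by rewrite divr_gt0.
  have nA : nbhs v [set u | `|v i - u i| < e / 2].
    by apply: (nV v i [set t | `|v i - t| < e / 2]); apply/nbhs_ballP; exists (e / 2).
  have [N nN NP] := nbhs_set_type ((cvgrPdist_lt _ _).1 (cF i k') _ e2).
  have [_ [[h /= he <-] Nh]] := kB _ _ (ex_intro2 _ _ _ nA (fun _ => id)) nN.
  have /= h2 := NP h Nh.
  have -> : F k' i - v i = (F k' i - F h i) - (v i - F h i) by ring.
  by rewrite (le_trans (ler_normB _ _))// [e]splitr lerD// ltW.
have Finj h h' : F h = F h' -> h = h'.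
  move=> hh; apply: val_inj; apply: characters_separate => f cf.
  pose ff : {f : K -> circle R | character f} := exist _ f cf.
  have c := congr1 (fun u => u (inl (ff, true))) hh.
  have s := congr1 (fun u => u (inl (ff, false))) hh.
  exact: circ_inj c s.
exists I, C; split=> //.
pose f (h : H) : C := SigSub (mem_set (imageP F (Logic.I : [set: H] h))).
have exg (c : C) : exists h, F h = set_val c.
  by have [h _ hc] := set_valP c; exists h.
have [r rP] := choice exg.
have fr : cancel r f by move=> c; apply: val_inj; exact: rP.
exists f, r; split=> //.
- by move=> h; apply: Finj; rewrite rP.
- move=> h A /nbhs_set_type[N nN NA].
  have : {ptws, F @ h --> F h}.
    by apply: ptws_cvg => i; exact: cF.
  move=> /(_ N nN) hN; have {}hN : nbhs h [set z | N (F z)] := hN.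
  by apply: filterS hN => z /= Nz; exact: NA.
- move=> c A /nbhs_set_type[N nN NA].
  set h0 := set_val (r c) in nN.
  have U0 : nbhs 0 [set x | N (x + h0)].
    by have := @continuous_translate _ h0 0 N; rewrite add0r; apply.
  have [l [d [lc d0 lU]]] := nbhs0_characters R cK hK U0.
  have : nbhs c [set c' : C | char_nbhs l d (set_val (r c') - h0)].
    elim: l lc {lU} => [|ch l IH] lc.
      by apply: (filterS _ filterT) => c' _ f'.
    have cch : character ch by apply: lc; rewrite mem_head.
    pose ff : {f : K -> circle R | character f} := exist _ ch cch.
    (* The addition formula writes [circ_cos (ch (_ - h0))] through two coordinates of the
       embedding; this makes the inverse continuous. *)
    pose p (u : {ptws I -> R}) := u (inl (ff, true)) * circ_cos (ch h0) +
      u (inl (ff, false)) * circ_sin (ch h0).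
    have pE c' : p (set_val c') = circ_cos (ch (set_val (r c') - h0)).
      by rewrite -rP characterB// circ_cosD circ_cosN circ_sinN mulrN opprK.
    have np : nbhs (set_val c) [set u | 1 - d < p u].
      have FV : Filter (nbhs (set_val c : {ptws I -> R})) by exact: nbhs_filter.
      have cp : p u @[u --> (set_val c : {ptws I -> R})] --> p (set_val c).
        have cu i : (u i : R) @[u --> (set_val c : {ptws I -> R})] --> set_val c i.
          by move=> V; exact: nV.
        apply: (cvgD (cvgM (cu (inl (ff, true))) (cvg_cst _))
          (cvgM (cu (inl (ff, false))) (cvg_cst _))); exact: FV.
      move/cvgr_gt : cp; apply; rewrite pE subrr (character0 cch) circ_cos0.
      by rewrite gtrBl.
    have IH' : nbhs c [set c' : C | char_nbhs l d (set_val (r c') - h0)].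
      by apply: IH => f' f'l; apply: lc; rewrite inE f'l orbT.
    apply: filterS2 IH' (set_type_nbhs np) => c' IHc /=.
    rewrite pE => pc f'; rewrite inE => /orP[/eqP->//|]; exact: IHc.
  by apply: filterS => c' /lU /=; rewrite subrK => /NA.
Qed.

(** The coordinates of the embedding have limits at [y] along [H], so the trace of the
    neighbourhoods of [y] converges in the closed set [C]. Pulled back by [g] it converges to a
    point of [H], which is [y] as [K] is Hausdorff. *)
Lemma realcompact_l_closed : realcompact R H -> l_closed R H.
Proof.
move=> [I [C [clC [f [g [fK gK cf cg]]]]]].
apply/seteqP; split; last exact: sub_l_closure.
move=> y yl; have yH := l_closure_sub_closure cK hK sH yl.
have cfi i : continuous (fun h : H => (set_val (f h) : {ptws I -> R}) i).
  move=> h V nV.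
  have c1 : {for h, continuous (fun z : H => set_val (f z) : {ptws I -> R})}.
    apply: (@continuous_comp _ _ _ f (@set_val _ C)); first exact: cf.
    exact: initial_continuous.
  exact: c1 _ (ptws_coordinate (v := set_val (f h)) nV).
have [v vP] := choice (fun i => continuous_limit cK hK sH (cfi i) yl).
pose T := filter_from (nbhs y) (fun O => [set h : H | O (set_val h)]).
have PT : ProperFilter T.
  apply: filter_from_proper; last first.
    by move=> O /yH[h [Hh Nh]]; exists (SigSub (mem_set Hh)).
  apply: filter_from_filter; first by exists setT; exact: filterT.
  move=> V W nV nW; exists (V `&` W); first exact: filterI.
  by move=> h [].
have Tv : {ptws, (fun h : H => set_val (f h) : {ptws I -> R}) @ T --> v}.
  apply: ptws_cvg => i; apply/cvgrPdist_le => e e0.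
  have [N nN NP] := vP i e e0; exists N => // h Nh.
  by rewrite /= distrC; exact: NP.
have Cv : C v.
  apply: (closed_cvg _ clC _ _ Tv).
  by exists setT; [exact: filterT|move=> h _; exact: set_valP].
pose c : C := SigSub (mem_set Cv).
have Tc : f @ T --> c.
  by move=> A /nbhs_set_type[N nN NA]; have TN : T [set h | N (set_val (f h))] := Tv N nN;
  apply: filterS TN => h /NA.
have Tg : T --> g c.
  move=> A nA; have TA : T [set h | A (g (f h))] := Tc _ (cg c A nA).
  by apply: filterS TA => h /=; rewrite fK.
suff -> : y = set_val (g c) by exact: set_valP.
apply: hK => A B nA nB.
have [N nN NB] := Tg _ (set_type_nbhs nB).
have [h [Hh [Ah Nh]]] := yH _ (filterI nA nN).
by exists h; split=> //; apply: (NB (SigSub (mem_set Hh))).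
Qed.

(** Large values of an unbounded function would accumulate at some [y] of the compact group, where
    the function has a finite limit along [H]. *)
Lemma l_dense_pseudocompact : l_dense R H -> dense H /\ pseudocompact R H.
Proof.
move=> lH; have yl y : l_closure R H y by rewrite lH.
split.
  move=> O [y Oy] oO.
  have [h [Hh Nh]] := l_closure_sub_closure cK hK sH (yl y) (open_nbhs_nbhs (conj oO Oy)).
  by exists h.
move=> f cf; apply: contrapT => /forallNP no.
pose B (n : R) := @set_val _ H @` [set h : H | n < `|f h|].
have BF : ProperFilter (filter_from setT B).
  apply: filter_from_proper; last first.
    move=> n _; apply: contrapT => h; apply: (no n) => x.
    by rewrite leNgt; apply/negP => nx; apply: h; exists (set_val x), x.
  apply: filter_from_filter; first by exists 0.
  move=> m n _ _; exists (Num.max m n) => // t [h /= hmn <-].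
  by move: hmn; rewrite gt_max => /andP[mh nh]; split; exists h.
have [y [_ yB]] : [set: K] `&` cluster (filter_from setT B) !=set0.
  by apply: cK; exact: filterT.
have [v vP] := continuous_limit cK hK sH cf (yl y).
have [N nN NP] := vP 1 ltr01.
have [_ [[h /= vh <-] Nh]] :=
  yB _ _ (ex_intro2 _ _ (`|v| + 1) Logic.I (fun _ => id)) nN.
have := NP h Nh; rewrite leNgt => /negP; apply.
have := ler_norm (v - f h) => _.
have : `|f h| <= `|f h - v| + `|v| by rewrite -{1}[f h](subrK v) ler_normD.
by move: vh; lra.
Qed.

Lemma pseudocompact_l_dense : dense H -> pseudocompact R H -> l_dense R H.
Proof.
move=> dH pH; rewrite /l_dense -subTset => y _; apply/(l_closureP R y sH).
move=> chi cchi; apply: contrapT => no.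
pose g z := dist_to chi y z.
have c1 n z : `|circ_coord chi n z| <= 1 by exact: circ_coord_le1.
have cc n : continuous (circ_coord chi n) by exact: continuous_circ_coord.
have cg : continuous g by exact: continuous_sdist.
have g0 h : H h -> 0 < g h.
  move=> Hh; rewrite lt_neqAle sdist_ge0// andbT.
  apply/eqP => /esym/(sdist_eq0 c1)/circ_coord_inj hy.
  by apply: no; exists h.
have cf : continuous (fun h : H => (g (set_val h))^-1).
  move=> h; have gn0 : g (set_val h) != 0.
    by rewrite gt_eqF// g0//; exact: set_valP.
  have ch : {for h, continuous (fun z : H => g (set_val z))}.
    apply: (@continuous_comp _ _ _ (@set_val _ H) g); last exact: cg.
    exact: initial_continuous.
  exact: (cvgV gn0 ch).
have [M MP] := pH _ cf.
pose c := `|M| + 1; have c0 : 0 < c by rewrite ltr_wpDl.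
have ny : nbhs y [set z | g z < c^-1].
  have gy : g y = 0 by exact: sdistxx.
  by move/cvgr_lt : (cg y); apply; rewrite gy invr_gt0.
move: ny; rewrite nbhsE => -[N [oN Ny] NP].
have [h [Nh Hh]] := dH N (ex_intro _ y Ny) oN.
have := MP (SigSub (mem_set Hh)); rewrite /= ger0_norm; last by rewrite invr_ge0 ltW// g0.
have := NP h Nh; rewrite /= -ltf_pV2 ?posrE ?invr_gt0 ?g0// invrK /c => h1.
by have := ler_norm M; move: h1; lra.
Qed.

End realcompact_subgroup.

(** * Metrizability through a separating sequence of characters *)

Section metrizability.
Context (R : realType) (K : topologicalZmodType).
Hypotheses (cK : compact [set: K]) (hK : hausdorff_space K).

Lemma metrizable_character_seq : metrizable R K ->
  exists2 chi : nat -> K -> circle R, forall n, character (chi n) &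
    forall x, (forall n, chi n x = 0) -> x = 0.
Proof.
move=> [M [f [g [fK gK cf cg]]]].
have ex (n : nat) : exists chi : nat -> K -> circle R,
    (forall m, character (chi m)) /\
    forall x, (forall m, chi m x = 0) -> ball (f 0) n.+1%:R^-1 (f x).
  have nU : nbhs 0 [set x | ball (f 0) n.+1%:R^-1 (f x)].
    by apply: (cf 0); apply/nbhs_ballP; exists n.+1%:R^-1 => //=; rewrite invr_gt0.
  by have [chi ? ?] := nbhs0_character_seq R cK hK nU; exists chi.
have [chi chiP] := choice ex.
have [eta ceta etaP] := countable_character_seq (fun n m => (chiP n).1 m).
exists eta => // x x0.
have xb n : ball (f 0) n.+1%:R^-1 (f x).
  by apply: (chiP n).2 => m; have [k <-] := etaP n m.
suff : f 0 = f x by move=> /(can_inj fK).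
apply: mdist_positivity; apply/le_anti; rewrite mdist_ge0 andbT.
apply/ler_addgt0Pl => e e0; rewrite addr0.
have := xb (Num.truncn e^-1); rewrite ballEmdist/= => /ltW/le_trans; apply.
by rewrite invf_ple ?posrE ?ltr0n// ltW// truncnS_gt.
Qed.

Lemma metrizable_l_closed : metrizable R K ->
  forall L : set K, zmod_closed (mem L) -> l_closed R L.
Proof.
move=> /metrizable_character_seq[chi cchi chi0] L sL.
apply/seteqP; split; last exact: sub_l_closure.
move=> y /(l_closureP R y sL)/(_ chi cchi)[h Lh yh].
suff -> : y = h by [].
apply/eqP; rewrite -subr_eq0; apply/eqP/chi0 => n.
by rewrite characterB// yh subrr.
Qed.

End metrizability.

(** * Independent characters *)

Section span.
Context (V : zmodType).
Implicit Types (X Y A B : set V) (s : seq V).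

Definition span Y : set V :=
  [set v | forall A, zmod_closed (mem A) -> Y `<=` A -> A v].

(** Directness of the sum of the cyclic groups generated by the members, stated without
    coefficients. Torsion members are allowed, and 0 is not excluded, whence the separate condition
    [~ X 0] later. *)
Definition independent X := forall A B, A `<=` X -> B `<=` X ->
  A `&` B = set0 -> span A `&` span B `<=` [set 0].

Lemma zmod_closed_span Y : zmod_closed (mem (span Y)).
Proof.
split=> [|a b]; rewrite !inE; first by move=> A sA _; exact: subgroup0.
move=> aY bY A sA YA.
by apply: subgroupB => //; [exact: aY|exact: bY].
Qed.

Lemma sub_span Y : Y `<=` span Y.
Proof. by move=> y Yy A _; exact. Qed.

Lemma span_min Y A : zmod_closed (mem A) -> Y `<=` A -> span Y `<=` A.
Proof. by move=> sA YA v; exact. Qed.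

Lemma span_mono A B : A `<=` B -> span A `<=` span B.
Proof.
move=> AB; apply: span_min; first exact: zmod_closed_span.
by move=> a /AB; exact: sub_span.
Qed.

Lemma span_set0 v : span set0 v -> v = 0.
Proof.
move=> /(_ [set 0]); apply=> //.
by split=> [|a b]; rewrite !inE// => -> ->; rewrite subr0.
Qed.

Lemma span_finitary Y v : span Y v ->
  exists2 s : seq V, (forall u, u \in s -> Y u) & span [set u | u \in s] v.
Proof.
move: v; apply: span_min => [|v Yv].
  split=> [|a b]; rewrite !inE.
    by exists [::] => //; apply: subgroup0; exact: zmod_closed_span.
  move=> [s sY sa] [t tY tb]; exists (s ++ t).
    by move=> u; rewrite mem_cat => /orP[/sY|/tY].
  apply: (subgroupB (zmod_closed_span _)).
    by apply: span_mono sa => u /= us; rewrite mem_cat us.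
  by apply: span_mono tb => u /= ut; rewrite mem_cat ut orbT.
exists [:: v]; first by move=> u; rewrite inE => /eqP->.
by apply: sub_span; rewrite /= mem_head.
Qed.

Lemma span_split A d v : span A v ->
  exists n : int, span (A `\ d) (v - d *~ n).
Proof.
move: v; apply: span_min => [|v Av].
  split=> [|a b]; rewrite !inE.
    by exists 0; rewrite mulr0z subr0; apply: subgroup0; exact: zmod_closed_span.
  move=> [m am] [n bn]; exists (m - n).
  have -> : a - b - d *~ (m - n) = (a - d *~ m) - (b - d *~ n).
    by rewrite mulrzBr !opprB addrACA [RHS]addrACA [- b - _]addrC.
  exact: (subgroupB (zmod_closed_span _)).
have [->|/eqP vd] := eqVneq v d.
  by exists 1; rewrite mulr1z subrr; apply: subgroup0; exact: zmod_closed_span.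
by exists 0; rewrite mulr0z subr0; apply: sub_span; split.
Qed.

Lemma countable_span Y : countable Y -> countable (span Y).
Proof.
move=> /(countable_set_seq 0)[e Ye _].
pose f (s : seq (bool * nat)) : V :=
  \sum_(p <- s) (if p.1 then e p.2 else - e p.2).
apply: (@sub_countable _ _ _ (range f)); last first.
  by apply: sub_countable (card_image_le _ _) _; exact: countableP.
apply: subset_card_le; apply: span_min => [|y Yy]; last first.
  by have [n <-] := Ye y Yy; exists [:: (true, n)] => //; rewrite /f big_seq1.
split=> [|a b]; rewrite !inE; first by exists [::] => //; rewrite /f big_nil.
move=> [s _ <-] [t _ <-]; exists (s ++ [seq (~~ p.1, p.2) | p <- t]) => //.
rewrite /f big_cat big_map -sumrN/=; congr (_ + _).
by apply: eq_bigr => -[[] n] _ //=; rewrite opprK.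
Qed.

(** A common element of two spans uses finitely many generators, which lie in one member of the
    chain; if there are none, no member need exist, but the element is 0. *)
Lemma independent_bigcup (F : set (set V)) : total_on F subset ->
  F `<=` independent -> independent (\bigcup_(X in F) X).
Proof.
move=> tF iF A B AF BF AB v [/span_finitary[s sA sv] /span_finitary[t tB tv]].
have [st|[Z FZ Zst]] : s ++ t = [::] \/
    exists2 Z, F Z & forall u, u \in s ++ t -> Z u.
  have : forall u, u \in s ++ t -> (\bigcup_(X in F) X) u.
    by move=> u; rewrite mem_cat => /orP[/sA/AF|/tB/BF].
  elim: (s ++ t) => [|a r IH] ar; [by left|right].
  have [Z FZ Za] := ar a (mem_head _ _).
  have [->|[Y FY Yr]] := IH (fun u ur => ar u (mem_behead (s := a :: r) ur)).
    by exists Z => // u; rewrite inE => /eqP->.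
  have [ZY|YZ] := tF Z Y FZ FY.
    by exists Y => // u; rewrite inE => /orP[/eqP->|/Yr//]; exact: ZY.
  by exists Z => // u; rewrite inE => /orP[/eqP->//|/Yr]; exact: YZ.
- have s0 : s = [::] by case: s st {sA sv}.
  apply: span_set0; apply: span_mono sv => u /=; by rewrite s0.
- apply: (iF Z FZ [set u | u \in s] [set u | u \in t]) => [u us|u ut||]; last by split.
  + by apply: Zst; rewrite mem_cat us.
  + by apply: Zst; rewrite mem_cat ut orbT.
  + by rewrite -subset0 -AB => u [/sA ? /tB].
Qed.

(* If [d] is outside a maximal independent [X], a relation between disjoint
   subsets of [d |` X] must involve [d]. *)
Lemma maximal_independent (D : set V) : zmod_closed (mem D) ->
  exists X, [/\ X `<=` D, ~ X 0, independent X &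
    forall d, D d -> d != 0 -> exists n, d *+ n != 0 /\ span X (d *+ n)].
Proof.
move=> sD; pose P X := [/\ X `<=` D, ~ X 0 & independent X].
have PU F : F `<=` P -> total_on F subset -> P (\bigcup_(X in F) X).
  move=> FP tF; split.
  - by move=> v [X /FP[XD _ _]]; exact: XD.
  - by move=> [X /FP[_ X0 _]].
  - by apply: independent_bigcup => // X /FP[].
have [X [[XD X0 iX] mX]] := Zorn_bigcup PU.
exists X; split=> // d Dd d0.
have [Xd|nXd] := pselect (X d).
  by exists 1%N; rewrite mulr1n; split=> //; exact: sub_span.
suff [n [dn0 Xdn]] : exists n : int, d *~ n != 0 /\ span X (d *~ n).
  case: n dn0 Xdn => n dn0 Xdn; first by exists n.
  exists n.+1; split; first by move: dn0; rewrite NegzE mulrNz oppr_eq0.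
  rewrite -[_ *+ _]opprK; apply: (subgroupN (zmod_closed_span _)).
  by rewrite NegzE mulrNz in Xdn.
apply: contrapT => no; apply: (mX (d |` X)).
  by split=> [|/(_ d (or_introl erefl))//] x Xx; right.
split; [by move=> x [->|/XD]|by move=> [/esym/eqP|//]; rewrite (negPf d0)|].
have sub A : A `<=` d |` X -> A `\ d `<=` X.
  by move=> AX a [/AX[->|//] /= /(_ erefl)].
(* Here [v] is [d *~ n] plus an element of the span of [A] without [d], so [d *~ n] lies in [span X]
   and must vanish; the relation then lives in [X]. *)
have main A B : A `<=` d |` X -> B `<=` X -> A `&` B = set0 ->
    span A `&` span B `<=` [set 0].
  move=> AX BX AB v [Av Bv]; have [n vn] := span_split d Av.
  have sX := zmod_closed_span X.
  have dn0 : d *~ n = 0.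
    apply/eqP/negP => /negP dn; apply: no; exists n; split=> //.
    have -> : d *~ n = v - (v - d *~ n) by rewrite subKr.
    apply: (subgroupB sX); first exact: span_mono Bv.
    exact: span_mono (sub _ AX) _ vn.
  rewrite dn0 subr0 in vn.
  apply: (iX (A `\ d) B) => //; first exact: sub.
  by rewrite -subset0 -AB => u [[]].
move=> A B AX BX AB; have [Bd|nBd] := pselect (B d).
  rewrite setIC; apply: main => //; last by rewrite setIC.
  move=> a Aa; have [ad|//] := AX a Aa.
  by have : (A `&` B) a by [split=> //; rewrite ad]; rewrite AB.
apply: main => // b Bb; have [bd|//] := BX b Bb.
by rewrite bd in Bb.
Qed.

Lemma countable_fibers (T U : Type) (f : T -> U) (A : set T) (S : set U) :
  countable S -> (forall a, A a -> S (f a)) ->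
  (forall u, countable (A `&` [set a | f a = u])) -> countable A.
Proof.
move=> cS AS cf.
have : countable (\bigcup_(u in S) (A `&` [set a | f a = u])).
  exact: bigcup_countable.
apply: sub_countable; apply: subset_card_le => a Aa.
by exists (f a); [exact: AS|split].
Qed.

(* By strong induction on [n], countably many elements have their [n]-th
   multiple in the countable group [span X]: two elements with the same
   multiple differ by an [n]-torsion element, whose first nonzero multiple in
   [span X] has index below [n]. *)
Lemma countable_torsion_over (D X : set V) : zmod_closed (mem D) ->
  countable X ->
  (forall d, D d -> d != 0 -> exists n, d *+ n != 0 /\ span X (d *+ n)) ->
  countable D.
Proof.
move=> sD /countable_span cX DX; have sX := zmod_closed_span X.
pose T n := D `&` [set d | span X (d *+ n)].
have cT n : (0 < n)%N -> countable (T n).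
  elim/ltn_ind: n => n IH n0.
  have cD : countable (D `&` [set d | d *+ n = 0]).
    have : countable ([set (0 : V)] `|`
        \bigcup_(k in [set k | (0 < k < n)%N]) T k).
      rewrite -bigcup2E; apply: bigcup_countable => // -[|[|i]] _ /=.
      - exact: countable1.
      - by apply: bigcup_countable => // k /andP[k0 kn]; exact: IH.
      - exact: countable0.
    apply: sub_countable; apply: subset_card_le => d [Dd /= dn].
    have [->|d0] := eqVneq d 0; [by left|right].
    have [k [dk Xdk]] := DX d Dd d0.
    have km : d *+ (k %% n) = d *+ k.
      by rewrite {2}(divn_eq k n) mulrnDr mulnC mulrnA dn mul0rn add0r.
    exists (k %% n)%N; last by split=> //=; rewrite km.
    rewrite /= ltn_pmod// andbT lt0n; apply: contra_neq dk => kn.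
    by rewrite -km kn mulr0n.
  apply: (@countable_fibers _ _ (fun d => d *+ n) _ (span X)) => //.
    by move=> d [].
  move=> u; have [[d0 [[Dd0 _] /= d0u]]|no] :=
      pselect (exists d, (T n `&` [set d | d *+ n = u]) d); last first.
    suff -> : T n `&` [set d | d *+ n = u] = set0 by exact: countable0.
    by rewrite -subset0 => d Td; apply: no; exists d.
  have : countable ((fun d => d + d0) @` (D `&` [set d | d *+ n = 0])).
    exact: sub_countable (card_image_le _ _) cD.
  apply: sub_countable; apply: subset_card_le => d [[Dd _] /= du].
  exists (d - d0); last by rewrite subrK.
  by split; [exact: subgroupB|rewrite /= mulrnBl du d0u subrr].
have : countable (\bigcup_(n in [set n | (0 < n)%N]) T n).
  exact: bigcup_countable.
apply: sub_countable; apply: subset_card_le => d Dd.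
have [->|d0] := eqVneq d 0.
  exists 1%N => //; split; first exact: subgroup0.
  by rewrite /= mulr1n; exact: subgroup0.
have [n [dn Xdn]] := DX d Dd d0; exists n => //.
by rewrite /= lt0n; apply: contra_neq dn => ->; rewrite mulr0n.
Qed.

End span.

Lemma compact_finite_cover (X : topologicalType) (U : X -> set X) :
  compact [set: X] -> (forall x, nbhs x (U x)) ->
  exists s : seq X, forall y, exists2 x, x \in s & U x y.
Proof.
move=> cX nU; apply: contrapT => /forallNP no.
pose B (s : seq X) := [set y | forall x, x \in s -> ~ U x y].
have BF : ProperFilter (filter_from setT B).
  apply: filter_from_proper; last first.
    move=> s _; apply: contrapT => h; apply: (no s) => y.
    apply: contrapT => hy; apply: h; exists y => x xs Uxy.
    by apply: hy; exists x.
  apply: filter_from_filter; first by exists [::].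
  move=> s t _ _; exists (s ++ t) => // y hy.
  by split=> x xs; apply: hy; rewrite mem_cat xs ?orbT.
have [x [_ xB]] : [set: X] `&` cluster (filter_from setT B) !=set0.
  by apply: cX; exact: filterT.
have [y [yx Uxy]] := xB _ _ (ex_intro2 _ _ [:: x] Logic.I (fun _ => id)) (nU x).
by exact: yx x (mem_head _ _) Uxy.
Qed.

(** * Annihilators in a compact group and independent families of characters *)

Section annihilator.
Context (R : realType) (K : topologicalZmodType).
Hypotheses (cK : compact [set: K]) (hK : hausdorff_space K).

Lemma zmod_closed_characters :
  zmod_closed (mem [set f : K -> circle R | character f]).
Proof.
split=> [|f g]; rewrite !inE; first exact: character_cst0.
by move=> cf cg; apply: characterD_character cf (characterN_character cg).
Qed.

Definition annihilator (A : set (K -> circle R)) : set K :=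
  [set k | forall a, A a -> a k = 0].

(** Double annihilator. By compactness finitely many members of [A] control [f]: where they are all
    close to 0, the cosine of [f] is at least 1/2. The representation lemma, with points against
    polynomials, then places [f] in [A]. *)
Lemma annihilator_character (A : set (K -> circle R)) (f : K -> circle R) :
  zmod_closed (mem A) -> (forall a, A a -> character a) -> character f ->
  (forall k, annihilator A k -> f k = 0) -> A f.
Proof.
move=> sA cA cf Af.
have ex (k : K) : exists p : (K -> circle R) * R, [/\ A p.1, 0 < p.2 &
    nbhs k [set u | 2^-1 < circ_cos (f u) \/ circ_cos (p.1 u) < 1 - p.2]].
  have [Ak|nAk] := pselect (annihilator A k).
    exists (0, 1); split=> //=; first exact: subgroup0.
    have : nbhs k [set u | 2^-1 < circ_cos (f u)].
      have cfk : {for k, continuous (fun u => circ_cos (f u))}.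
        exact: continuous_cos_character.
      move/cvgr_gt : cfk; apply.
      by rewrite (Af k Ak) circ_cos0 invf_lt1// ltr1n.
    by apply: filterS => u; left.
  have [a Aa ak] : exists2 a, A a & a k <> 0.
    apply: contrapT => no; apply: nAk => a Aa.
    by apply: contrapT => ak; apply: no; exists a.
  have c1 : circ_cos (a k) < 1.
    by rewrite lt_neqAle circ_cos_le1 andbT; apply/eqP => /circ_cos_eq1.
  exists (a, (1 - circ_cos (a k)) / 2); split=> //=.
    by rewrite divr_gt0// subr_gt0.
  have : nbhs k [set u | circ_cos (a u) < 1 - (1 - circ_cos (a k)) / 2].
    have cak : {for k, continuous (fun u => circ_cos (a u))}.
      by apply: continuous_cos_character; exact: cA.
    move/cvgr_lt : cak; apply.
    by move: c1; lra.
  by apply: filterS => u; right.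
have [p pP] := choice ex.
have nU k : nbhs k [set u | 2^-1 < circ_cos (f u) \/
    circ_cos ((p k).1 u) < 1 - (p k).2] by case: (pP k).
have [s sP] := compact_finite_cover cK nU.
pose d := \big[Num.min/(1 : R)]_(k <- s) (p k).2.
have d0 : 0 < d.
  rewrite /d; elim/big_ind : _ => // [x y x0 y0|k _]; last by case: (pP k).
  by rewrite lt_min x0.
have ds k : k \in s -> d <= (p k).2.
  rewrite /d; clear d d0; elim: s {sP} => // a l IH; rewrite big_cons inE ge_min.
  by move=> /orP[/eqP->|/IH ->]; rewrite ?lexx ?orbT.
pose l := [seq (p k).1 | k <- s].
have lA g : g \in l -> A g by move=> /mapP[k _ ->]; case: (pP k).
(* Index 0 is [f], so ['X^0] stands for it; the later indices are the controlling members of [A]. *)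
pose chi n := if n is m.+1 then nth 0 l m else f.
have lA' m : A (nth 0 l m).
  have [ml|lm] := ltnP m (size l); first exact/lA/mem_nth.
  by rewrite nth_default//; exact: subgroup0.
have cchi n : character (chi n) by case: n => [//|m]; exact/cA/lA'.
pose A' := [set q : {poly int} | A (poly_char chi q)].
have sA' : zmod_closed (mem A').
  have chi0 : poly_char chi 0 = 0.
    by apply/funext => k; rewrite /poly_char size_poly0 big_ord0.
  have chiD q r : poly_char chi (q + r) = poly_char chi q + poly_char chi r.
    by apply/funext => k; rewrite poly_charDl.
  split=> [|q r]; rewrite !inE /A' /=; first by rewrite chi0; exact: subgroup0.
  move=> Aq Ar; have := subgroupB sA Aq Ar; congr A; apply/eqP.
  by rewrite subr_eq -chiD subrK.
pose lX : seq {poly int} := [seq 'X^(n.+1) | n <- iota 0 (size l)].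
have bDl u v q : poly_char chi q (u + v) = poly_char chi q u + poly_char chi q v.
  exact: (character_poly_char cchi q).1.
have bDr u q r := poly_charDl chi q r u.
have [_ /mapP[n _ ->]||q Aq fq] := @continuous_char_represented R K _
    (fun k q => poly_char chi q k) bDl bDr A' 'X^0 lX d sA' _ d0.
- rewrite /A' /=.
  by have := lA' n; congr A; apply/funext => k; rewrite poly_charXn.
- move=> u us; rewrite poly_charXn; have [k ks [/ltW//|]] := sP u.
  have /(nthP 0)[n nl nk] : (p k).1 \in l by exact: map_f.
  have Xl : 'X^(n.+1) \in lX by apply: map_f; rewrite mem_iota.
  have := us _ Xl; rewrite poly_charXn /= nk.
  by move: (ds k ks); lra.
suff -> : f = poly_char chi q by [].
by apply/funext => k; rewrite -fq poly_charXn.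
Qed.

Lemma closed_annihilator (A : set (K -> circle R)) :
  (forall a, A a -> character a) -> closed (annihilator A).
Proof.
move=> cA; have -> : annihilator A =
    \bigcap_(a in A) (fun k => circ_cos (a k)) @^-1` [set 1 : R].
  apply/seteqP; split=> k Ak a Aa /=; first by rewrite (Ak a Aa) circ_cos0.
  exact: circ_cos_eq1 (Ak a Aa).
apply: closed_bigI => a Aa.
apply: (continuous_closedP _).1; first exact: continuous_cos_character (cA a Aa).
exact: closed_eq.
Qed.

(* [annihilator A + annihilator B] is all of [K], since its annihilator is
   contained in [A `&` B]. *)
Lemma disjoint_characters_extend (A B : set (K -> circle R)) (x y : K) :
  zmod_closed (mem A) -> zmod_closed (mem B) ->
  (forall a, A a -> character a) -> (forall b, B b -> character b) ->
  A `&` B `<=` [set 0] ->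
  exists h, (forall a, A a -> a h = a x) /\ (forall b, B b -> b h = b y).
Proof.
move=> sA sB cA cB AB.
pose S := (fun p : K * K => p.1 - p.2) @` (annihilator A `*` annihilator B).
have a0 C : (forall c, C c -> character c) -> annihilator C 0.
  by move=> cC c Cc; rewrite character0//; exact: cC.
have aB C u v : (forall c, C c -> character c) ->
    annihilator C u -> annihilator C v -> annihilator C (u - v).
  by move=> cC Cu Cv c Cc; rewrite (characterB _ _ (cC c Cc)) Cu// Cv// subrr.
have sS : zmod_closed (mem S).
  split=> [|u v]; rewrite !inE.
    by exists (0, 0); [split; exact: a0|rewrite subrr].
  move=> [[u1 u2] /= [Au1 Bu2] <-] [[v1 v2] /= [Av1 Bv2] <-].
  exists (u1 - v1, u2 - v2); first by split; exact: aB.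
  by rewrite /= !opprB addrACA [RHS]addrACA [- v1 - _]addrC.
have cS : closed S.
  apply: compact_closed => //; apply: continuous_compact.
    by apply: continuous_subspaceT; exact: sub_continuous.
  apply: compact_setX; rewrite -[X in compact X]setTI;
    by apply: compact_closedI => //; exact: closed_annihilator.
(* From [u - v = x - y], the point [x - u = y - v] agrees with [x] on [A] and with [y] on [B]. *)
have [[[u v] /= [Au Bv] uv]|nS] := pselect (S (x - y)).
  exists (x - u); split=> [a Aa|b Bb].
    by rewrite (characterB _ _ (cA a Aa)) (Au a Aa) subr0.
  have -> : x - u = y - v.
    by apply/eqP; rewrite subr_eq addrAC -addrA uv addrC subrK.
  by rewrite (characterB _ _ (cB b Bb)) (Bv b Bb) subr0.
have [f cf [fS /eqP]] := @character_separation R K S _ cK hK sS cS nS.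
suff f0 : f = 0 by rewrite f0.
apply: AB; split; apply: annihilator_character => // k hk; apply: fS.
  by exists (k, 0); [split=> //; exact: a0|rewrite /= subr0].
exists (0, - k); last by rewrite /= opprK add0r.
split; first exact: a0.
by rewrite /= -sub0r; apply: aB => //; exact: a0.
Qed.

(* [H] is the group of points killed by all but countably many members of [X].
   It meets every coset of a countable intersection of kernels, since the group
   generated by countably many characters meets [span X] inside the span of a
   countable subset of [X]; but by compactness some point is killed by no
   member of [X]. *)
Lemma independent_not_l_closed (X : set (K -> circle R)) :
  (forall f, X f -> character f) -> ~ X 0 -> independent X -> ~ countable X ->
  exists2 H : set K, zmod_closed (mem H) & ~ l_closed R H.
Proof.
move=> cX X0 iX nX.
pose N x := X `&` [set f | f x != 0].
pose H := [set x | countable (N x)].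
have sp (Y : set (K -> circle R)) : (forall f, Y f -> character f) ->
    forall f, span Y f -> character f.
  by move=> cY; apply: span_min => //; exact: zmod_closed_characters.
have sH : zmod_closed (mem H).
  split=> [|x y]; rewrite !inE.
    have -> : H 0 = countable (set0 : set (K -> circle R)).
      congr countable; rewrite -subset0 => f [Xf] /=.
      by rewrite character0 ?eqxx//; exact: cX.
    exact: countable0.
  move=> Hx Hy; have : countable (N x `|` N y).
    rewrite -bigcup2E; apply: bigcup_countable => // -[|[|i]] _ //=.
  apply: sub_countable; apply: subset_card_le => f [Xf /= fxy].
  have [fx|fx] := eqVneq (f x) 0; last by left.
  right; split=> //=; apply: contra_neq fxy => fy.
  by rewrite (characterB _ _ (cX f Xf)) fx fy subrr.
have ext (A B : set (K -> circle R)) x y : A `<=` X -> B `<=` X ->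
    A `&` B = set0 ->
    exists h, (forall a, A a -> a h = a x) /\ (forall b, B b -> b h = b y).
  move=> AX BX AB.
  have [||f fAB|h [hA hB]] := @disjoint_characters_extend
      (span A) (span B) x y (zmod_closed_span A) (zmod_closed_span B).
  - by apply: sp => f /AX/cX.
  - by apply: sp => f /BX/cX.
  - exact: iX fAB.
  exists h; split=> [a /sub_span/hA//|b /sub_span/hB//].
(* Values can be prescribed independently on disjoint parts of [X], so the members of [l] are
   treated one at a time. The bound is closed and the same for all members, so it passes to all of
   [X] by compactness. *)
have fin (l : seq (K -> circle R)) : (forall f, f \in l -> X f) ->
    exists x, forall f, f \in l -> circ_cos (f x) <= - 2^-1.
  elim: l => [|f l IH] lX; first by exists 0.
  have [x xl] := IH (fun g gl => lX g (mem_behead (s := f :: l) gl)).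
  have Xf : X f by apply: lX; exact: mem_head.
  have [z fz] : exists z, f z != 0.
    apply: contrapT => no; apply: X0; suff -> : (0 : K -> circle R) = f by [].
    apply/funext => z; apply/esym/eqP/negbNE/negP => fz.
    by apply: no; exists z.
  have [n fn] := circ_cos_mulrn_le fz.
  have [|||h [hf hX]] := ext [set f] (X `\ f) (z *+ n) x.
  - by move=> _ ->.
  - by move=> g [].
  - by rewrite -subset0 => g [-> [_ /=]].
  exists h => g; rewrite inE => /orP[/eqP->|gl].
    by rewrite hf// characterMn//; exact: cX.
  have [->|/eqP gf] := eqVneq g f; first by rewrite hf// characterMn//; exact: cX.
  rewrite hX; first exact: xl.
  by split=> //; apply: lX; rewrite inE gl orbT.
have [x xX] : exists x, forall f, X f -> circ_cos (f x) <= - 2^-1.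
  apply: contrapT => /forallNP no.
  have ex x : exists f, X f /\ - 2^-1 < circ_cos (f x).
    apply: contrapT => h; apply: (no x) => f Xf.
    by rewrite leNgt; apply/negP => fx; apply: h; exists f.
  have [f fP] := choice ex.
  have nU x : nbhs x [set u | - 2^-1 < circ_cos (f x u)].
    have cfx : {for x, continuous (fun u => circ_cos (f x u))}.
      by apply: continuous_cos_character; exact: cX _ (fP x).1.
    by move/cvgr_gt : cfx; apply; exact: (fP x).2.
  have [s sP] := compact_finite_cover cK nU.
  have [|x xs] := fin [seq f y | y <- s].
    by move=> _ /mapP[y _ ->]; exact: (fP y).1.
  have [y ys] := sP x; rewrite /= ltNge => /negP; apply.
  by apply: xs; exact: map_f.
have nHx : ~ H x.
  apply: contra_not nX; apply: sub_countable; apply: subset_card_le => f Xf.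
  split=> //=; apply/eqP => fx; have := xX f Xf; rewrite fx circ_cos0; lra.
exists H => // lH; apply: nHx; rewrite -lH; apply/(l_closureP R x sH) => chi cchi.
pose Q := span (range chi) `&` span X.
have cQ : countable Q.
  apply: (@sub_countable _ _ _ (span (range chi))).
    by apply: subset_card_le => f [].
  apply: countable_span; apply: sub_countable (card_image_le _ _) _.
  exact: countableP.
have exJ f : exists J : set (K -> circle R), Q f ->
    [/\ J `<=` X, countable J & span J f].
  have [[_ /span_finitary[s sX sf]]|nQ] := pselect (Q f); last by exists set0.
  exists [set u | u \in s] => _; split=> //.
  by apply: finite_set_countable; exact: finite_seq.
have [J JP] := choice exJ.
pose JJ := \bigcup_(f in Q) J f.
have cJJ : countable JJ by apply: bigcup_countable => // f /JP[].
have JX : JJ `<=` X by move=> g [f /JP[Jf _ _]] /Jf.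
have cc f : range chi f -> character f by move=> [n _ <-].
(* [h] agrees with [x] on the sequence and is killed by [X] outside the countable [JJ], hence lies
   in [H]. The spans meet trivially, as common elements lie in [span JJ]. *)
have [||f [Gf Xf]|h [hG hX]] := @disjoint_characters_extend (span (range chi))
    (span (X `\` JJ)) x 0 (zmod_closed_span _) (zmod_closed_span _).
- exact: sp.
- by apply: sp => f [/cX].
- have Qf : Q f by split=> //; apply: span_mono Xf => g [].
  apply: (iX JJ (X `\` JJ)) => //; first by rewrite -subset0 => g [? []].
  split=> //; have [_ _ ] := JP f Qf; apply: span_mono => g Jg.
  by exists f.
exists h.
  apply: sub_countable cJJ; apply: subset_card_le => f [Xf /=] /eqP fh.
  apply: contrapT => nJ; apply: fh; rewrite hX.
    by rewrite character0//; exact: cX.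
  by apply: sub_span; split.
by move=> n; rewrite hG//; apply: sub_span; exists n.
Qed.

Lemma l_closed_metrizable :
  (forall L : set K, zmod_closed (mem L) -> l_closed R L) -> metrizable R K.
Proof.
move=> lL.
have [X [XD X0 iX DX]] := maximal_independent zmod_closed_characters.
have [cX|nX] := pselect (countable X); last first.
  by have [H sH []] := independent_not_l_closed XD X0 iX nX; exact: lL.
have [e De eD] := countable_set_seq (0 : K -> circle R)
  (countable_torsion_over zmod_closed_characters cX DX).
have ce n : character (e n).
  by case: (eD n) => // ->; exact: character_cst0.
apply: (metrizable_of_character_seq ce cK hK) => x x0.
apply: (@characters_separate R K cK hK) => f cf.
by have [n <-] := De f cf; rewrite x0 character0.
Qed.

End annihilator.

Theorem corollary3p7 (R : realType) (K : topologicalZmodType)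
    (compactK : compact [set: K]) (hausdorffK : hausdorff_space K)
    (H : set K) (subgroupH : GRing.zmod_closed (mem H)) :
  [/\ closed H -> l_closed R H,
      l_closed R H <-> realcompact R H,
      l_dense R H <-> dense H /\ pseudocompact R H &
      metrizable R K <->
        (forall L : set K, GRing.zmod_closed (mem L) -> l_closed R L)].
Proof.
split.
- exact: closed_l_closed.
- split; first exact: l_closed_realcompact.
  exact: realcompact_l_closed.
- split; first exact: l_dense_pseudocompact.
  by case; exact: pseudocompact_l_dense.
- split; first exact: metrizable_l_closed.
  exact: l_closed_metrizable.
Qed.
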